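(* Let $a<b$ be real, $T\in(0,\infty)$, $d\in\mathbb{N}$. Suppose that the initial function $\varphi$, the drift $\mu$ and the diffusion $\sigma$ of the linear Kolmogorov PDE described in the context satisfy one of the cases (i), (ii), (iii) listed there, let $F:(0,1)^{d+D}\to\mathbb{R}$ be the corresponding function given there ($D=d$ in cases (i), (ii), and $D=Md$ in case (iii)), and let $\mathcal{H}$, $\mathcal{L}$, $\mathcal{L}_n$, $f_{\mathcal{H}}$, $f_{n,\mathcal{H}}$ be as in the deep learning problem with uniform input described in the context for this $F$. Then: (i) Suppose that $(\boldsymbol{u}_{i})_{i=1}^{\infty}$ is the scrambled digital sequence (a scrambled $(t,d+D)$-sequence) in base $\beta\geq 2$, and let the sample size be $n=\beta^{m}$, $m\in \mathbb{N}$. Then for arbitrarily small $\epsilon>0$ (i.e. for every $\epsilon>0$) we have $$\mathbb{E}\left[ \mathcal{L}(f_{n,\mathcal{H}})-\mathcal{L}(f_{\mathcal{H}})\right] = O(n^{-1+\epsilon}).$$ (ii) Suppose that $(\boldsymbol{u}_{i})_{i=1}^{\infty}$ are i.i.d. samples from the uniform distribution over $(0,1)^{d+D}$. Then for arbitrarily small $\epsilon>0$ (i.e. for every $\epsilon>0$) we have $$\mathbb{E}\left[ \mathcal{L}(f_{n,\mathcal{H}})-\mathcal{L}(f_{\mathcal{H}})\right] = O(n^{-\frac{1}{2}+\epsilon}).$$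
   Context: **PDE and the three cases.** The linear Kolmogorov PDE is $\nabla_t u(t,x)=\frac12\mathrm{Trace}\big(\sigma(x)\sigma(x)^*\nabla_x^2u(t,x)\big)+\langle\mu(x),\nabla_xu(t,x)\rangle$, $u(0,x)=\varphi(x)$, $x\in\mathbb{R}^d$. Assume that $\varphi\in C^\infty(\mathbb{R}^d,\mathbb{R})$ has polynomially growing partial derivatives (of all orders, including $\varphi$ itself), and one of: (i) $\mu(x)\equiv\overline\mu$ and $\sigma(x)\equiv\overline\sigma$; (ii) $\mu(x)=\mathrm{diag}(x_1,\dots,x_d)\overline\mu$ and $\sigma(x)=\mathrm{diag}(x_1,\dots,x_d)\overline\sigma$; (iii) $\mu:\mathbb{R}^d\to\mathbb{R}^d$ and $\sigma:\mathbb{R}^d\to\mathbb{R}^{d\times d}$ are both affine transformations; where $\overline\mu\in\mathbb{R}^d$, $\overline\sigma\in\mathbb{R}^{d\times d}$. **The function $F$.** Let $\Phi^{-1}$ be the inverse of the standard normal distribution function, applied componentwise, let $u_{j:k}=(u_j,\dots,u_k)$, and put $x=a+(b-a)u_{1:d}$ (componentwise). In case (i): $F(u)=\varphi(\overline\mu T+x+\overline\sigma z)$ for $u\in(0,1)^{2d}$, with $z=\sqrt T\,\Phi^{-1}(u_{(d+1):2d})$. In case (ii): $F(u)=\varphi(s_1,\dots,s_d)$ for $u\in(0,1)^{2d}$, with $s_i=x_i\exp\big((\mu_i-\frac12\|\sigma_i\|_2^2)T+\langle\sigma_i,z\rangle\big)$, where $\mu_i$ is the $i$th component of $\overline\mu$,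 $\sigma_i$ the $i$th row of $\overline\sigma$, and $z$ is as in case (i). In case (iii): fix $M\in\mathbb{N}$ (number of Euler–Maruyama steps). For $u\in(0,1)^{d+Md}$ put $z_i=\sqrt{T/M}\,\Phi^{-1}(u_{(id+1):(id+d)})$, $1\le i\le M$, and $s^{(0)}=x$, $s^{(m+1)}=s^{(m)}+\mu(s^{(m)})\frac TM+\sigma(s^{(m)})z_{m+1}$, $0\le m\le M-1$. Then $s^{(M)}=(P_1(x,z_1,\dots,z_M),\dots,P_d(x,z_1,\dots,z_M))$ with polynomials $P_1,\dots,P_d:\mathbb{R}^{d+Md}\to\mathbb{R}$, and $F(u)=\varphi(P_1(x,z_1,\dots,z_M),\dots,P_d(x,z_1,\dots,z_M))$. **Deep learning problem with uniform input.** Let $U=(U_1,U_2)$ be uniform on $(0,1)^{d+D}$ with $U_1\in(0,1)^d$, $U_2\in(0,1)^D$. The input and output are $X=a+(b-a)U_1$ and $Y=F(U)$. Let $\boldsymbol{u}_i=(\boldsymbol{u}_{i,1},\boldsymbol{u}_{i,2})$, $i\in\mathbb{N}$, be random variables each with the distribution of $U$ (not necessarily independent), and set $\boldsymbol{x}_i=a+(b-a)\boldsymbol{u}_{i,1}$, $\boldsymbol{y}_i=F(\boldsymbol{u}_i)$. Define $$\mathcal{L}(f)=\mathbb{E}[(f(X)-Y)^2],\qquad \mathcal{L}_n(f)=\frac1n\sum_{i=1}^n[f(\boldsymbol{x}_i)-\boldsymbol{y}_i]^2 .$$ For the random function $f_{n,\mathcal{H}}$ below, $\mathcal{L}(f_{n,\mathcal{H}})$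 is the functional $\mathcal{L}$ evaluated at the realization of $f_{n,\mathcal{H}}$; the outer expectation is over the data. **Hypothesis class.** Let $L\ge2$, $S=(N_0,\dots,N_L)=(d,N_1,\dots,N_{L-1},1)\in\mathbb{N}^{L+1}$, $R\in(0,\infty)$ and $\rho(x)=\frac{x}{1+\exp(-x)}$ (swish). For $\theta=((A_l,B_l))_{l=1}^L$ with $A_l\in\mathbb{R}^{N_l\times N_{l-1}}$, $B_l\in\mathbb{R}^{N_l}$, put $W_l(x)=A_lx+B_l$ and $\Phi_\theta=W_L\circ\rho\circ W_{L-1}\circ\rho\cdots\circ\rho\circ W_1$, with $\rho$ applied componentwise. Let $\Theta_R=\{\theta:\|\theta\|_\infty\le R\}$ and $\mathcal{H}=\{\Phi_\theta|_{[a,b]^d}:\theta\in\Theta_R\}$. The class $\mathcal{H}$ is kept fixed as $n$ varies. Define $f_{\mathcal{H}}=\operatorname{argmin}_{f\in\mathcal{H}}\mathcal{L}(f)$ and $f_{n,\mathcal{H}}=\operatorname{argmin}_{f\in\mathcal{H}}\mathcal{L}_n(f)$. **Scrambled $(t,s)$-sequences in base $\beta$.** An elementary interval in base $\beta$ is a set $\prod_{j=1}^s[c_j\beta^{-k_j},(c_j+1)\beta^{-k_j})$ with integers $k_j\ge 0$, $0\le c_j<\beta^{k_j}$. A set of $\beta^m$ points in $[0,1)^s$ is a $(t,m,s)$-net (integers $0\le t\le m$) if every elementary interval of volume $\beta^{t-m}$ contains exactly $\beta^t$ of them. A sequence $(a_i)_{i\ge1}$ in $[0,1)^s$ is a $(t,s)$-sequence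 if for all integers $k\ge0$, $m\ge t$ the points $a_i$ with $k\beta^m<i\le(k+1)\beta^m$ form a $(t,m,s)$-net. A scrambled $(t,s)$-sequence $(\boldsymbol{u}_i)$ is obtained from a $(t,s)$-sequence by Owen's nested uniform scrambling: if the $j$th coordinate of $a_i$ is $\sum_{k\ge1}a_{i,j,k}\beta^{-k}$, the $j$th coordinate of $\boldsymbol{u}_i$ is $\sum_{k\ge1}x_{i,j,k}\beta^{-k}$ with $x_{i,j,k}=\pi_{j;a_{i,j,1},\dots,a_{i,j,k-1}}(a_{i,j,k})$, all permutations $\pi_{j;\cdot}$ of $\{0,\dots,\beta-1\}$ being mutually independent and uniformly distributed. It has the properties: (i) every $\boldsymbol{u}_i$ is uniform on $(0,1)^s$; (ii) it is a $(t,s)$-sequence in base $\beta$ with probability 1; (iii) there is a constant $B'$ such that for every $m\in\mathbb{N}$ and $n=\beta^m$, with probability 1, the star discrepancy satisfies $D^*(\boldsymbol{u}_1,\dots,\boldsymbol{u}_n)\le B'(\log n)^s/n$. *)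

(* Defs.v *)
From HB Require Import structures.
From mathcomp Require Import all_boot all_order all_algebra all_fingroup.
From mathcomp Require Import all_classical all_reals all_analysis.

Set Implicit Arguments.
Unset Strict Implicit.
Unset Printing Implicit Defensive.

Import Order.TTheory GRing.Theory Num.Theory.
Import numFieldNormedType.Exports.

Local Open Scope classical_set_scope.
Local Open Scope ring_scope.

Definition iter_partial (R : realType) (d : nat) (f : 'cV[R]_d -> R)
    (s : seq 'I_d) : 'cV[R]_d -> R :=
  foldr (fun i g => fun x => 'D_(delta_mx i ord0) g x) f s.

Definition smooth (R : realType) (d : nat) (f : 'cV[R]_d -> R) : Prop :=
  forall s : seq 'I_d,
    continuous (iter_partial f s) /\
    forall (i : 'I_d) (x : 'cV[R]_d),
      derivable (iter_partial f s) x (delta_mx i ord0).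

(* The empty [s] gives the growth of [f] itself; [`|x|] is the max-norm, which
   is equivalent to the Euclidean one. *)
Definition poly_growing_partials (R : realType) (d : nat)
    (f : 'cV[R]_d -> R) : Prop :=
  forall s : seq 'I_d, exists (C : R) (k : nat),
    forall x : 'cV[R]_d, `|iter_partial f s x| <= C * (1 + `|x| ^+ k).

Definition affine_map (R : realType) (V W : lmodType R) (f : V -> W) : Prop :=
  exists (g : {linear V -> W}) (c : W), forall x, f x = g x + c.

(* The inverse of the standard normal distribution function; [xget] picks the
   unique preimage when 0 < p < 1 and returns 0 for the other values of [p]. *)
Definition normal_quantile (R : realType) (p : R) : R :=
  xget 0 [set x : R | normal_prob 0 1 `]-oo, x] = p%:E].

Definition input (R : realType) (a b : R) (d D : nat)
    (u : 'cV[R]_(d + D)) : 'cV[R]_d :=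
  const_mx a + (b - a) *: usubmx u.

Definition F_additive (R : realType) (d : nat) (phi : 'cV[R]_d -> R)
    (mubar : 'cV[R]_d) (sigmabar : 'M[R]_d) (a b T : R)
    (u : 'cV[R]_(d + d)) : R :=
  let x := input a b u in
  let z := Num.sqrt T *: map_mx (@normal_quantile R) (dsubmx u) in
  phi (T *: mubar + x + sigmabar *m z).

Definition F_geometric (R : realType) (d : nat) (phi : 'cV[R]_d -> R)
    (mubar : 'cV[R]_d) (sigmabar : 'M[R]_d) (a b T : R)
    (u : 'cV[R]_(d + d)) : R :=
  let x := input a b u in
  let z := Num.sqrt T *: map_mx (@normal_quantile R) (dsubmx u) in
  phi (\col_i (x i ord0 *
    expR ((mubar i ord0 - 2^-1 * (\sum_j sigmabar i j ^+ 2)) * T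
          + \sum_j sigmabar i j * z j ord0))).

(* [vec_mx] is row-major, so row i of the M x d matrix below (0 <= i < M) is
   the block of coordinates d + i d + 1, ..., d + i d + d of [u]. *)
Definition F_euler (R : realType) (d M : nat) (phi : 'cV[R]_d -> R)
    (mu : 'cV[R]_d -> 'cV[R]_d) (sigma : 'cV[R]_d -> 'M[R]_d) (a b T : R)
    (u : 'cV[R]_(d + M * d)) : R :=
  let w : 'M[R]_(M, d) := vec_mx (dsubmx u)^T in
  let z (i : 'I_M) : 'cV[R]_d :=
    Num.sqrt (T / M%:R) *: map_mx (@normal_quantile R) (row i w)^T in
  phi (foldl (fun s i => s + (T / M%:R) *: mu s + sigma s *m z i)
             (input a b u) (enum 'I_M)).

Inductive kolmogorov_F (R : realType) (d : nat) (phi : 'cV[R]_d -> R)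
    (mu : 'cV[R]_d -> 'cV[R]_d) (sigma : 'cV[R]_d -> 'M[R]_d) (a b T : R) :
    forall D : nat, ('cV[R]_(d + D) -> R) -> Prop :=
| kolmogorov_additive (mubar : 'cV[R]_d) (sigmabar : 'M[R]_d) :
    (forall x, mu x = mubar) ->
    (forall x, sigma x = sigmabar) ->
    kolmogorov_F phi mu sigma a b T (F_additive phi mubar sigmabar a b T)
| kolmogorov_geometric (mubar : 'cV[R]_d) (sigmabar : 'M[R]_d) :
    (forall x, mu x = diag_mx x^T *m mubar) ->
    (forall x, sigma x = diag_mx x^T *m sigmabar) ->
    kolmogorov_F phi mu sigma a b T (F_geometric phi mubar sigmabar a b T)
| kolmogorov_affine (M : nat) :
    affine_map mu -> affine_map sigma -> (0 < M)%N ->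
    kolmogorov_F phi mu sigma a b T (@F_euler R d M phi mu sigma a b T).

Definition swish (R : realType) (x : R) : R := x / (1 + expR (- x)).

(* Parameters of the networks with input dimension [n], hidden widths [h] and
   output dimension 1. *)
Fixpoint params (R : realType) (n : nat) (h : seq nat) : Type :=
  if h is m :: h' then ('M[R]_(m, n) * 'cV[R]_m * params R m h')%type
  else ('M[R]_(1, n) * 'cV[R]_1)%type.

Fixpoint network (R : realType) (n : nat) (h : seq nat) :
    params R n h -> 'cV[R]_n -> R :=
  match h return params R n h -> 'cV[R]_n -> R with
  | [::] => fun th x => (th.1 *m x + th.2) ord0 ord0
  | m :: h' => fun th x =>
      network th.2 (map_mx (@swish R) (th.1.1 *m x + th.1.2))
  end.

(* On matrices [`|A|] is the max-norm, so this is ||th||_oo <= r. *)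
Fixpoint params_bounded (R : realType) (r : R) (n : nat) (h : seq nat) :
    params R n h -> Prop :=
  match h return params R n h -> Prop with
  | [::] => fun th => `|th.1| <= r /\ `|th.2| <= r
  | m :: h' => fun th =>
      [/\ `|th.1.1| <= r, `|th.1.2| <= r & params_bounded r th.2]
  end.

Definition cube (R : realType) (a b : R) (d : nat) : set 'cV[R]_d :=
  [set x | forall i, a <= x i ord0 <= b].
Arguments cube {R} a b d.

Definition hypothesis_class (R : realType) (a b r : R) (d : nat)
    (h : seq nat) : set ('cV[R]_d -> R) :=
  [set f | exists th : params R d h,
     params_bounded r th /\ f = network th \_ (cube a b d)].
Arguments hypothesis_class {R} a b r d h.

Definition risk (d0 : measure_display) (T0 : measurableType d0) (R : realType)
    (P0 : probability T0 R) (d D : nat) (U : T0 -> 'cV[R]_(d + D))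
    (F : 'cV[R]_(d + D) -> R) (a b : R) (f : 'cV[R]_d -> R) : \bar R :=
  'E_P0[fun w => (f (input a b (U w)) - F (U w)) ^+ 2].

(* Samples are numbered from 0. *)
Definition empirical_risk (R : realType) (d D : nat) (n : nat)
    (u : nat -> 'cV[R]_(d + D)) (F : 'cV[R]_(d + D) -> R) (a b : R)
    (f : 'cV[R]_d -> R) : R :=
  n%:R^-1 * \sum_(i < n) (f (input a b (u i)) - F (u i)) ^+ 2.

Definition is_argmin (disp : Order.disp_t) (V : porderType disp) (X : Type)
    (A : set X) (J : X -> V) (x : X) : Prop :=
  A x /\ forall y, A y -> (J x <= J y)%O.

(* A random function with values in [H] that almost surely minimizes the
   empirical risk over [H]; minimizers need not be unique, and [f] is any
   choice of them for which all evaluations are random variables. *)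
Definition empirical_minimizer (dO : measure_display) (Omega : measurableType dO)
    (R : realType) (P : probability Omega R) (d D n : nat)
    (u : nat -> Omega -> 'cV[R]_(d + D)) (F : 'cV[R]_(d + D) -> R) (a b : R)
    (H : set ('cV[R]_d -> R)) (f : Omega -> 'cV[R]_d -> R) : Prop :=
  [/\ forall w, H (f w),
      forall x, measurable_fun setT (fun w => f w x) &
      {ae P, forall w,
         is_argmin H (empirical_risk n (u ^~ w) F a b) (f w)}].

Definition borel (E : topologicalType) : set (set E) :=
  <<s [set A : set E | open A] >>.

Definition uniform_vector (dO : measure_display) (Omega : measurableType dO)
    (R : realType) (P : probability Omega R) (s : nat)
    (X : Omega -> 'cV[R]_s) : Prop :=
  (forall B, borel B -> measurable (X @^-1` B)) /\
  forall B : 'I_s -> set R, (forall j, measurable (B j)) ->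
    P [set w | forall j, B j (X w j ord0)] =
    (\big[*%E/1]_(j < s) lebesgue_measure (B j `&` `]0%R, 1%R[%classic))%E.

(* Mutual independence of a family of random elements of [E], where [G] is the
   sigma-algebra of [E]. *)
Definition mutually_independent (dO : measure_display)
    (Omega : measurableType dO) (R : realType) (P : probability Omega R)
    (I : eqType) (E : Type) (G : set (set E)) (X : I -> Omega -> E) : Prop :=
  forall (J : seq I) (B : I -> set E), uniq J -> (forall i, G (B i)) ->
    P (\bigcap_(i in [set` J]) (X i @^-1` B i)) =
    (\big[*%E/1]_(i <- J) P (X i @^-1` B i))%E.

Definition iid_uniform (dO : measure_display) (Omega : measurableType dO)
    (R : realType) (P : probability Omega R) (s : nat)
    (u : nat -> Omega -> 'cV[R]_s) : Prop :=
  (forall i, uniform_vector P (u i)) /\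
  mutually_independent P (@borel 'cV[R]_s) u.

Definition elementary_interval (R : realType) (beta s : nat)
    (k c : 'I_s -> nat) : set 'cV[R]_s :=
  [set x | forall j, (c j)%:R / (beta ^ k j)%:R <= x j ord0
                     < (c j).+1%:R / (beta ^ k j)%:R].
Arguments elementary_interval R beta {s} k c.

(* Points are counted with multiplicity; an elementary interval with
   exponents [k] has volume [beta ^ - (\sum_j k j)]. *)
Definition is_net (R : realType) (beta t m s : nat)
    (p : 'I_(beta ^ m) -> 'cV[R]_s) : Prop :=
  (t <= m)%N /\
  forall k c : 'I_s -> nat, (forall j, c j < beta ^ k j)%N ->
    (\sum_j k j = m - t)%N ->
    #|[pred i | p i \in elementary_interval R beta k c]| = (beta ^ t)%N.

(* Points are numbered from 0. *)
Definition is_ts_sequence (R : realType) (beta t s : nat)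
    (x : nat -> 'cV[R]_s) : Prop :=
  (forall i j, 0 <= x i j ord0 < 1) /\
  forall k m : nat, (t <= m)%N ->
    is_net t (fun r : 'I_(beta ^ m) => x (k * beta ^ m + r)%N).

(* [digit hb x k] is the coefficient of [beta ^ - (k + 1)] in the expansion of
   [x] in [0, 1[ that does not end in an infinite run of [beta - 1]. *)
Definition digit (R : realType) (beta : nat) (hb : (1 < beta)%N) (x : R)
    (k : nat) : 'I_beta :=
  Ordinal (ltn_pmod (Num.truncn (x * (beta ^ k.+1)%:R)) (ltnW hb)).

(* The permutation applied to digit [k] is indexed by the preceding digits of
   the unscrambled coordinate. *)
Definition scramble (R : realType) (beta : nat) (hb : (1 < beta)%N)
    (pi : seq 'I_beta -> {perm 'I_beta}) (x : R) : R :=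
  limn (series (fun k : nat =>
    (pi [seq digit hb x l | l <- iota 0 k] (digit hb x k))%:R
    / (beta ^ k.+1)%:R : R)).

Definition scrambled_ts_sequence (dO : measure_display)
    (Omega : measurableType dO) (R : realType) (P : probability Omega R)
    (beta : nat) (hb : (1 < beta)%N) (t s : nat)
    (u : nat -> Omega -> 'cV[R]_s) : Prop :=
  exists (x : nat -> 'cV[R]_s)
         (pi : 'I_s * seq 'I_beta -> Omega -> {perm 'I_beta}),
    [/\ is_ts_sequence beta t x,
        forall (k : 'I_s * seq 'I_beta) (g : {perm 'I_beta}),
          measurable (pi k @^-1` [set g]) /\
          P (pi k @^-1` [set g]) = ((beta`!)%:R^-1)%:E,
        mutually_independent P [set: set {perm 'I_beta}] pi &
        forall i w j,
          u i w j ord0 = scramble hb (fun l => pi (j, l) w) (x i j ord0)].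

(* Main.v *)
Require Import Defs.
From HB Require Import structures.
From mathcomp Require Import all_boot all_order all_algebra all_fingroup.
From mathcomp Require Import all_classical all_reals all_analysis.
From mathcomp Require Import measurable_realfun ring lra zify.

Set Implicit Arguments.
Unset Strict Implicit.
Unset Printing Implicit Defensive.

Import Order.TTheory GRing.Theory Num.Theory.
Import numFieldNormedType.Exports.

Local Open Scope classical_set_scope.
Local Open Scope ring_scope.

(** The excess risk of an empirical minimizer is at most twice the largest
    deviation, over the hypothesis class, of the empirical risk from the risk.
    The risk is an integral over the unit cube and the empirical risk a
    quadrature rule for it, so the point is to bound the quadrature error for all
    networks simultaneously, although the integrand is unbounded: the normal
    quantile blows up at the boundary of the cube.

    In the coordinates [z] in which the Gaussian increments replace their uniform
    sources, the integrand is generated from bounded weights, coordinates,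
    exponentials of linear forms, sigmoids and derivatives of [phi].  This class
    ([tame]) is closed under partial differentiation and grows at most
    exponentially, uniformly in the weights.  On a grid of half-width
    [lam = eta * ln n] with [n] cells per axis, summation by parts
    ([box_expansion]) writes the rounded integrand as a combination of indicators
    of boxes, whose coefficients are mixed differences; by the mean value theorem
    ([tame_diffs]) these are bounded by mixed derivatives, and their total size is
    a small power of [n].  Rounding costs, up to such a power, [1 / n] inside the
    grid, and outside it an exponential moment times [1 / n] ([tame_round]).
    Increasing maps pull the boxes back to boxes with corner 1 in the unit cube
    ([tame_box_approximation]).

    Hence the deviation is bounded by a fixed combination of the errors with which
    the sample measures those boxes, plus the rounding error, and neither depends
    on the network.  Taking means ([expected_excess_risk]), it remains to know the
    mean box error and the exponential moments at a single sample point.  The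
    moments are finite as soon as the law of the point charges neighbourhoods of
    the faces at most proportionally to their width ([integral_inv_sqrt]).

    For independent samples a box error has mean at most [n `^ (- 1 / 2)], by the
    variance of a mean of indicators ([iid_box_error]).  For [n = beta ^ m] points
    of a net it is at most [beta ^ t * (1 + beta * m) ^ s / n], by subdividing the
    box into elementary intervals ([net_box_error]).  Scrambling almost surely
    permutes the elementary intervals of each shape, so it preserves nets
    ([scrambled_net]), and each scrambled point charges an elementary interval
    proportionally to its length ([scrambled_tails]).  The power of [m] and the
    powers of [n] with small exponent are absorbed in [n `^ eps]. *)

(** * The normal distribution function and its inverse *)

Section normal_quantile_theory.
Context {R : realType}.
Implicit Types x y p u : R.

Let measurable_pdf m (A : set R) :
  measurable_fun A (fun x => (normal_pdf m 1 x)%:E).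
Proof.
by apply: measurable_funTS; apply/measurable_EFinP; exact: measurable_normal_pdf.
Qed.

Definition ncdf y : R := fine (normal_prob 0 1 `]-oo, y] : \bar R).

Lemma normal_prob_ncdf y : normal_prob 0 1 `]-oo, y] = (ncdf y)%:E :> \bar R.
Proof. by rewrite /ncdf fineK// fin_num_measure. Qed.

Lemma ncdfB x y : x <= y ->
  (ncdf y - ncdf x)%:E = normal_prob 0 1 `]x, y] :> \bar R.
Proof.
move=> xy; have : (`]-oo, y] = `]-oo, x] `|` `]x, y] :> set R)%classic.
  by rewrite -itv_bndbnd_setU// bnd_simp.
move=> /(congr1 (normal_prob 0 1 : set R -> \bar R)).
rewrite measureU//=; last first.
  by rewrite -subset0 => z [/=]; rewrite !in_itv/= => zx /andP[]; rewrite ltNge zx.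
by rewrite !normal_prob_ncdf EFinB => ->; rewrite addeAC subee// add0e.
Qed.

Lemma ncdf1B y : (1 - ncdf y)%:E = normal_prob 0 1 `]y, +oo[ :> \bar R.
Proof.
have : (setT = `]-oo, y] `|` `]y, +oo[ :> set R)%classic.
  by rewrite -itv_bndbnd_setU// set_itvNyy.
move=> /(congr1 (normal_prob 0 1 : set R -> \bar R)).
rewrite probability_setT measureU//=; last first.
  by rewrite -subset0 => z [/=]; rewrite !in_itv/= andbT => zx; rewrite ltNge zx.
by rewrite !normal_prob_ncdf EFinB => ->; rewrite addeAC subee// add0e.
Qed.

(** The density is bounded below by its value at the endpoint of larger modulus,
    which is positive. *)
Lemma ncdf_lt x y : x < y -> ncdf x < ncdf y.
Proof.
move=> xy; rewrite -subr_gt0 -lte_fin ncdfB 1?ltW//.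
pose M := Num.max `|x| `|y|.
have M0 : 0 <= M by rewrite le_max normr_ge0.
have : ((normal_pdf 0 1 M)%:E * (y - x)%:E <= normal_prob 0 1 `]x, y])%E.
  have -> : (y - x)%:E = lebesgue_measure `]x, y]%classic :> \bar R.
    by rewrite lebesgue_measure_itv/= lte_fin xy.
  rewrite -integral_cst//; apply: ge0_le_integral => //=.
  - by move=> *; rewrite lee_fin normal_pdf_ge0.
  - exact: measurable_pdf.
  - move=> z; rewrite in_itv/= => /andP[xz zy].
    have zM : `|z| <= M.
      rewrite /M; case: (lerP 0 z) => z0; rewrite le_max.
        by rewrite (ger0_norm z0) (le_trans zy (ler_norm _)) orbT.
      have zx : - z <= `|x|.
        by rewrite -normrN (le_trans _ (ler_norm _))// lerN2 ltW.
      by rewrite (ltr0_norm z0) zx.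
    rewrite lee_fin !normal_pdfE ?oner_neq0//.
    rewrite ler_wpM2l ?normal_peak_ge0// /normal_fun ler_expR.
    rewrite !subr0 ler_wpM2r// ?invr_ge0 ?mulrn_wge0 ?sqr_ge0//.
    by rewrite lerN2 -(real_normK (num_real z)) ler_pXn2r// nnegrE.
apply: lt_le_trans.
rewrite mule_gt0// lte_fin ?subr_gt0// normal_pdfE ?oner_neq0//.
by rewrite mulr_gt0 ?normal_peak_gt0 ?oner_neq0 ?expR_gt0.
Qed.

Lemma ncdf_le : {mono ncdf : x y / x <= y}.
Proof. by apply: le_mono => x y; exact: ncdf_lt. Qed.

Lemma ncdf_lipschitz x y : x <= y -> ncdf y - ncdf x <= normal_peak 1 * (y - x).
Proof.
move=> xy; rewrite -lee_fin ncdfB// EFinM.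
have -> : (y - x)%:E = lebesgue_measure `]x, y]%classic :> \bar R.
  rewrite lebesgue_measure_itv/= lte_fin; case: ltgtP xy => // -> _.
  by rewrite subrr.
rewrite -integral_cst//; apply: ge0_le_integral => //=.
- by move=> *; rewrite lee_fin normal_pdf_ge0.
- exact: measurable_pdf.
- by move=> z _; rewrite lee_fin normal_pdf_ub// oner_neq0.
Qed.

Lemma continuous_ncdf : continuous ncdf.
Proof.
move=> x; apply/cvgrPdist_le => e e0.
have P0 : 0 < normal_peak (1 : R) by rewrite normal_peak_gt0 ?oner_neq0.
have e'0 : 0 < e / normal_peak 1 by rewrite divr_gt0.
near=> y.
have : `|x - y| <= e / normal_peak 1.
  by near: y; exists (e / normal_peak 1) => //= z /ltW.
rewrite ler_pdivlMr// => xy; apply: le_trans xy; rewrite [leRHS]mulrC.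
have [xy|/ltW yx] := leP x y.
  rewrite distrC ger0_norm ?subr_ge0 ?ncdf_le// (distrC x).
  by rewrite ger0_norm ?subr_ge0// ncdf_lipschitz.
by rewrite !ger0_norm ?subr_ge0 ?ncdf_le// ncdf_lipschitz.
Unshelve. all: by end_near. Qed.

(** Chernoff's bound: on a half line beyond [y] the standard normal density is
   at most [expR (K ^+ 2 / 2 - K * y)] times the density with mean [K] (or
   [- K] for the left tail), whose total mass is 1. *)
Lemma ncdf_tail K y :  0 <= K ->
  1 - ncdf y <= expR (K ^+ 2 / 2) * expR (- (K * y)) /\
  ncdf (- y) <= expR (K ^+ 2 / 2) * expR (- (K * y)).
Proof.
move=> K0; rewrite -!lee_fin ncdf1B -normal_prob_ncdf.
set c := expR _ * expR _.
have c0 : 0 <= c by rewrite mulr_ge0 ?expR_ge0.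
have main (m : R) (A : set R) : measurable A ->
    (forall z, A z -> normal_pdf 0 1 z <= c * normal_pdf m 1 z) ->
    (normal_prob 0 1 A <= c%:E)%E.
  move=> mA cA; apply: (@le_trans _ _ (c%:E * normal_prob m 1 A)%E).
    rewrite /normal_prob -ge0_integralZl//=; last 2 first.
    - exact: measurable_pdf.
    - by move=> z _; rewrite lee_fin normal_pdf_ge0.
    apply: ge0_le_integral => //=.
    - by move=> *; rewrite lee_fin normal_pdf_ge0.
    - exact: measurable_pdf.
    - under eq_fun do rewrite EFinM.
      by apply: measurable_funeM; exact: measurable_pdf.
  by rewrite -[leRHS]mule1 lee_wpmul2l ?lee_fin// probability_le1.
have ineq (m z : R) : (m = K /\ y <= z) \/ (m = - K /\ z <= - y) ->
    normal_pdf 0 1 z <= c * normal_pdf m 1 z.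
  move=> mz; rewrite !normal_pdfE ?oner_neq0// mulrCA.
  rewrite ler_wpM2l ?normal_peak_ge0// /normal_fun /c -!expRD ler_expR.
  rewrite expr1n -[1 *+ 2]/(2%:R).
  have : 0 <= K * (m / K * z - y) \/ K = 0.
    have [->|Kn0] := eqVneq K 0; [by right|left].
    rewrite mulr_ge0//; case: mz => -[-> zy].
      by rewrite divff// mul1r subr_ge0.
    by rewrite mulNr divff// mulN1r subr_ge0 lerNr.
  case=> [|K00]; last first.
    have -> : m = 0 by case: mz => -[-> _]; rewrite K00 ?oppr0.
    by rewrite K00; nra.
  have [K00|Kn0] := eqVneq K 0.
    have -> : m = 0 by case: mz => -[-> _]; rewrite K00 ?oppr0.
    by rewrite K00; nra.
  have -> : K * (m / K * z - y) = m * z - K * y by field.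
  have : m ^+ 2 = K ^+ 2 by case: mz => -[-> _]; rewrite ?sqrrN.
  by nra.
split.
  apply: (main K) => // z /=; rewrite in_itv/= andbT => yz.
  by apply: ineq; left; split => //; exact: ltW.
by apply: (main (- K)) => // z /=; rewrite in_itv/= => yz; apply: ineq; right.
Qed.

Lemma ncdf_surj p : 0 < p < 1 -> exists x, ncdf x = p.
Proof.
move=> /andP[p0 p1].
have h (q : R) : 0 < q -> exists y : R, 0 <= y /\
    expR (1 ^+ 2 / 2) * expR (- (1 * y)) <= q.
  move=> q0; set c := expR (1 ^+ 2 / 2).
  have c0 : 0 < c / q by rewrite divr_gt0 ?expR_gt0.
  exists (Num.max 0 (ln (c / q))); rewrite le_max lexx mul1r; split => //.
  rewrite expRN ler_pdivrMr ?expR_gt0// mulrC -ler_pdivrMr//.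
  by rewrite -{1}[c / q]lnK ?posrE// ler_expR le_max lexx orbT.
have [y [y0 hy]] := h _ p0.
have [y' [y'0 hy']] := h (1 - p) ltac:(by rewrite subr_gt0).
have [_ t1] := @ncdf_tail 1 y ler01.
have [t2 _] := @ncdf_tail 1 y' ler01.
have yy' : - y <= y' by rewrite (le_trans _ y'0)// oppr_le0.
have [||x _ ?] := @IVT R ncdf (- y) y' p yy'.
- exact/continuous_subspaceT/continuous_ncdf.
- rewrite ge_min le_max (le_trans t1 hy)/=; apply/orP; right.
  by have := le_trans t2 hy'; lra.
- by exists x.
Qed.

Lemma normal_quantileK p : 0 < p < 1 -> ncdf (normal_quantile p) = p.
Proof.
move=> p01; have [x xp] := ncdf_surj p01.
rewrite /normal_quantile; case: xgetP => [y _ /=|/(_ x)].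
  by rewrite normal_prob_ncdf => -[].
by case; rewrite /= normal_prob_ncdf xp.
Qed.

Lemma le_normal_quantile u y : 0 < u < 1 ->
  (y <= normal_quantile u) = (ncdf y <= u).
Proof. by move=> u01; rewrite -{2}(normal_quantileK u01) ncdf_le. Qed.

End normal_quantile_theory.

(** * The chain rule along coordinate axes *)

Section matrix_norm.
Context {R : realType} {m n : nat}.
Implicit Types A : 'M[R]_(m, n).

Lemma le_mx_norm A c : 0 <= c -> (`|A| <= c) <-> (forall i j, `|A i j| <= c).
Proof.
move=> c0; have -> : `|A| = \big[Num.max/0]_ij `|A ij.1 ij.2|; first exact: mx_normrE.
split => [/bigmax_leP[_ h] i j|h].
  exact: (h (i, j)).
by apply/bigmax_leP; split.
Qed.

Lemma coord_le_mx_norm A i j : `|A i j| <= `|A|.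
Proof. by have [h _] := le_mx_norm A (normr_ge0 A); exact: h. Qed.

End matrix_norm.

Section chain_rule.
Context {R : realType} {d : nat}.
Variable psi : 'cV[R]_d -> R.
Local Notation e_ i := (delta_mx i ord0 : 'cV[R]_d).
Hypothesis psi_derivable : forall i x, derivable psi x (e_ i).
Hypothesis psi_cont : forall i, continuous (fun x => 'D_(e_ i) psi x).

Let is_derive_slice x i (t : R) :
  is_derive t 1 (fun t : R => psi (x + t *: e_ i)) ('D_(e_ i) psi (x + t *: e_ i)).
Proof.
have E : (fun h : R => h^-1 *: (((fun t : R => psi (x + t *: e_ i)) \o shift t)
      (h *: (1 : R)) - psi (x + t *: e_ i))) =
    (fun h : R => h^-1 *: ((psi \o shift (x + t *: e_ i)) (h *: e_ i)
      - psi (x + t *: e_ i))).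
  apply/funext => h /=; congr (_ *: (psi _ - _)).
  by rewrite [h *: (1 : R)]mulr1 scalerDl addrCA addrA.
apply: DeriveDef; first by rewrite /derivable E; exact: psi_derivable.
by rewrite /derive E.
Qed.

Let mvt_slice x i (t : R) : exists2 s : R, `|s| <= `|t| &
  psi (x + t *: e_ i) - psi x = t * 'D_(e_ i) psi (x + s *: e_ i).
Proof.
have cont : continuous (fun t : R => psi (x + t *: e_ i)).
  move=> s; apply: differentiable_continuous; apply/derivable1_diffP.
  by case: (is_derive_slice x i s).
have [t0|/ltW t0] := leP 0 t.
  have [|s] := @MVT_segment R _ _ 0 t t0 (fun s _ => is_derive_slice x i s).
    exact: continuous_subspaceT.
  rewrite in_itv/= => /andP[s0 st]; rewrite scale0r addr0 subr0 => ->.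
  by exists s; rewrite ?ger0_norm// mulrC.
have [|s] := @MVT_segment R _ _ t 0 t0 (fun s _ => is_derive_slice x i s).
  exact: continuous_subspaceT.
rewrite in_itv/= => /andP[ts s0]; rewrite scale0r addr0 sub0r => E.
exists s; first by rewrite !ler0_norm// lerN2.
by rewrite -opprB E mulrN opprK mulrC.
Qed.

(** Moving from [x] to [x + eta] one coordinate at a time, the mean value theorem
    turns each step into a partial derivative at a point at most as far from [x]
    as [x + eta] is. *)
Let telescope_partials (x eta : 'cV[R]_d) : exists zeta : 'I_d -> 'cV[R]_d,
  (forall i, `|zeta i| <= `|eta|) /\
  psi (x + eta) - psi x = \sum_i eta i ord0 * 'D_(e_ i) psi (x + zeta i).
Proof.
pose part (s : seq 'I_d) : 'cV[R]_d := \sum_(i <- s) eta i ord0 *: e_ i.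
have partE s j : uniq s ->
    part s j ord0 = if j \in s then eta j ord0 else 0.
  move=> us; rewrite /part summxE.
  under eq_bigr do rewrite !mxE eqxx andbT mulr_natr mulrb.
  rewrite -big_mkcond/=.
  have [js|js] := boolP (j \in s).
    rewrite -big_filter (eq_filter (a2 := pred1 j)); last first.
      by move=> i /=; rewrite eq_sym.
    by rewrite filter_pred1_uniq// big_seq1.
  rewrite big_seq_cond big1// => i /andP[ins /eqP ji].
  by rewrite ji ins in js.
have H s : uniq s -> exists zeta : 'I_d -> 'cV[R]_d,
  (forall i, i \in s -> `|zeta i| <= `|eta|) /\
  psi (x + part s) - psi x =
    \sum_(i <- s) eta i ord0 * 'D_(e_ i) psi (x + zeta i).
  elim: s => [_|a s IH /= /andP[as_ us]].
    by exists (fun _ => 0); split=> //; rewrite /part !big_nil addr0 subrr.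
  have [zeta [zle zE]] := IH us.
  have [t tle tE] := mvt_slice (x + part s) a (eta a ord0).
  pose z' i := if i == a then part s + t *: e_ a else zeta i.
  exists z'; split.
    move=> i; rewrite inE /z'; case: eqVneq => [_ _|_]; last exact: zle.
    apply/le_mx_norm => // j k; rewrite (ord1 k).
    rewrite mxE [X in _ + X]mxE [X in _ + _ * X]mxE eqxx andbT partE//.
    have [->|ja] := eqVneq j a.
      rewrite (negbTE as_) add0r mulr1 (le_trans tle)//; exact: coord_le_mx_norm.
    rewrite mulr0 addr0; case: ifP => _; last by rewrite normr0.
    exact: coord_le_mx_norm.
  rewrite big_cons {1}/z' eqxx addrA -tE.
  have -> : \sum_(i <- s) eta i ord0 * 'D_(e_ i) psi (x + z' i) =
      \sum_(i <- s) eta i ord0 * 'D_(e_ i) psi (x + zeta i).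
    apply: eq_big_seq => i ins; rewrite /z'; case: eqVneq => // ia.
    by rewrite -ia ins in as_.
  rewrite -zE addrA subrK; congr (psi _ - _).
  by rewrite /part big_cons -!addrA; congr (_ + _); rewrite addrC.
have [zeta [zle zE]] := H (enum 'I_d) (enum_uniq _).
exists zeta; split; first by move=> i; apply: zle; rewrite mem_enum.
rewrite big_enum/= in zE; rewrite -zE; congr (psi (_ + _) - _).
by apply/colP => j; rewrite partE ?enum_uniq// mem_enum.
Qed.

(** Partial derivatives along the axes and their continuity are enough for the
    chain rule: in the telescoped increment of [psi] the intermediate points
    tend to [S t], so the partial derivatives there tend to those at [S t]. *)
Lemma is_derive_comp_partials (S : R -> 'cV[R]_d) (dS : 'I_d -> R) (t : R) :
  (forall i, is_derive t 1 (fun s => S s i ord0) (dS i)) ->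
  is_derive t 1 (fun s => psi (S s)) (\sum_i 'D_(e_ i) psi (S t) * dS i).
Proof.
move=> hS.
pose eta h : 'cV[R]_d := S (h + t) - S t.
have /choice[zeta zetaP] h := telescope_partials (S t) (eta h).
have cvgS i : (S (h + t) i ord0 - S t i ord0) @[h --> 0^'] --> (0 : R).
  have c : (fun s => S s i ord0) @ t --> S t i ord0.
    apply: differentiable_continuous; apply/derivable1_diffP.
    by case: (hS i).
  have c0 : (S (h + t) i ord0 - S t i ord0) @[h --> (0 : R)] --> (0 : R).
    rewrite -{2}(subrr (S t i ord0)); apply: cvgB; last exact: cvg_cst.
    have : h + t @[h --> (0 : R)] --> t.
      by rewrite -{2}[t]add0r; apply: cvgD; [exact: cvg_id|exact: cvg_cst].
    by move=> ht; apply: (cvg_comp _ _ ht c).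
  exact: cvg_within_filter c0.
have cvg_eta : eta h @[h --> 0^'] --> (0 : 'cV[R]_d).
  apply/cvgr0Pnorm_le => e e0.
  have : \forall h \near 0^', forall i, `|S (h + t) i ord0 - S t i ord0| <= e.
    apply: filter_forall => i; exact: cvgr0_norm_le.
  apply: filterS => h hle; apply/le_mx_norm; first exact: ltW.
  by move=> i j; rewrite (ord1 j) !mxE.
have cvgz i : zeta h i @[h --> 0^'] --> (0 : 'cV[R]_d).
  apply/cvgr0Pnorm_le => e e0.
  have /cvgr0Pnorm_le/(_ e e0) := cvg_eta.
  by apply: filterS => h; apply: le_trans; case: (zetaP h) => + _; exact.
have cvgE : (h^-1 *: (((fun s => psi (S s)) \o shift t) (h *: (1 : R)) - psi (S t)))
    @[h --> 0^'] --> \sum_i 'D_(e_ i) psi (S t) * dS i.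
  have -> : (fun h : R => h^-1 *: (((fun s => psi (S s)) \o shift t)
      (h *: (1 : R)) - psi (S t))) = (fun h : R => \sum_i
      'D_(e_ i) psi (S t + zeta h i) * (h^-1 * (S (h + t) i ord0 - S t i ord0))).
    apply/funext => h /=.
    have [_] := zetaP h.
    have -> : S t + eta h = S (h + t) by rewrite /eta addrC subrK.
    move=> zE.
    rewrite [h *: (1 : R)]mulr1 zE scaler_sumr; apply: eq_bigr => i _.
    rewrite [h^-1 *: _]mulrA [RHS]mulrC; congr (_ * _).
    by rewrite !mxE.
  apply: (@cvg_big _ _ +%R 0 xpredT _ _ _ _ (fun i (h : R) =>
    'D_(e_ i) psi (S t + zeta h i) * (h^-1 * (S (h + t) i ord0 - S t i ord0))))
    => [|i _]; first exact: add_continuous.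
  apply: cvgM.
    have cz : S t + zeta h i @[h --> 0^'] --> S t.
      rewrite -[X in _ --> X]addr0; apply: cvgD; first exact: cvg_cst.
      exact: cvgz.
    exact: (cvg_comp _ _ cz (@psi_cont i (S t))).
  have [] := hS i; rewrite /derivable /derive => dc <-.
  have -> : (fun h : R => h^-1 * (S (h + t) i ord0 - S t i ord0)) =
     (fun h : R => h^-1 *: (((fun s => S s i ord0) \o shift t) (h *: (1 : R))
         - S t i ord0)).
    by apply/funext => h /=; rewrite [h *: (1 : R)]mulr1.
  exact: dc.
apply: DeriveDef; first by apply/cvg_ex; eexists; exact: cvgE.
exact: cvg_lim cvgE.
Qed.

End chain_rule.

(** * Tame functions *)

(** The derivative of the sigmoid is a polynomial in the sigmoid itself and
    [swish x] is [x * sigmoid x]: this is what makes the activation tame. *)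
Definition sigmoid {R : realType} (x : R) : R := (1 + expR (- x))^-1.

Section sigmoid_theory.
Context {R : realType}.
Implicit Types x : R.

Lemma norm_sigmoid_le1 x : `|sigmoid x| <= 1.
Proof.
have e0 := expR_gt0 (- x).
rewrite ger0_norm ?invr_ge0 ?addr_ge0 ?expR_ge0//.
by rewrite invf_le1 ?lerDl ?expR_ge0// ltr_wpDr// ltW.
Qed.

Lemma is_derive_sigmoid x :
  is_derive x 1 (@sigmoid R) (sigmoid x * (1 - sigmoid x)).
Proof.
have e0 : 0 < 1 + expR (- x) by rewrite addr_gt0// expR_gt0.
have dN : is_derive x (1 : R) (fun y : R => expR (- y)) (expR (- x) * (- 1)).
  exact: is_derive1_comp.
have dD : is_derive x (1 : R) (fun y : R => 1 + expR (- y)) (0 + expR (- x) * (- 1)).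
  exact: is_deriveD.
have dV := @is_deriveV R (fun y => 1 + expR (- y)) x _ _ (lt0r_neq0 e0) dD.
refine (is_derive_eq dV _).
rewrite /sigmoid -[LHS]/(_ * _).
by have := lt0r_neq0 e0; set E := expR _ => ?; field.
Qed.

End sigmoid_theory.

Section coordinate_update.
Context {R : realType} {s : nat}.
Local Notation point := ('I_s -> R).
Implicit Types (z : point) (g : point -> R) (i j : 'I_s).

Definition upd z j y : point := fun i => if i == j then y else z i.

Lemma upd_same z j y : upd z j y j = y.
Proof. by rewrite /upd eqxx. Qed.

Lemma upd_id z j : upd z j (z j) = z.
Proof. by apply/funext => i; rewrite /upd; case: eqP => // ->. Qed.

Lemma upd_upd z j y y' : upd (upd z j y) j y' = upd z j y'.
Proof. by apply/funext => i; rewrite /upd; case: eqP. Qed.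

Lemma updC z i j y y' : i != j ->
  upd (upd z i y) j y' = upd (upd z j y') i y.
Proof.
move=> ij; apply/funext => k; rewrite /upd.
by case: eqVneq => // ->; rewrite eq_sym (negbTE ij).
Qed.

(** Differentiating one coordinate at a time avoids any topology on the space
    ['I_s -> R] of points. *)
Definition has_partial j g g' :=
  forall z, is_derive (z j) 1 (fun y => g (upd z j y)) (g' z).

Lemma has_partial_at j g g' z (y : R) : has_partial j g g' ->
  is_derive y 1 (fun y => g (upd z j y)) (g' (upd z j y)).
Proof.
move=> /(_ (upd z j y)); rewrite upd_same.
by congr (is_derive _ _ _ _); apply/funext => t; rewrite upd_upd.
Qed.

Lemma has_partial_mvt j g g' z (y1 y2 : R) : has_partial j g g' -> y1 <= y2 ->
  exists2 y, y1 <= y <= y2 &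
    g (upd z j y2) - g (upd z j y1) = g' (upd z j y) * (y2 - y1).
Proof.
move=> gg' y12.
have d (y : R) : is_derive y 1 (fun y => g (upd z j y)) (g' (upd z j y)).
  exact: has_partial_at.
have [|y] := @MVT_segment R _ _ y1 y2 y12 (fun y _ => d y).
  apply: continuous_subspaceT => y.
  apply: differentiable_continuous; apply/derivable1_diffP.
  by case: (d y).
by rewrite in_itv/= => ? ?; exists y.
Qed.

Definition l1norm z := \sum_j `|z j|.

Lemma l1norm_ge0 z : 0 <= l1norm z.
Proof. by apply: sumr_ge0. Qed.

Lemma le_l1norm z j : `|z j| <= l1norm z.
Proof. by rewrite /l1norm (bigD1 j)//= lerDl sumr_ge0. Qed.

End coordinate_update.

Section tame_functions.
Context {R : realType} {s d : nat} {Theta : Type}.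
Variable phi : 'cV[R]_d -> R.
Hypothesis phi_smooth : smooth phi.
Hypothesis phi_growth : poly_growing_partials phi.
Local Notation point := ('I_s -> R).
Implicit Types G : Theta -> point -> R.

(** The functions of the coordinates [z] that the learning problem is built
    from, as families indexed by [Theta].  The class is generated so that it is
    closed under partial differentiation, and every generator grows at most
    exponentially in [z], uniformly in the index: these two facts, each proved
    by induction on the generation, bound all mixed partial derivatives at
    once. *)
Inductive tame : (Theta -> point -> R) -> Prop :=
| tame_param (w : Theta -> R) :
    (exists B, forall th, `|w th| <= B) -> tame (fun th _ => w th)
| tame_coord (j : 'I_s) : tame (fun _ z => z j)
| tame_exp (c : 'I_s -> R) : tame (fun _ z => expR (\sum_j c j * z j))
| tame_add G1 G2 : tame G1 -> tame G2 -> tame (fun th z => G1 th z + G2 th z)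
| tame_mul G1 G2 : tame G1 -> tame G2 -> tame (fun th z => G1 th z * G2 th z)
| tame_sigmoid G : tame G -> tame (fun th z => sigmoid (G th z))
| tame_phi (l : seq 'I_d) (S : 'I_d -> Theta -> point -> R) :
    (forall i, tame (S i)) ->
    tame (fun th z => iter_partial phi l (\col_i S i th z)).

Lemma tame_cst (c : R) : tame (fun _ _ => c).
Proof. by apply: (@tame_param (fun _ => c)); exists `|c|. Qed.

Lemma tame_sum n (S : 'I_n -> Theta -> point -> R) :
  (forall i, tame (S i)) -> tame (fun th z => \sum_i S i th z).
Proof.
elim: n S => [|n IH] S hS.
  have -> : (fun th z => \sum_(i < 0) S i th z) = (fun _ _ => 0).
    by apply/funext => th; apply/funext => z; rewrite big_ord0.
  exact: tame_cst.
have -> : (fun th z => \sum_(i < n.+1) S i th z) =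
   (fun th z => S ord0 th z + \sum_(i < n) S (lift ord0 i) th z).
  by apply/funext => th; apply/funext => z; rewrite big_ord_recl.
by apply: tame_add => //; apply: IH.
Qed.

Lemma tame_growth G : tame G -> exists C c, [/\ 0 <= C, 0 <= c &
  forall th z, `|G th z| <= C * expR (c * l1norm z)].
Proof.
have e1 (c : R) z : 0 <= c -> 1 <= expR (c * l1norm (z : point)).
  by move=> c0; rewrite -expR0 ler_expR mulr_ge0// l1norm_ge0.
elim=> [w [B hB]|j|c|G1 G2 _ [C1 [c1 [C10 c10 h1]]] _ [C2 [c2 [C20 c20 h2]]]
       |G1 G2 _ [C1 [c1 [C10 c10 h1]]] _ [C2 [c2 [C20 c20 h2]]]
       |G0 _ _|l S _ IH].
- exists `|B|, 0; split=> // th z; rewrite mul0r expR0 mulr1.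
  exact: le_trans (hB th) (ler_norm _).
- exists 1, 1; split=> // _ z; rewrite !mul1r.
  rewrite (le_trans (le_l1norm z j))// (le_trans _ (expR_ge1Dx _))//.
  by rewrite lerDr.
- exists 1, (\sum_j `|c j|); split=> //; first exact: sumr_ge0.
  move=> _ z; rewrite mul1r ger0_norm ?expR_ge0// ler_expR.
  rewrite (le_trans (ler_norm _))// (le_trans (ler_norm_sum _ _ _))//.
  rewrite mulr_suml ler_sum// => j _; rewrite normrM.
  by rewrite ler_wpM2l// le_l1norm.
- exists (C1 + C2), (c1 + c2); split; rewrite ?addr_ge0// => th z.
  rewrite (le_trans (ler_normD _ _))// mulrDl lerD//.
    rewrite (le_trans (h1 th z))// ler_wpM2l// ler_expR.
    by rewrite ler_wpM2r ?l1norm_ge0// lerDl.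
  rewrite (le_trans (h2 th z))// ler_wpM2l// ler_expR.
  by rewrite ler_wpM2r ?l1norm_ge0// lerDr.
- exists (C1 * C2), (c1 + c2); split; rewrite ?addr_ge0 ?mulr_ge0// => th z.
  by rewrite normrM mulrDl expRD mulrACA ler_pM.
- exists 1, 0; split=> // th z; rewrite mul0r expR0 mulr1.
  exact: norm_sigmoid_le1.
- have [A [k hA]] := phi_growth l.
  have /choice[Cc hC] : forall i, exists Cc : R * R, [/\ 0 <= Cc.1, 0 <= Cc.2 &
      forall th z, `|S i th z| <= Cc.1 * expR (Cc.2 * l1norm z)].
    by move=> i; have [C [c ?]] := IH i; exists (C, c).
  pose C := \sum_i (Cc i).1; pose c := \sum_i (Cc i).2.
  have C0 : 0 <= C by apply: sumr_ge0 => i _; have [] := hC i.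
  have c0 : 0 <= c by apply: sumr_ge0 => i _; have [] := hC i.
  exists (`|A| * (1 + C ^+ k)), (c *+ k); split.
  + by rewrite mulr_ge0// addr_ge0// exprn_ge0.
  + exact: mulrn_wge0.
  + move=> th z; apply: le_trans (hA _) _.
    set x := \col_i _.
    have hx : `|x| <= C * expR (c * l1norm z).
      apply/le_mx_norm; first by rewrite mulr_ge0 ?expR_ge0.
      move=> i j; rewrite mxE; have [Ci0 ci0 hi] := hC i.
      rewrite (le_trans (hi th z))// ler_pM ?expR_ge0//.
        rewrite /C (bigD1 i)//= lerDl sumr_ge0// => i' _.
        by have [] := hC i'.
      rewrite ler_expR ler_wpM2r ?l1norm_ge0// /c (bigD1 i)//= lerDl.
      by rewrite sumr_ge0// => i' _; have [] := hC i'.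
    have hxk : `|x| ^+ k <= C ^+ k * expR (c *+ k * l1norm z).
      rewrite mulrnAl -mulr_natl expRM_natl -exprMn.
      by rewrite lerXn2r// nnegrE ?mulr_ge0 ?expR_ge0.
    rewrite -mulrA (le_trans (ler_norm _))// normrM ler_wpM2l//.
    rewrite ger0_norm ?addr_ge0 ?exprn_ge0// mulrDl mul1r lerD//.
    by apply: e1; rewrite mulrn_wge0.
Qed.

(** Each rule of generation is closed under the corresponding rule of
    differentiation; for [tame_phi] this uses that all the iterated partial
    derivatives of [phi] are generators too. *)
Lemma tame_partial G j : tame G -> exists2 G', tame G' &
  forall th, has_partial j (G th) (G' th).
Proof.
elim=> [w _|i|c|G1 G2 t1 [G1' t1' h1] t2 [G2' t2' h2]
       |G1 G2 t1 [G1' t1' h1] t2 [G2' t2' h2]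
       |G0 t0 [G0' t0' h0]|l S tS IH].
- exists (fun _ _ => 0); first exact: tame_cst.
  by move=> th z; exact: is_derive_cst.
- exists (fun _ _ => (i == j)%:R); first exact: tame_cst.
  move=> _ z; rewrite /upd; case: eqVneq => _; first exact: is_derive_id.
  exact: is_derive_cst.
- exists (fun _ z => c j * expR (\sum_j c j * z j)).
    exact: tame_mul (tame_cst _) (tame_exp _).
  move=> _ z; rewrite mulrC.
  have -> : (fun y => expR (\sum_i c i * upd z j y i)) =
      expR \o (fun y => \sum_i c i * upd z j y i) by [].
  have E : \sum_i c i * z i = \sum_i c i * upd z j (z j) i by rewrite upd_id.
  rewrite E; apply: is_derive1_comp.
  have -> : (fun y => \sum_i c i * upd z j y i) =
     (fun y => c j * y + \sum_(i | i != j) c i * z i).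
    apply/funext => y; rewrite (bigD1 j)//= upd_same; congr (_ + _).
    by apply: eq_bigr => i ij; rewrite /upd (negbTE ij).
  rewrite -[c j]addr0; apply: is_deriveD.
  rewrite addr0 -[X in is_derive _ _ _ X]mulr1; exact: is_deriveZ.
- exists (fun th z => G1' th z + G2' th z); first exact: tame_add.
  by move=> th z; exact: is_deriveD (h1 th z) (h2 th z).
- exists (fun th z => G1 th z * G2' th z + G2 th z * G1' th z).
    by apply: tame_add; exact: tame_mul.
  move=> th z; have := is_deriveM (h1 th z) (h2 th z); rewrite !upd_id.
  exact.
- exists (fun th z => sigmoid (G0 th z) * (1 + (-1) * sigmoid (G0 th z)) * G0' th z).
    apply: tame_mul => //; apply: tame_mul; first exact: tame_sigmoid.
    apply: tame_add; first exact: tame_cst.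
    by apply: tame_mul; [exact: tame_cst|exact: tame_sigmoid].
  move=> th z; have h := h0 th z.
  have dS := is_derive_sigmoid (G0 th (upd z j (z j))).
  have := is_derive1_comp dS h; rewrite upd_id mulN1r.
  exact.
- have /choice[S' hS'] : forall i, exists S' : Theta -> point -> R,
      tame S' /\ forall th, has_partial j (S i th) (S' th).
    by move=> i; have [S' ? ?] := IH i; exists S'.
  exists (fun th z => \sum_i iter_partial phi (i :: l) (\col_k S k th z)
     * S' i th z).
    apply: tame_sum => i; apply: tame_mul; first exact: tame_phi.
    by have [] := hS' i.
  move=> th z.
  have hd i x : derivable (iter_partial phi l) x (delta_mx i ord0).
    by have [_] := phi_smooth l; exact.
  have hc i : continuous (fun x => 'D_(delta_mx i ord0) (iter_partial phi l) x).
    by have [] := phi_smooth (i :: l).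
  have := @is_derive_comp_partials R d _ hd hc
    (fun y => \col_k S k th (upd z j y)) (fun i => S' i th z) (z j).
  rewrite upd_id; apply => i.
  have [_ /(_ th z)] := hS' i.
  by congr (is_derive _ _ _ _); apply/funext => y; rewrite mxE.
Qed.

End tame_functions.

(** * Summation by parts on a grid *)

Section grid.
Context {R : realType} {s : nat}.
Variables (lam : R) (N : nat).
Local Notation point := ('I_s -> R).
Implicit Types (z : point) (g : point -> R) (i j : 'I_s) (b : seq ('I_s * nat)).

Definition mesh : R := 2 * lam / N%:R.
Definition grid (k : nat) : R := - lam + k%:R * mesh.

(** Rounding down to the grid; a point left of the grid goes to its first node,
    a point right of it to its last one. *)
Definition round (t : R) : R :=
  grid (count (fun k => grid k <= t) (iota 1 N)).

(** The terms of the telescoping sum along coordinate [j] from the first node: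
    index 0 is the value there, index [k] the increment over the [k]th cell. *)
Definition diff_op j (k : nat) g : point -> R := fun z =>
  if k is k'.+1 then g (upd z j (grid k)) - g (upd z j (grid k'))
  else g (upd z j (grid 0)).

Definition diffs b g := foldl (fun g jk => diff_op jk.1 jk.2 g) g b.

(** A box is encoded by one lower node for each coordinate in [l]; node 0 stands
    for the absence of a constraint, so that points left of the grid are covered
    as well. *)
Fixpoint boxes (l : seq 'I_s) : seq (seq ('I_s * nat)) :=
  if l is j :: l' then [seq (j, k) :: b | k <- iota 0 N.+1, b <- boxes l']
  else [:: [::]].

Lemma boxes_cons j l :
  boxes (j :: l) = [seq (j, k) :: b | k <- iota 0 N.+1, b <- boxes l].
Proof. by []. Qed.

Definition weight b : R := \prod_(jk <- b) (if jk.2 == 0%N then 1 else mesh).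

Definition in_box b z : bool :=
  all (fun jk => (jk.2 == 0%N) || (grid jk.2 <= z jk.1)) b.

Definition in_cube z := forall j, `|z j| <= lam.

Hypotheses (lam0 : 0 <= lam) (N0 : (0 < N)%N).

Lemma mesh_ge0 : 0 <= mesh.
Proof. by rewrite divr_ge0// mulr_ge0. Qed.

Lemma mulrn_mesh : N%:R * mesh = 2 * lam.
Proof. by rewrite /mesh mulrC divfK// pnatr_eq0 -lt0n. Qed.

Lemma grid_le k k' : (k <= k')%N -> grid k <= grid k'.
Proof. by move=> kk'; rewrite lerD2l ler_wpM2r ?mesh_ge0 ?ler_nat. Qed.

Lemma gridS k : grid k.+1 - grid k = mesh.
Proof. by rewrite /grid -natr1; ring. Qed.

Lemma norm_grid k : (k <= N)%N -> `|grid k| <= lam.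
Proof.
move=> kN; rewrite ler_norml; apply/andP; split.
  by rewrite lerDl mulr_ge0 ?mesh_ge0.
have := grid_le kN; rewrite {2}/grid mulrn_mesh => /le_trans; apply.
lra.
Qed.

Let cnt t n := count (fun k => grid k <= t) (iota 1 n).

Let cntS t n : cnt t n.+1 = (cnt t n + (grid n.+1 <= t)%R)%N.
Proof. by rewrite /cnt -{1}(addn1 n) iotaD count_cat/= addn0 add1n. Qed.

Let cnt_le t n : (cnt t n <= n)%N.
Proof. by rewrite -[leqRHS](size_iota 1) count_size. Qed.

Let cnt_full t n : grid n <= t -> cnt t n = n.
Proof.
move=> nt; apply/eqP; rewrite -[eqbRHS](size_iota 1) -all_count.
apply/allP => k; rewrite mem_iota => /andP[_ kn].
by rewrite (le_trans (grid_le _) nt)// -ltnS -add1n.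
Qed.

Lemma norm_round t : `|round t| <= lam.
Proof. exact/norm_grid/cnt_le. Qed.

Lemma round_near t : `|t| <= lam -> round t <= t <= round t + mesh.
Proof.
rewrite ler_norml => /andP[lt tl].
have H n : grid (cnt t n) <= t /\ ((cnt t n < n)%N -> t <= grid (cnt t n).+1).
  elim: n => [|n [IH1 IH2]]; first by rewrite /cnt/= /grid mul0r addr0.
  rewrite cntS; case: (leP (grid n.+1) t) => nt /=.
    have ct : cnt t n = n by apply: cnt_full; exact: le_trans (grid_le _) nt.
    by rewrite ct addn1 ltnn.
  rewrite addn0; split=> // _.
  by case: (ltngtP (cnt t n) n) (cnt_le t n) => // [/IH2//|-> _]; exact: ltW.
have [h1 h2] := H N; rewrite h1/= -(gridS (cnt t N)) addrC subrK.
have [cN|cN] := ltnP (cnt t N) N; first exact: h2.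
have -> : cnt t N = N by apply/eqP; rewrite eqn_leq cnt_le.
rewrite (le_trans tl)// (le_trans _ (grid_le (leqnSn N)))//.
by rewrite /grid mulrn_mesh; lra.
Qed.

Let telescope_count (f : nat -> R) t n :
  f (cnt t n) = f 0%N + \sum_(k <- iota 1 n) (grid k <= t)%R%:R * (f k - f k.-1).
Proof.
elim: n => [|n IH]; first by rewrite /cnt/= big_nil addr0.
rewrite cntS -(addn1 n) iotaD big_cat big_seq1 addrA -IH add1n addn1.
case: leP => [nt|_]; last by rewrite addn0 mul0r addr0.
have -> : cnt t n = n by apply: cnt_full; exact: le_trans (grid_le _) nt.
by rewrite addn1 mul1r addrC subrK.
Qed.

Let expand_coord j g z (t : R) : g (upd z j (round t)) =
  \sum_(k <- iota 0 N.+1) diff_op j k g z * ((k == 0%N) || (grid k <= t))%:R.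
Proof.
rewrite /round (telescope_count (fun k => g (upd z j (grid k)))).
rewrite big_cons mulr1; congr (_ + _).
apply: eq_big_seq => k; rewrite mem_iota => /andP[k0 _].
by case: k k0 => // k _; rewrite mulrC.
Qed.

(** Summation by parts in every coordinate: at a point rounded down to the grid,
    [g] is the sum of its mixed differences over the boxes containing the
    point.  The differences depend on [g] only and the boxes on the grid only,
    so an integration error for [g] becomes a combination of errors for
    boxes. *)
Lemma box_expansion l g z z0 :
  g (fun j => if j \in l then round (z j) else z0 j) =
  \sum_(b <- boxes l) diffs b g z0 * (in_box b z)%:R.
Proof.
elim: l g => [|j l IH] g; first by rewrite big_seq1 mulr1.
rewrite boxes_cons big_allpairs_dep.
have -> : (fun i => if i \in j :: l then round (z i) else z0 i) =
  upd (fun i => if i \in l then round (z i) else z0 i) j (round (z j)).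
  by apply/funext => i; rewrite /upd inE; case: eqVneq => // ->.
rewrite expand_coord; apply: eq_bigr => k _.
rewrite IH mulr_suml; apply: eq_bigr => b _ /=.
by rewrite -mulrA -natrM mulnb andbC.
Qed.

Lemma sum_weight l : \sum_(b <- boxes l) weight b = (1 + 2 * lam) ^+ size l.
Proof.
elim: l => [|j l IH]; first by rewrite big_seq1 /weight big_nil.
rewrite boxes_cons big_allpairs_dep exprS -IH.
under eq_bigr do under eq_bigr do rewrite /weight big_cons.
under eq_bigr do rewrite -big_distrr.
rewrite -big_distrl /= big_cons/=; congr ((_ + _) * _).
rewrite (eq_big_seq (fun=> mesh)); last by case=> //; rewrite mem_iota.
rewrite -mulrn_mesh big_const_seq count_predT size_iota iter_addr_0.
by rewrite mulr_natl.
Qed.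

Lemma weight_ge0 b : 0 <= weight b.
Proof. by apply: prodr_ge0 => jk _; case: ifP; rewrite // mesh_ge0. Qed.

End grid.

(** * Mixed differences of tame functions *)

Section mixed_differences.
Context {R : realType} {s : nat}.
Variables (lam : R) (N : nat).
Local Notation point := ('I_s -> R).
Implicit Types (z : point) (g : point -> R) (i j : 'I_s) (b : seq ('I_s * nat)).
Local Notation y_ := (grid lam N).
Local Notation diff_op := (diff_op lam N).
Local Notation diffs := (diffs lam N).

Lemma in_cube_upd z j y : in_cube lam z -> `|y| <= lam -> in_cube lam (upd z j y).
Proof. by move=> zc yl i; rewrite /upd; case: eqP. Qed.

Lemma diff_op_partial i j k g g' : i != j -> has_partial j g g' ->
  has_partial j (diff_op i k g) (diff_op i k g').
Proof.
move=> ij gg' z.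
have h (c : R) : is_derive (z j) 1 (fun y => g (upd (upd z j y) i c))
    (g' (upd z i c)).
  have := gg' (upd z i c); rewrite {1}/upd eq_sym (negbTE ij).
  by congr (is_derive _ _ _ _); apply/funext => y; rewrite updC.
case: k => [|k]; first exact: h.
exact: is_deriveB (h _) (h _).
Qed.

Lemma diffs_partial j b g g' : j \notin map fst b -> has_partial j g g' ->
  has_partial j (diffs b g) (diffs b g').
Proof.
elim: b g g' => [|[i k] b IH] g g' //=.
rewrite inE negb_or => /andP[ji jb] gg'; apply: IH => //.
by apply: diff_op_partial; rewrite 1?eq_sym.
Qed.

Lemma diff_opC i j k k' g : i != j ->
  diff_op i k (diff_op j k' g) = diff_op j k' (diff_op i k g).
Proof.
move=> ij; apply/funext => z; have E c c' := updC z c c' ij.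
by case: k => [|k]; case: k' => [|k'] /=; rewrite ?E//; ring.
Qed.

Lemma diffs_diff_op j k b g : j \notin map fst b ->
  diffs b (diff_op j k g) = diff_op j k (diffs b g).
Proof.
elim: b g => [|[i k'] b IH] g //=.
rewrite inE negb_or => /andP[ji jb]; rewrite -IH//.
by congr diffs; rewrite diff_opC// eq_sym.
Qed.

Lemma boxes_axes l b : b \in boxes N l -> map fst b = l.
Proof.
elim: l b => [|j l IH] b; first by rewrite inE => /eqP->.
by rewrite boxes_cons => /allpairsP[[k b'] /= [_ /IH <- ->]].
Qed.

End mixed_differences.

Section tame_bounds.
Context {R : realType} {s d : nat} {Theta : Type}.
Variable phi : 'cV[R]_d -> R.
Hypothesis phi_smooth : smooth phi.
Hypothesis phi_growth : poly_growing_partials phi.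
Local Notation point := ('I_s -> R).
Implicit Types G : Theta -> point -> R.
Local Notation tame := (@tame R s d Theta phi).

Lemma l1norm_cube (lam : R) (z : point) : in_cube lam z -> l1norm z <= s%:R * lam.
Proof.
move=> zc; rewrite /l1norm (le_trans (ler_sum _ (fun j _ => zc j)))//.
by rewrite sumr_const card_ord mulr_natl.
Qed.

(** The mean value theorem, once for each coordinate in which a difference is
    taken, bounds a mixed difference by the corresponding mixed partial
    derivative, which is again tame. *)
Lemma tame_diffs G (l : seq 'I_s) : tame G -> uniq l ->
  exists C c, [/\ 0 <= C, 0 <= c & forall (lam : R) N, 0 <= lam -> (0 < N)%N ->
    forall th b z, b \in boxes N l -> in_cube lam z ->
      `|diffs lam N b (G th) z| <= C * expR (c * lam) * weight lam N b].
Proof.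
elim: l G => [|j l IH] G tG.
  move=> _; have [C [c [C0 c0 h]]] := tame_growth phi_growth tG.
  exists C, (c * s%:R); split; rewrite ?mulr_ge0// => lam N l0 N0 th b z.
  rewrite inE => /eqP-> zc; rewrite /weight big_nil mulr1.
  rewrite (le_trans (h th z))// ler_wpM2l// ler_expR -mulrA ler_wpM2l//.
  exact: l1norm_cube.
rewrite cons_uniq => /andP[jl ul].
have [G' tG' GG'] := tame_partial phi_smooth j tG.
have [C1 [c1 [C10 c10 h1]]] := IH _ tG ul.
have [C2 [c2 [C20 c20 h2]]] := IH _ tG' ul.
exists (C1 + C2), (c1 + c2); split; rewrite ?addr_ge0// => lam N l0 N0 th b z.
rewrite boxes_cons => /allpairsP[[k b'] /= [+ b'l ->]].
rewrite -[0%N :: iota 1 N]/(iota 0 N.+1) mem_iota add0n ltnS => /= kN zc.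
have jb' : j \notin map fst b' by rewrite (boxes_axes b'l).
rewrite diffs_diff_op// /weight big_cons -/(weight lam N b').
have w0 : 0 <= weight lam N b' by exact: weight_ge0.
have m0 : 0 <= mesh lam N by exact: mesh_ge0.
have le1 : C1 * expR (c1 * lam) <= (C1 + C2) * expR ((c1 + c2) * lam).
  by rewrite ler_pM ?expR_ge0 ?lerDl// ler_expR ler_wpM2r// lerDl.
have le2 : C2 * expR (c2 * lam) <= (C1 + C2) * expR ((c1 + c2) * lam).
  by rewrite ler_pM ?expR_ge0 ?lerDr// ler_expR ler_wpM2r// lerDr.
case: k kN => [|k] kN /=.
  rewrite mul1r (le_trans (h1 _ _ l0 N0 _ _ _ b'l _))//.
    by apply: in_cube_upd => //; apply: norm_grid.
  by rewrite ler_wpM2r.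
have [y /andP[y1 y2] ->] := has_partial_mvt z
  (diffs_partial lam N jb' (GG' th)) (grid_le N l0 (leqnSn k)).
rewrite gridS normrM (ger0_norm m0) [leRHS]mulrCA [leRHS]mulrC ler_wpM2r//.
have yl : `|y| <= lam.
  have := norm_grid l0 N0 kN; have := norm_grid l0 N0 (ltnW kN).
  rewrite !ler_norml => /andP[a1 a2] /andP[b1 b2].
  by rewrite (le_trans a1 y1) (le_trans y2 b2).
rewrite (le_trans (h2 _ _ l0 N0 _ _ _ b'l _))//; first exact: in_cube_upd.
by rewrite ler_wpM2r.
Qed.

(** Rounding one coordinate at a time moves the point by at most one mesh each
    time, and the partial derivatives are bounded on the cube. *)
Lemma tame_round_cube G : tame G ->
  exists C c, [/\ 0 <= C, 0 <= c & forall (lam : R) N, 0 <= lam -> (0 < N)%N ->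
    forall th z, in_cube lam z ->
      `|G th z - G th (round lam N \o z)| <= C * expR (c * lam) * mesh lam N].
Proof.
move=> tG.
suff : forall l : seq 'I_s, exists C c, [/\ 0 <= C, 0 <= c &
    forall (lam : R) N, 0 <= lam -> (0 < N)%N -> forall th z, in_cube lam z ->
      `|G th z - G th (fun j => if j \in l then round lam N (z j) else z j)|
        <= C * expR (c * lam) * mesh lam N].
  move=> /(_ (enum 'I_s))[C [c [C0 c0 h]]]; exists C, c; split=> // lam N l0 N0 th z zc.
  have := h lam N l0 N0 th z zc.
  by under eq_fun do rewrite mem_enum.
elim=> [|j l [C1 [c1 [C10 c10 h1]]]].
  exists 0, 0; split=> // lam N l0 N0 th z zc.
  rewrite !mul0r (_ : (fun _ => _) = z) ?subrr ?normr0//.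
have [G' tG' GG'] := tame_partial phi_smooth j tG.
have [C2 [c2 [C20 c20 h2]]] := tame_growth phi_growth tG'.
exists (C1 + C2), (c1 + c2 * s%:R); split; rewrite ?addr_ge0 ?mulr_ge0// => lam N l0 N0 th z zc.
have m0 : 0 <= mesh lam N by exact: mesh_ge0.
set zl := fun i : 'I_s => if i \in l then round lam N (z i) else z i.
have zlc : in_cube lam zl.
  by move=> i; rewrite /zl; case: ifP => // _; exact: norm_round.
have -> : (fun i => if i \in j :: l then round lam N (z i) else z i) =
    upd zl j (round lam N (z j)).
  by apply/funext => i; rewrite /upd /zl inE; case: eqVneq => // ->.
rewrite -(subrK (G th zl) (G th z)) -addrA (le_trans (ler_normD _ _))//.
rewrite !mulrDl lerD//.
  rewrite (le_trans (h1 _ _ l0 N0 th z zc))// ler_wpM2r// ler_wpM2l//.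
  by rewrite ler_expR lerDl !mulr_ge0.
have near : round lam N (zl j) <= zl j <= round lam N (zl j) + mesh lam N.
  exact: round_near.
have -> : G th zl = G th (upd zl j (zl j)) by rewrite upd_id.
have rr : round lam N (z j) = round lam N (zl j) \/ round lam N (z j) = zl j.
  by rewrite /zl; case: ifP; [right|left].
have G2b : forall z', in_cube lam z' ->
    `|G' th z'| <= C2 * expR (c1 * lam + c2 * s%:R * lam).
  move=> z' z'c; rewrite (le_trans (h2 th z'))// ler_wpM2l// ler_expR.
  rewrite (@le_trans _ _ (c2 * s%:R * lam)) ?lerDr ?mulr_ge0//.
  by rewrite -mulrA ler_wpM2l// l1norm_cube.
case: rr => ->; last first.
  by rewrite subrr normr0 !mulr_ge0 ?expR_ge0.
move/andP: near => [n1 n2].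
have [y /andP[y1 y2] ->] := has_partial_mvt zl (GG' th) n1.
rewrite normrM ler_pM//.
  apply: G2b; apply: in_cube_upd => //.
  have := norm_round l0 N0 (zl j); have := zlc j; rewrite !ler_norml.
  by move=> /andP[a1 a2] /andP[b1 b2]; rewrite (le_trans b1 y1) (le_trans y2 a2).
by rewrite ger0_norm ?subr_ge0// lerBlDl.
Qed.

(** Outside the cube the exponential growth of [G] is traded for an arbitrarily
    large power of [expR (- lam)], at the price of a larger exponential moment
    of the point. *)
Lemma tame_round G : tame G -> exists c, 0 <= c /\ forall K, 0 <= K ->
  exists C, 0 <= C /\ forall (lam : R) N, 0 <= lam -> (0 < N)%N -> forall th z,
    `|G th z - G th (round lam N \o z)| <= C * (expR (c * lam) * mesh lam N
      + expR (- (K * lam)) * \sum_j expR ((c + K) * `|z j|)).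
Proof.
move=> tG.
have [C1 [c1 [C10 c10 h1]]] := tame_round_cube tG.
have [C2 [c2 [C20 c20 h2]]] := tame_growth phi_growth tG.
exists (c1 + c2 * s%:R); split; first by rewrite addr_ge0 ?mulr_ge0.
move=> K K0; exists (C1 + 2 * C2); split; first by rewrite addr_ge0 ?mulr_ge0.
move=> lam N l0 N0 th z.
have m0 : 0 <= mesh lam N by exact: mesh_ge0.
set c := c1 + c2 * s%:R.
have S0 : 0 <= \sum_j expR ((c + K) * `|z j|) by apply: sumr_ge0 => *; exact: expR_ge0.
have [zc|] := pselect (in_cube lam z).
  rewrite (le_trans (h1 _ _ l0 N0 th z zc))// -mulrA ler_pM ?mulr_ge0 ?expR_ge0//.
    by rewrite lerDl mulr_ge0.
  rewrite (@le_trans _ _ (expR (c * lam) * mesh lam N))//.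
    by rewrite ler_wpM2r// ler_expR ler_wpM2r// lerDl mulr_ge0.
  by rewrite lerDl mulr_ge0 ?expR_ge0.
move=> /existsNP[j0 /negP]; rewrite -ltNge => j0l.
(* The coordinate of largest modulus exceeds [lam] and controls both the norm of
   [z] and that of its rounding. *)
have [j1 _ hmax] := arg_maxP (fun j => `|z j|) (erefl true : xpredT j0).
have j1max j : `|z j| <= `|z j1| by exact: hmax.
have lj1 : lam <= `|z j1| by rewrite (le_trans (ltW j0l))// j1max.
set E := expR (- (K * lam)) * \sum_j expR ((c + K) * `|z j|).
have key z' : in_cube `|z j1| z' -> `|G th z'| <= C2 * E.
  move=> z'c; rewrite (le_trans (h2 th z'))// ler_wpM2l//.
  rewrite /E (bigD1 j1)//= mulrDr -expRD.
  rewrite (@le_trans _ _ (expR (- (K * lam) + (c + K) * `|z j1|)))//; last first.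
    by rewrite lerDl mulr_ge0 ?expR_ge0// sumr_ge0// => *; exact: expR_ge0.
  rewrite ler_expR mulrDl addrCA -[leLHS]addr0 lerD//.
    rewrite (@le_trans _ _ (c2 * s%:R * `|z j1|))//.
      by rewrite -mulrA ler_wpM2l// l1norm_cube.
    by rewrite ler_wpM2r// lerDr.
  by rewrite addrC -mulrBr mulr_ge0// subr_ge0.
have E0 : 0 <= E by rewrite mulr_ge0 ?expR_ge0.
rewrite (le_trans (ler_normB _ _))// (@le_trans _ _ (2 * C2 * E))//.
  rewrite -mulrA mulr_natl mulr2n lerD//; apply: key => j.
    exact: j1max.
  by rewrite (le_trans (norm_round l0 N0 _)).
rewrite ler_pM ?mulr_ge0//; first by rewrite lerDr.
by rewrite lerDr mulr_ge0 ?expR_ge0.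
Qed.

End tame_bounds.

(** * Monotonicity of the integral, and inverse square roots *)

Section integral_monotonicity.
Local Open Scope ereal_scope.
Context {d} {T : measurableType d} {R : realType}.
Variable mu : {measure set T -> \bar R}.
Implicit Types f g : T -> \bar R.

Let measurable_mem (N : set T) : measurable N ->
  measurable_fun setT (fun x => x \in N).
Proof.
move=> mN; apply: (measurable_fun_bool true); rewrite setTI.
rewrite [X in measurable X](_ : _ = N)//.
by apply/seteqP; split=> x /=; [move/set_mem|move/mem_set].
Qed.

(** The integral of a nonnegative function is the supremum over the simple
    functions below it, and there are more of these below a larger function. *)
Lemma ge0_le_integral_nonmeasurable f g : (forall x, 0 <= f x) ->
  (forall x, f x <= g x) -> \int[mu]_x f x <= \int[mu]_x g x.
Proof.
move=> f0 fg; have g0 x : 0 <= g x by exact: le_trans (f0 x) (fg x).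
rewrite !ge0_integralTE//; apply: ereal_sup_le => _ [h hf <-].
by exists h => // x; rewrite (le_trans (hf x)).
Qed.

Lemma ae_le_integral_measurable_r f g :
  (forall x, 0 <= f x) -> (forall x, 0 <= g x) -> measurable_fun setT g ->
  {ae mu, forall x, f x <= g x} -> \int[mu]_x f x <= \int[mu]_x g x.
Proof.
move=> f0 g0 mg [N [mN N0 fgN]].
pose g' x := if x \in N then +oo else g x.
have mg' : measurable_fun setT g'.
  apply: measurable_fun_ifT => //.
  exact: measurable_mem.
apply: (@le_trans _ _ (\int[mu]_x g' x)).
  apply: ge0_le_integral_nonmeasurable => // x; rewrite /g'.
  case: ifPn => [_|]; first exact: leey.
  by rewrite notin_setE => xN; apply: contrapT => /(fgN x).
rewrite (@ge0_ae_eq_integral _ _ _ _ setT g' g)//.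
  by move=> x _; rewrite /g'; case: ifP.
exists N; split=> // x /= /not_implyP[_]; rewrite /g'.
by case: ifPn => // xN _; rewrite inE in xN.
Qed.

Lemma ae_le_integral_measurable_l f g :
  (forall x, 0 <= f x) -> (forall x, 0 <= g x) -> measurable_fun setT f ->
  {ae mu, forall x, f x <= g x} -> \int[mu]_x f x <= \int[mu]_x g x.
Proof.
move=> f0 g0 mf [N [mN N0 fgN]].
pose f' x := if x \in N then 0 else f x.
have mf' : measurable_fun setT f'.
  apply: measurable_fun_ifT => //.
  exact: measurable_mem.
rewrite (@ge0_ae_eq_integral _ _ _ _ setT f f')//; last 2 first.
- by move=> x _; rewrite /f'; case: ifP.
- exists N; split=> // x /= /not_implyP[_]; rewrite /f'.
  by case: ifPn => // xN _; rewrite inE in xN.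
apply: ge0_le_integral_nonmeasurable => x; rewrite /f'; case: ifPn => //.
by rewrite notin_setE => xN; apply: contrapT => /(fgN x).
Qed.

End integral_monotonicity.

Section inverse_square_root.
Context {R : realType}.
Implicit Types x : R.

Definition inv_sqrt x : R := x `^ (- 2^-1).

Lemma inv_sqrt_ge0 x : 0 <= inv_sqrt x.
Proof. exact: powR_ge0. Qed.

Lemma measurable_inv_sqrt : measurable_fun setT inv_sqrt.
Proof. exact: measurable_powR. Qed.

Lemma inv_sqrt_le x y : 0 < x -> 0 < y -> x^-1 <= y ^+ 2 -> inv_sqrt x <= y.
Proof.
move=> x0 y0 xy; have y0' := ltW y0.
have -> : inv_sqrt x = x^-1 `^ 2^-1.
  by rewrite -powR_inv1 ?ltW// -powRrM mulN1r.
rewrite (@le_trans _ _ ((y ^+ 2) `^ 2^-1))//.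
  by apply: ge0_ler_powR => //; rewrite nnegrE ?sqr_ge0 ?invr_ge0 ?(ltW x0).
by rewrite -powR_mulrn// -powRrM divff// powRr1.
Qed.

Lemma le_inv_sqrt x y : 0 < x -> 0 <= y -> y ^+ 2 * x <= 1 -> y <= inv_sqrt x.
Proof.
move=> x0 y0 yx; rewrite leNgt; apply/negP => xy.
have h : 0 < inv_sqrt x ^+ 2 * x by rewrite mulr_gt0// exprn_gt0// powR_gt0.
have E : inv_sqrt x ^+ 2 * x = 1.
  rewrite /inv_sqrt -powR_mulrn ?powR_ge0// -powRrM mulNr mulVf//.
  by rewrite powR_inv1 ?ltW// mulVf// gt_eqF.
have : inv_sqrt x ^+ 2 * x < y ^+ 2 * x.
  by rewrite ltr_pM2r// ltrXn2r// inv_sqrt_ge0.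
by rewrite E ltNge yx.
Qed.

Let dyadic_below x : 0 < x < 1 ->
  exists l, 4%:R^-1 ^+ l.+1 < x <= 4%:R^-1 ^+ l.
Proof.
move=> /andP[x0 x1].
have ex : exists l, 4%:R^-1 ^+ l.+1 < x.
  have := @cvg_expr R 4%:R^-1.
  rewrite ger0_norm// => /(_ ltac:(lra)) /cvgr0Pnorm_lt /(_ _ x0)[n _ hn].
  by exists n; have := hn n.+1 (leqnSn n); rewrite ger0_norm// exprn_ge0.
exists (ex_minn ex); case: ex_minnP => -[|l] lx lmin; first by rewrite lx expr0 ltW.
rewrite lx leNgt; apply/negP => /lmin; by rewrite ltnn.
Qed.

Context {d} {T : measurableType d}.
Variable P : probability T R.

Lemma ae_gt0 (X : T -> R) (A : R) : 0 <= A -> measurable_fun setT X ->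
  (forall x, 0 < x -> (P [set w | (X w <= x)%R] <= (A * x)%:E)%E) ->
  {ae P, forall w, 0 < X w}.
Proof.
move=> A0 mX hX.
have mlev x : measurable [set w | X w <= x].
  rewrite -[X in measurable X]setTI.
  exact: (@measurable_fun_le _ _ _ setT X (cst x)).
exists [set w | X w <= 0]; split => //; last first.
  by move=> w /= /negP; rewrite -leNgt.
apply/eqP; rewrite eq_le measure_ge0 andbT.
apply/lee_addgt0Pr => e e0; rewrite add0e.
have x0 : 0 < e / (A + 1) by rewrite divr_gt0// ltr_wpDl.
apply: (@le_trans _ _ (P [set w | (X w <= e / (A + 1))%R])).
  by apply: le_measure; rewrite ?inE// => w /= /le_trans; apply; exact: ltW.
apply: (le_trans (hX _ x0)); rewrite lee_fin mulrA ler_pdivrMr ?ltr_wpDl//.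
by rewrite mulrC; apply: ler_wpM2l; rewrite ?lerDl//; exact: ltW.
Qed.

(** A layer-cake bound over the dyadic levels [X <= 4 ^- l]: the mass of each
    level is at most proportional to its height, while [inv_sqrt] only doubles
    from a level to the next. *)
Lemma integral_inv_sqrt (X : T -> R) (A : R) : 0 <= A ->
  measurable_fun setT X ->
  (forall x, 0 < x -> (P [set w | (X w <= x)%R] <= (A * x)%:E)%E) ->
  (\int[P]_w (inv_sqrt (X w))%:E <= (1 + 4 * A)%:E)%E.
Proof.
move=> A0 mX hX.
pose lev l := [set w | X w <= 4%:R^-1 ^+ l].
have mlev x : measurable [set w | X w <= x].
  rewrite -[X in measurable X]setTI.
  exact: (@measurable_fun_le _ _ _ setT X (cst x)).
pose f (l : nat) (w : T) : \bar R := (2%:R ^+ l.+1 * \1_(lev l) w)%:E.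
have f0 l w : (0 <= f l w)%E by rewrite lee_fin mulr_ge0 ?exprn_ge0.
have mf l : measurable_fun setT (f l).
  apply/measurable_EFinP; apply: measurable_funM => //.
  by apply: measurable_indic; exact: mlev.
have mS : measurable_fun setT (fun w => \sum_(l <oo) f l w)%E.
  exact: ge0_emeasurable_sum.
have S0 w : (0 <= \sum_(l <oo) f l w)%E by exact: nneseries_ge0.
have null := ae_gt0 A0 mX hX.
apply: (@le_trans _ _ (\int[P]_w (1 + \sum_(l <oo) f l w))%E).
  apply: ae_le_integral_measurable_r.
  - by move=> w; rewrite lee_fin inv_sqrt_ge0.
  - by move=> w; rewrite adde_ge0.
  - exact: emeasurable_funD.
  - apply: filterS null => w Xw.
    have [X1|X1] := ltP (X w) 1; last first.
      rewrite (@le_trans _ _ 1%:E)//; last by rewrite leeDl.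
      by rewrite lee_fin inv_sqrt_le// expr1n invf_le1.
    have [l /andP[Xl lX]] := @dyadic_below (X w) ltac:(by rewrite Xw X1).
    apply: (@le_trans _ _ (f l w)).
      rewrite lee_fin indicE mem_set// mulr1 inv_sqrt_le ?exprn_gt0//.
      rewrite -exprM mulnC exprM -[2 ^+ 2]/(2 * 2) -natrM.
      by rewrite -[leRHS]invrK -exprVn lef_pV2 ?posrE ?exprn_gt0 ?invr_gt0// ltW.
    rewrite (le_trans _ (leeDr _ _))//.
    rewrite (le_trans _ (nneseries_lim_ge l.+1 _))//.
    by rewrite big_nat_recr//= leeDr// sume_ge0.
rewrite ge0_integralD//.
have -> : (\int[P]__ 1 = 1)%E.
  by rewrite (integral_cst P measurableT 1) mul1e; exact: probability_setT.
rewrite EFinD leeD2l//.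
rewrite integral_nneseries//.
apply: lime_le.
  by apply: is_cvg_nneseries => l _ _; exact: integral_ge0.
apply: nearW => n.
apply: (@le_trans _ _ (\sum_(0 <= l < n) (2 * A * 2^-1 ^+ l)%:E)%E).
  apply: lee_sum => l _; rewrite /f.
  under eq_integral do rewrite EFinM.
  rewrite ge0_integralZl_EFin//; last first.
    by apply/measurable_EFinP/measurable_indic; exact: mlev.
  rewrite (integral_indic P measurableT (mlev _)) setIT.
  apply: (@le_trans _ _ ((2 ^+ l.+1)%:E * (A * 4%:R^-1 ^+ l)%:E)%E).
    by apply: lee_wpmul2l; rewrite ?lee_fin ?exprn_ge0 ?hX ?exprn_gt0.
  rewrite -EFinM lee_fin.
  have -> : 4%:R^-1 ^+ l = 2^-1 ^+ l * 2^-1 ^+ l :> R.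
    by rewrite -exprMn -invfM -natrM.
  have h2 : (2 : R) ^+ l * 2^-1 ^+ l = 1 by rewrite -exprMn divff// expr1n.
  have -> : 2%:R ^+ l.+1 * (A * (2^-1 ^+ l * 2^-1 ^+ l)) =
    2 * A * 2^-1 ^+ l * ((2 : R) ^+ l * 2^-1 ^+ l) by rewrite exprS; ring.
  by rewrite h2 mulr1.
rewrite sumEFin lee_fin.
have : forall n, \sum_(0 <= l < n) (2 * A * 2^-1 ^+ l) = 4 * A * (1 - 2^-1 ^+ n) :> R.
  elim=> [|k IH]; first by rewrite big_nil expr0 subrr mulr0.
  by rewrite big_nat_recr//= IH exprS; lra.
by move=> ->; rewrite ler_piMr ?mulr_ge0// gerBl exprn_ge0.
Qed.

End inverse_square_root.

(** * Functions with bounded mean *)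

Section mean_bounds.
Context {d} {T : measurableType d} {R : realType}.
Variable P : probability T R.
Implicit Types (f g : T -> R) (a b : R).

Definition mean_le f a := [/\ measurable_fun setT f, forall w, 0 <= f w &
  (\int[P]_w (f w)%:E <= a%:E)%E].

Lemma mean_leD f g a b : mean_le f a -> mean_le g b ->
  mean_le (fun w => f w + g w) (a + b).
Proof.
move=> [mf f0 fa] [mg g0 gb]; split; first exact: measurable_funD.
  by move=> w; rewrite addr_ge0.
under eq_integral do rewrite EFinD.
rewrite ge0_integralD//; first by rewrite EFinD leeD.
- by move=> w _; rewrite lee_fin.
- exact/measurable_EFinP.
- by move=> w _; rewrite lee_fin.
- exact/measurable_EFinP.
Qed.

Lemma mean_leZ k f a : 0 <= k -> mean_le f a -> mean_le (fun w => k * f w) (k * a).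
Proof.
move=> k0 [mf f0 fa]; split; first exact: measurable_funM.
  by move=> w; rewrite mulr_ge0.
under eq_integral do rewrite EFinM.
rewrite ge0_integralZl_EFin//; first by rewrite EFinM lee_wpmul2l// lee_fin.
- by move=> w _; rewrite lee_fin.
- exact/measurable_EFinP.
Qed.

Lemma mean_le_cst a : 0 <= a -> mean_le (fun=> a) a.
Proof.
move=> a0; split=> //.
by rewrite (integral_cst P measurableT a%:E) [X in (_ * X)%E]probability_setT mule1.
Qed.

Lemma mean_le_sum n (f : 'I_n -> T -> R) (a : 'I_n -> R) :
  (forall i, mean_le (f i) (a i)) ->
  mean_le (fun w => \sum_i f i w) (\sum_i a i).
Proof.
elim: n f a => [|n IH] f a hf.
  rewrite big_ord0 (_ : (fun w => _) = (fun=> 0)); first exact: mean_le_cst.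
  by apply/funext => w; rewrite big_ord0.
rewrite big_ord_recl (_ : (fun w => _) =
  (fun w => f ord0 w + \sum_(i < n) f (lift ord0 i) w)).
  by apply: mean_leD => //; exact: IH.
by apply/funext => w; rewrite big_ord_recl.
Qed.

Lemma mean_le_integrable f a : mean_le f a -> P.-integrable setT (EFin \o f).
Proof.
move=> [mf f0 fa]; apply/integrableP; split; first exact/measurable_EFinP.
under eq_integral do rewrite /= ger0_norm//.
by rewrite (le_lt_trans fa)// ltry.
Qed.

(** The measurable functions [Y - h] and [Y + h] bracket [f], so their integrals
    bracket the integral of [f]. *)
Lemma integral_near (f Y h : T -> R) (y eta : R) : (forall w, 0 <= f w) ->
  P.-integrable setT (EFin \o Y) -> (\int[P]_w (Y w)%:E = y%:E)%E ->
  mean_le h eta -> {ae P, forall w, `|f w - Y w| <= h w} ->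
  exists2 r, (\int[P]_w (f w)%:E = r%:E)%E & `|r - y| <= eta.
Proof.
move=> f0 iY Yy hle fY; have ih := mean_le_integrable hle.
have [mh h0 heta] := hle.
have [e' he'] : exists e', (\int[P]_w (h w)%:E = e'%:E)%E.
  exists (fine (\int[P]_w (h w)%:E)); rewrite fineK//.
  exact: (integrable_fin_num measurableT ih).
have e'eta : e' <= eta by rewrite -lee_fin -he'.
have mY : measurable_fun setT Y by exact/measurable_EFinP/(measurable_int P iY).
have mD : measurable_fun setT (fun w => Y w + h w) by exact: measurable_funD.
have mB : measurable_fun setT (fun w => Y w - h w) by exact: measurable_funB.
have up : (\int[P]_w (f w)%:E <= (y + e')%:E)%E.
  have -> : (y + e')%:E = (\int[P]_w (Y w + h w)%:E)%E.
    by rewrite EFinD -Yy -he' -(integralD measurableT iY ih).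
  rewrite (@ae_eq_integral _ _ _ P setT (fun w => (Num.max (Y w + h w) 0)%:E)
    (fun w => (Y w + h w)%:E))//; last 3 first.
  - exact/measurable_EFinP.
  - by apply/measurable_EFinP; exact: measurable_maxr.
  - apply: filterS fY => w; rewrite ler_norml => /andP[_ fwY] _ /=.
    by rewrite max_l// (le_trans (f0 w))//; move: fwY; rewrite lerBlDl.
  apply: ae_le_integral_measurable_r.
  - by move=> w; rewrite lee_fin.
  - by move=> w; rewrite lee_fin le_max lexx orbT.
  - by apply/measurable_EFinP; exact: measurable_maxr.
  - apply: filterS fY => w; rewrite ler_norml => /andP[_ fwY].
    by rewrite lee_fin le_max -lerBlDl fwY.
have lo : ((y - e')%:E <= \int[P]_w (f w)%:E)%E.
  have iB := integrableB measurableT iY ih.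
  have -> : (y - e')%:E = (\int[P]_w (Y w - h w)%:E)%E.
    by rewrite EFinB -Yy -he' -(integralB measurableT iY ih).
  have mM : measurable_fun setT (fun w => Num.max (Y w - h w) 0).
    exact: measurable_maxr.
  apply: (@le_trans _ _ (\int[P]_w (Num.max (Y w - h w) 0)%:E)%E).
    have iM : P.-integrable setT (fun w => (Num.max (Y w - h w) 0)%:E).
      apply: (le_integrable measurableT _ _ iB); first exact/measurable_EFinP.
      move=> w _ /=; rewrite lee_fin.
      case: (leP (Y w - h w) 0) => // _; rewrite normr0 //.
    apply: le_integral => // w _ /=.
    by rewrite lee_fin le_max lexx.
  apply: ae_le_integral_measurable_l.
  - by move=> w; rewrite lee_fin le_max lexx orbT.
  - by move=> w; rewrite lee_fin.
  - exact/measurable_EFinP.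
  - apply: filterS fY => w; rewrite ler_norml => /andP[fwY _].
    by rewrite lee_fin ge_max f0 andbT; move: fwY; lra.
have fin : (\int[P]_w (f w)%:E)%E \is a fin_num.
  rewrite ge0_fin_numE ?(le_lt_trans up) ?ltry//.
  by apply: integral_ge0 => w _; rewrite lee_fin.
exists (fine (\int[P]_w (f w)%:E)%E); first by rewrite fineK.
move: up lo; rewrite -(fineK fin) !lee_fin => up lo.
by rewrite ler_norml; apply/andP; split; lra.
Qed.

End mean_bounds.

(** * Box approximation of tame functions on the unit cube *)

Section upper_boxes.
Context {R : realType} {s : nat}.
Implicit Types (u : 'cV[R]_s) (p : 'I_s -> R).

Definition interior_cube u := forall j, 0 < u j ord0 < 1.

(** Boxes are anchored at the corner 1 of the cube because the telescoping sums
    over the grid start from its lowest node. *)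
Definition upper_box p u : bool := [forall j, p j <= u j ord0].

Definition unit_corner p := forall j, 0 <= p j <= 1.

Definition volume p : R := \prod_j (1 - p j).

Definition box_error (n : nat) (us : nat -> 'cV[R]_s) p : R :=
  n%:R^-1 * \sum_(i < n) (upper_box p (us i))%:R - volume p.

(** A dominating function for the exponential moments of the Gaussian
    coordinates: each exponential of the normal quantile grows more slowly than
    an inverse square root at the boundary of the cube. *)
Definition boundary_moment u : R :=
  \sum_j (inv_sqrt (u j ord0) + inv_sqrt (1 - u j ord0)).

Lemma boundary_moment_ge0 u : 0 <= boundary_moment u.
Proof. by apply: sumr_ge0 => j _; rewrite addr_ge0// inv_sqrt_ge0. Qed.

(** The boxes and the bounds [wt] on the coefficients are common to all [th], so
    that finitely many box errors control the integration error of [ell th] for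
    all [th] at once, whatever the size of the family. *)
Definition box_approximation (Theta : Type) (ell : Theta -> 'cV[R]_s -> R)
    (err : 'cV[R]_s -> R) (W : R) :=
  exists M (p : 'I_M -> 'I_s -> R) (wt : 'I_M -> R) (coef : Theta -> 'I_M -> R),
    [/\ forall i, unit_corner (p i), forall i, 0 <= wt i, \sum_i wt i <= W,
        forall th i, `|coef th i| <= wt i &
        forall th u, interior_cube u ->
          `|ell th u - \sum_i coef th i * (upper_box (p i) u)%:R| <= err u].

End upper_boxes.

Lemma box_approximation_sub (R : realType) (s : nat) (Theta : Type)
    (ell ell' : Theta -> 'cV[R]_s -> R) err err' W W' :
  (forall th u, interior_cube u -> ell' th u = ell th u) ->
  (forall u, interior_cube u -> err u <= err' u) -> W <= W' ->
  box_approximation ell err W -> box_approximation ell' err' W'.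
Proof.
move=> ellE lerr leW [M [p [wt [coef [p01 wt0 wtW cwt happ]]]]].
exists M, p, wt, coef; split=> // [|th u iu]; first exact: le_trans wtW leW.
by rewrite ellE//; apply: le_trans (happ th u iu) (lerr u iu).
Qed.

Section change_of_coordinates.
Context {R : realType} {s d : nat} {Theta : Type}.
Variable phi : 'cV[R]_d -> R.
Hypothesis phi_smooth : smooth phi.
Hypothesis phi_growth : poly_growing_partials phi.
Variables tau thr : 'I_s -> R -> R.
Hypothesis tau_thr : forall j u y, 0 < u < 1 -> (y <= tau j u) = (thr j y <= u).
Hypothesis tau_moment : forall K, 0 <= K -> exists C, 0 <= C /\
  forall j u, 0 < u < 1 ->
    expR (K * `|tau j u|) <= C * (inv_sqrt u + inv_sqrt (1 - u)).

Definition coordinates (u : 'cV[R]_s) : 'I_s -> R := fun j => tau j (u j ord0).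

Let clip (x : R) := Num.min 1 (Num.max 0 x).

Let clip_le x u : 0 < u < 1 -> (clip x <= u) = (x <= u).
Proof.
move=> /andP[u0 u1]; rewrite /clip ge_min [1 <= u]leNgt u1/=.
by rewrite ge_max (ltW u0).
Qed.

Let clip01 x : 0 <= clip x <= 1.
Proof. by rewrite /clip le_min ler01 le_max lexx/= ge_min lexx. Qed.

(** As the coordinate maps are increasing, the boxes of the grid in [z] pull
    back to upper boxes of the unit cube. *)
Let in_box_upper lam N b : exists p, unit_corner p /\
  forall u, interior_cube u -> in_box lam N b (coordinates u) = upper_box p u.
Proof.
elim: b => [|[j k] b [p [p01 hp]]].
  exists (fun=> 0); split=> [j|u iu]; first by rewrite lexx ler01.
  by apply/esym/forallP => j; have /andP[/ltW] := iu j.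
pose q := if k == 0%N then 0 else clip (thr j (grid lam N k)).
have q01 : 0 <= q <= 1 by rewrite /q; case: ifP => _; rewrite ?lexx ?ler01 ?clip01.
exists (fun i => if i == j then Num.max (p i) q else p i); split=> [i|u iu].
  case: eqP => // _; move: (p01 i) q01 => /andP[p0 p1] /andP[q0 q1].
  by rewrite le_max p0/= ge_max p1.
rewrite /in_box/= -/(in_box lam N b (coordinates u)) hp// /upper_box.
have qu : (k == 0%N) || (grid lam N k <= coordinates u j) = (q <= u j ord0).
  rewrite /q /coordinates tau_thr//; case: eqP => //= _; last by rewrite clip_le.
  by have /andP[/ltW ->] := iu j.
rewrite qu; apply/andP/forallP => [[qj /forallP pu] i|h].
  by case: eqP => [->|_] //; rewrite ge_max pu.
split; first by have := h j; rewrite eqxx ge_max => /andP[].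
apply/forallP => i; have := h i; case: eqP => // _.
by rewrite ge_max => /andP[].
Qed.

(** The grid has half-width [lam = eta * ln n] and [n] cells in each direction.
    Then [expR (c * lam)] is the small power [n `^ (c * eta)], the mesh is of
    order [ln n / n], and the factor [expR (- lam / eta)] gained outside the grid
    is exactly [1 / n]. *)
Lemma tame_box_approximation (G : Theta -> ('I_s -> R) -> R) : tame phi G ->
  exists c, 0 <= c /\ forall eta, 0 < eta -> exists C, 0 <= C /\
    forall n, (0 < n)%N -> box_approximation (fun th u => G th (coordinates u))
      (fun u => C / n%:R * (n%:R `^ (c * eta) + boundary_moment u))
      (C * n%:R `^ (c * eta)).
Proof.
move=> tG.
have [c0 [c00 hround]] := tame_round phi_smooth phi_growth tG.
have [C1 [c1 [C10 c10 hdiff]]] :=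
  tame_diffs phi_smooth phi_growth tG (enum_uniq 'I_s).
pose c := c0 + 1 + c1 + s%:R.
exists c; split; first by rewrite !addr_ge0.
move=> eta eta0.
have K0 : 0 <= eta^-1 by rewrite invr_ge0 ltW.
have [C2 [C20 {}hround]] := hround _ K0.
have [C3 [C30 hmom]] := tau_moment (addr_ge0 c00 K0).
exists (C2 * (2 + C3) + C1 * 2 ^+ s); split.
  by rewrite addr_ge0 ?mulr_ge0 ?addr_ge0 ?exprn_ge0.
move=> n n0.
have n0R : 0 < n%:R :> R by rewrite ltr0n.
have n1R : 1 <= n%:R :> R by rewrite ler1n.
pose lam := eta * ln (n%:R : R).
have lam0 : 0 <= lam by rewrite mulr_ge0 ?ln_ge0// ltW.
have powE x : (n%:R : R) `^ (x * eta) = expR (x * lam).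
  by rewrite /powR gt_eqF// /lam mulrA.
have le_pow x : x <= c -> expR (x * lam) <= n%:R `^ (c * eta).
  by move=> xc; rewrite powE ler_expR ler_wpM2r.
have lamE : lam <= expR lam by rewrite (le_trans _ (expR_ge1Dx _))// lerDr.
have invn : expR (- (eta^-1 * lam)) = n%:R^-1.
  by rewrite /lam mulKf ?gt_eqF// expRN lnK// posrE.
pose bs := boxes n (enum 'I_s).
have /choice[p hp] := in_box_upper lam n.
pose bi (i : 'I_(size bs)) := tnth (in_tuple bs) i.
have bibs i : bi i \in bs by rewrite mem_tnth.
have cube0 : in_cube lam (fun _ : 'I_s => 0 : R) by move=> j; rewrite normr0.
exists (size bs), (fun i => p (bi i)),
  (fun i => C1 * expR (c1 * lam) * weight lam n (bi i)),
  (fun th i => diffs lam n (bi i) (G th) (fun=> 0)).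
split.
- by move=> i; have [] := hp (bi i).
- by move=> i; rewrite !mulr_ge0 ?expR_ge0 ?weight_ge0.
- rewrite -(big_tnth _ _ _ xpredT (fun b => C1 * expR (c1 * lam) * weight lam n b)).
  rewrite -big_distrr/= sum_weight// size_enum_ord.
  have : (1 + 2 * lam) ^+ s <= (2 * expR lam) ^+ s.
    have e1 := expR_ge1Dx lam.
    by apply: lerXn2r; rewrite ?nnegrE; lra.
  rewrite exprMn -expRM_natl => h.
  rewrite (@le_trans _ _ (C1 * 2 ^+ s * n%:R `^ (c * eta)))//; last first.
    by rewrite ler_wpM2r ?powR_ge0// lerDr mulr_ge0 ?addr_ge0.
  rewrite (@le_trans _ _ (C1 * expR (c1 * lam) * (2 ^+ s * expR (s%:R * lam))))//.
    by rewrite ler_wpM2l ?mulr_ge0 ?expR_ge0.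
  rewrite mulrACA -expRD -mulrDl ler_wpM2l ?mulr_ge0 ?exprn_ge0//.
  by rewrite le_pow// /c; lra.
- by move=> th i; apply: hdiff.
- move=> th u iu.
  have -> : \sum_(i < size bs) diffs lam n (bi i) (G th) (fun=> 0) *
      (upper_box (p (bi i)) u)%:R =
      \sum_(b <- bs) diffs lam n b (G th) (fun=> 0) *
        (in_box lam n b (coordinates u))%:R.
    rewrite [RHS]big_tnth; apply: eq_bigr => i _.
    by have [_ ->] := hp (bi i).
  rewrite -box_expansion//.
  have -> : (fun j => if j \in enum 'I_s then round lam n (coordinates u j) else 0)
      = round lam n \o coordinates u.
    by apply/funext => j; rewrite mem_enum.
  rewrite (le_trans (hround lam n lam0 n0 th _))//.
  rewrite invn /mesh.
  have m0 := boundary_moment_ge0 u.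
  have h1 : expR (c0 * lam) * (2 * lam / n%:R) <= 2 * n%:R `^ (c * eta) / n%:R.
    rewrite mulrA ler_wpM2r ?invr_ge0// mulrCA ler_wpM2l//.
    rewrite (@le_trans _ _ (expR (c0 * lam) * expR lam))//.
      by rewrite ler_wpM2l ?expR_ge0.
    rewrite -expRD -{2}[lam]mul1r -mulrDl le_pow// /c.
    by rewrite -addrA lerDl addr_ge0.
  have h2 : \sum_j expR ((c0 + eta^-1) * `|coordinates u j|) <=
      C3 * boundary_moment u.
    rewrite /boundary_moment big_distrr/= ler_sum// => j _; exact: hmom.
  rewrite (@le_trans _ _ (C2 * (2 * n%:R `^ (c * eta) / n%:R
      + n%:R^-1 * (C3 * boundary_moment u))))//.
    by rewrite ler_wpM2l// lerD// ler_wpM2l ?invr_ge0.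
  rewrite (@le_trans _ _ (C2 * (2 + C3) / n%:R *
      (n%:R `^ (c * eta) + boundary_moment u)))//; last first.
    rewrite ler_wpM2r ?addr_ge0 ?powR_ge0// ler_wpM2r ?invr_ge0//.
    by rewrite lerDl mulr_ge0 ?exprn_ge0.
  rewrite -!mulrA ler_wpM2l//.
  have -> : 2 * (n%:R `^ (c * eta) * n%:R^-1) + n%:R^-1 * (C3 * boundary_moment u)
    = n%:R^-1 * (2 * n%:R `^ (c * eta) + C3 * boundary_moment u) by ring.
  rewrite mulrCA ler_wpM2l ?invr_ge0// mulrDl.
  have pw0 : 0 <= (n%:R : R) `^ (c * eta) by exact: powR_ge0.
  nra.
Qed.

End change_of_coordinates.

(** * Random vectors near the boundary of the cube *)

Section boundary_tails.
Context {d} {T : measurableType d} {R : realType} {s : nat}.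
Variable P : probability T R.
Implicit Types (X : T -> 'cV[R]_s) (A : R).

(** All that is used of the law of one sample point besides its box errors: it
    charges the neighbourhood of a face at most [A] times as much as the uniform
    law does.  Scrambled points satisfy it with [A = beta]. *)
Definition boundary_tails X A := forall j,
  [/\ measurable_fun setT (fun w => X w j ord0),
      forall x, 0 < x -> (P [set w | (X w j ord0 <= x)%R] <= (A * x)%:E)%E &
      forall x, 0 < x -> (P [set w | (1 - X w j ord0 <= x)%R] <= (A * x)%:E)%E].

Lemma boundary_tails_interior X A : 0 <= A -> boundary_tails X A ->
  {ae P, forall w, interior_cube (X w)}.
Proof.
move=> A0 tX.
suff : \forall w \ae P, forall j, 0 < X w j ord0 < 1 by [].
apply: filter_forall => j; have [mX lo hi] := tX j.
have m1X : measurable_fun setT (fun w => 1 - X w j ord0) by exact: measurable_funB.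
apply: filterS2 (ae_gt0 A0 mX lo) (ae_gt0 A0 m1X hi) => w -> /=.
by rewrite subr_gt0.
Qed.

Lemma boundary_tails_moment X A : 0 <= A -> boundary_tails X A ->
  mean_le P (fun w => boundary_moment (X w)) (s%:R * (2 * (1 + 4 * A))).
Proof.
move=> A0 tX.
have -> : s%:R * (2 * (1 + 4 * A)) = \sum_(j < s) ((1 + 4 * A) + (1 + 4 * A)).
  by rewrite sumr_const card_ord -mulr_natl; ring.
apply: mean_le_sum => j; have [mX lo hi] := tX j.
have m1X : measurable_fun setT (fun w => 1 - X w j ord0) by exact: measurable_funB.
by apply: mean_leD; split; try (by move=> w; exact: inv_sqrt_ge0);
  try (by apply: measurableT_comp => //; exact: measurable_inv_sqrt);
  exact: integral_inv_sqrt.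
Qed.

Lemma measurable_upper_box X p :
  (forall j, measurable_fun setT (fun w => X w j ord0)) ->
  measurable [set w | upper_box p (X w)].
Proof.
move=> mX.
have -> : [set w | upper_box p (X w)] =
    \bigcap_(j in [set: 'I_s]) [set w | p j <= X w j ord0].
  apply/seteqP; split => w; first by move=> /forallP h j _; exact: h.
  by move=> h; apply/forallP => j; exact: h.
apply: fin_bigcap_measurable => [|j _]; first exact: finite_finset.
rewrite -[X in measurable X]setTI.
exact: (@measurable_fun_le _ _ _ setT (cst (p j))).
Qed.

Lemma uniform_vector_measurable X j : uniform_vector P X ->
  measurable_fun setT (fun w => X w j ord0).
Proof.
move=> [mX _].
apply: (@measurability _ _ _ _ _ _ _ (RGenOInfty.measurableE R)) => //.
move=> _ [_ [y ->] <-]; rewrite setTI.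
apply: (mX [set x | x j ord0 \in `]y, +oo[]); apply: sub_sigma_algebra => /=.
apply: (@open_comp _ _ (fun x : 'cV[R]_s => x j ord0) `]y, +oo[%classic).
  by move=> x _; exact: coord_continuous.
exact: interval_open.
Qed.

Lemma uniform_vector_upper_box X p : uniform_vector P X -> unit_corner p ->
  P [set w | upper_box p (X w)] = (volume p)%:E.
Proof.
move=> uX p01; have [_ uXP] := uX.
have -> : [set w | upper_box p (X w)] =
    [set w | forall j, `[p j, +oo[%classic (X w j ord0)].
  apply/seteqP; split => w; first by move=> /forallP h j /=; rewrite in_itv/= h.
  by move=> h; apply/forallP => j; have := h j; rewrite /= in_itv/= andbT.
rewrite (uXP (fun j => `[p j, +oo[%classic))// /volume -prodEFin; apply: eq_bigr => j _.
have /andP[pj0 pj1] := p01 j.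
have -> : `[p j, +oo[ `&` `]0, 1[ = if p j == 0 then `]0, 1[%classic else `[p j, 1[%classic.
  apply/seteqP; split => x; case: eqP => pj /=; rewrite !in_itv/= ?andbT.
  - by move=> [].
  - by move=> [-> /andP[]].
  - by move=> /andP[x0 x1]; rewrite pj x0 x1 ltW.
  - move=> /andP[px x1]; rewrite px x1 andbT; split=> //.
    by rewrite (lt_le_trans _ px)// lt_neqAle pj0 andbT eq_sym; apply/eqP.
case: eqP => [->|_].
  by rewrite lebesgue_measure_itv/= lte_fin ltr01 subr0 oppr0 adde0.
rewrite lebesgue_measure_itv/= lte_fin; case: ltP => // pj.
by have -> : p j = 1; [apply/eqP; rewrite eq_le pj1|rewrite subrr].
Qed.

Lemma uniform_vector_tails X : uniform_vector P X -> boundary_tails X 1.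
Proof.
move=> uX j; have [_ uXP] := uX.
have H (B : set R) x : 0 < x -> measurable B ->
    (lebesgue_measure (B `&` `]0%R, 1%R[%classic) <= x%:E)%E ->
    (P [set w | B (X w j ord0)] <= (1 * x)%:E)%E.
  move=> x0 mB Bx; rewrite mul1r.
  have -> : [set w | B (X w j ord0)] =
      [set w | forall i, (if i == j then B else setT) (X w i ord0)].
    apply/seteqP; split => w /=; first by move=> Bw i; case: eqP => // ->.
    by move=> /(_ j); rewrite eqxx.
  rewrite (uXP (fun i => if i == j then B else setT)); last by move=> i; case: ifP.
  rewrite (bigD1 j)//= eqxx big1 ?mule1// => i ij.
  by rewrite (negbTE ij) setTI lebesgue_measure_itv/= lte_fin ltr01 oppr0 adde0.
split; first exact: uniform_vector_measurable.
- move=> x x0; apply: (H `]-oo, x]%classic) => //.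
  apply: (@le_trans _ _ (lebesgue_measure (`]0, x]%classic : set R))).
    apply: le_measure; rewrite ?inE//; first exact: measurableI.
    by move=> y [/=]; rewrite !in_itv/= => -> /andP[->].
  by rewrite lebesgue_measure_itv/= lte_fin x0 oppr0 adde0.
- move=> x x0.
  have -> : [set w | 1 - X w j ord0 <= x] = [set w | `[1 - x, +oo[%classic (X w j ord0)].
    by apply/seteqP; split => w /=; rewrite in_itv/= andbT lerBlDl lerBlDr addrC.
  apply: H => //.
  apply: (@le_trans _ _ (lebesgue_measure (`[1 - x, 1[%classic : set R))).
    apply: le_measure; rewrite ?inE//; first exact: measurableI.
    by move=> y [/=]; rewrite !in_itv/= andbT => -> /andP[_ ->].
  rewrite lebesgue_measure_itv/= lte_fin gtrBl x0 -EFinB lee_fin; lra.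
Qed.

End boundary_tails.

(** * From box errors to the expected excess risk *)

Section expected_excess_risk.
Context {R : realType} {s : nat} {Theta : Type}.
Variable ell : Theta -> 'cV[R]_s -> R.
Hypothesis ell_ge0 : forall th u, 0 <= ell th u.
Context {d0} {T0 : measurableType d0}.
Variables (P0 : probability T0 R) (U : T0 -> 'cV[R]_s).
Hypothesis unifU : uniform_vector P0 U.

Definition population_risk th : \bar R := (\int[P0]_w (ell th (U w))%:E)%E.

Definition sample_risk n (us : nat -> 'cV[R]_s) th : R :=
  n%:R^-1 * \sum_(i < n) ell th (us i).

Variables (a b W : R) (n : nat).
Hypotheses (a0 : 0 <= a) (b0 : 0 <= b) (n0 : (0 < n)%N).
Hypothesis approx :
  box_approximation ell (fun u => a * (b + boundary_moment u)) W.

(** Population and sample risk differ by the same combination of box errors,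
    up to the approximation error on either side; the bound does not depend on
    the parameter. *)
Lemma risk_deviation : exists M (p : 'I_M -> 'I_s -> R) (wt : 'I_M -> R)
    (rk : Theta -> R),
  [/\ forall i, unit_corner (p i), forall i, 0 <= wt i, \sum_i wt i <= W,
      forall th, population_risk th = (rk th)%:E &
      forall th us, (forall i, (i < n)%N -> interior_cube (us i)) ->
        `|sample_risk n us th - rk th| <= a * (b + s%:R * 10) +
          (a * (b + n%:R^-1 * \sum_(i < n) boundary_moment (us i)) +
           \sum_i wt i * `|box_error n us (p i)|)].
Proof.
have [M [p [wt [coef [p01 wt0 wtW cwt happ]]]]] := approx.
exists M, p, wt.
have mU j := uniform_vector_measurable j unifU.
have tU := uniform_vector_tails unifU.
pose Y th w := \sum_i coef th i * (upper_box (p i) (U w))%:R.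
pose Q th := \sum_i coef th i * volume (p i).
have indE i w : (upper_box (p i) (U w))%:R =
    \1_[set w | upper_box (p i) (U w)] w :> R.
  rewrite indicE; congr (_%:R); congr nat_of_bool.
  by apply/idP/idP => [h|/set_mem//]; exact/mem_set.
have mbox i := measurable_upper_box (p i) mU.
have iU th i : P0.-integrable setT
    (fun w => (coef th i * (upper_box (p i) (U w))%:R)%:E).
  under eq_fun do rewrite indE EFinM.
  by apply: integrableZl => //; exact: integrable_indic.
have YQ th : P0.-integrable setT (EFin \o Y th) /\
    (\int[P0]_w (Y th w)%:E = (Q th)%:E)%E.
  have E : EFin \o Y th = (fun w => \sum_(i < M)
      (coef th i * (upper_box (p i) (U w))%:R)%:E)%E.
    by apply/funext => w; rewrite /= /Y sumEFin.
  split; first by rewrite E; apply: integrable_sum.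
  rewrite -[X in integral _ _ X]/(EFin \o Y th) E integral_sum//.
  rewrite /Q -sumEFin; apply: eq_bigr => i _.
  under eq_integral do rewrite indE EFinM.
  rewrite integralZl//; last exact: integrable_indic.
  rewrite (integral_indic P0 measurableT (mbox i)) setIT EFinM.
  by congr (_ * _)%E; exact: uniform_vector_upper_box.
have hU : mean_le P0 (fun w => a * (b + boundary_moment (U w))) (a * (b + s%:R * 10)).
  apply: mean_leZ => //; apply: mean_leD; first exact: mean_le_cst.
  have := boundary_tails_moment ler01 tU.
  by rewrite (_ : 2 * (1 + 4 * 1) = 10 :> R)//; ring.
have /choice[rk hrk] : forall th, exists r, population_risk th = r%:E /\
    `|r - Q th| <= a * (b + s%:R * 10).
  move=> th; have [iY Yy] := YQ th.
  have [||r rE rQ] := @integral_near _ _ _ P0 (fun w => ell th (U w)) (Y th)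
    (fun w => a * (b + boundary_moment (U w))) _ _ _ iY Yy hU.
  - by move=> w.
  - apply: filterS (boundary_tails_interior ler01 tU) => w; exact: happ.
  - by exists r.
exists rk; split=> //; first by move=> th; have [] := hrk th.
move=> th us ius; have [_ hr] := hrk th.
have -> : sample_risk n us th - rk th =
  (n%:R^-1 * \sum_(i < n) (ell th (us i)
     - \sum_j coef th j * (upper_box (p j) (us i))%:R) +
   \sum_j coef th j * box_error n us (p j)) - (rk th - Q th).
  rewrite /sample_risk sumrB mulrBr exchange_big/=.
  have -> : \sum_j coef th j * box_error n us (p j) =
     n%:R^-1 * (\sum_j \sum_(i < n) coef th j * (upper_box (p j) (us i))%:R) - Q th.
    rewrite /Q mulr_sumr -sumrB; apply: eq_bigr => j _.
    by rewrite /box_error mulrBr -mulr_sumr mulrCA.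
  by ring.
rewrite (le_trans (ler_normB _ _))// addrC lerD//.
rewrite (le_trans (ler_normD _ _))// lerD//.
  rewrite normrM ger0_norm ?invr_ge0//.
  rewrite (@le_trans _ _ (n%:R^-1 * \sum_(i < n)
      (a * (b + boundary_moment (us i)))))//.
    rewrite ler_wpM2l ?invr_ge0// (le_trans (ler_norm_sum _ _ _))//.
    by apply: ler_sum => i _; apply: happ; exact: ius.
  rewrite -mulr_sumr mulrCA ler_wpM2l// big_split/= mulrDr lerD2r.
  rewrite sumr_const card_ord -[X in _ * X <= _]mulr_natl mulKf//.
  by rewrite pnatr_eq0 -lt0n.
rewrite (le_trans (ler_norm_sum _ _ _))//; apply: ler_sum => j _.
by rewrite normrM ler_wpM2r.
Qed.

(** The learner [th w] beats [thH] on the sample, so its excess risk is at most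
    twice the deviation of [risk_deviation], in which [th w] no longer appears;
    only the mean of that deviation is left to bound. *)
Lemma expected_excess_risk {dO} {Omega : measurableType dO}
    (P : probability Omega R) (u : nat -> Omega -> 'cV[R]_s) (A kappa : R)
    (th : Omega -> Theta) (thH : Theta) :
  0 <= A -> (forall i, boundary_tails P (u i) A) ->
  (forall p, unit_corner p ->
    mean_le P (fun w => `|box_error n (u ^~ w) p|) kappa) ->
  (forall th', (population_risk thH <= population_risk th')%E) ->
  {ae P, forall w, sample_risk n (u ^~ w) (th w) <= sample_risk n (u ^~ w) thH} ->
  exists e, (\int[P]_w (population_risk (th w) - population_risk thH) = e%:E)%E /\
    0 <= e <= 2 * (a * (b + s%:R * 10) + (a * (b + s%:R * (2 * (1 + 4 * A)))
      + W * kappa)).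
Proof.
move=> A0 tu hbox Hmin hth.
have [M [p [wt [rk [p01 wt0 wtW rkE hdev]]]]] := risk_deviation.
pose D w := a * (b + s%:R * 10) +
  (a * (b + n%:R^-1 * \sum_(i < n) boundary_moment (u i w)) +
   \sum_i wt i * `|box_error n (u ^~ w) (p i)|).
have kappa0 : 0 <= kappa.
  have p0 : unit_corner (fun _ : 'I_s => 0 : R) by move=> j; rewrite lexx ler01.
  have [_ h0 /(le_trans _)] := hbox _ p0; rewrite -lee_fin; apply.
  by apply: integral_ge0 => w _; rewrite lee_fin.
have n0R : 0 < n%:R :> R by rewrite ltr0n.
have c0 : 0 <= a * (b + s%:R * 10) by rewrite mulr_ge0// addr_ge0// mulr_ge0.
have hD : mean_le P D (a * (b + s%:R * 10) +
    (a * (b + s%:R * (2 * (1 + 4 * A))) + W * kappa)).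
  apply: mean_leD; first exact: mean_le_cst.
  apply: mean_leD.
    apply: mean_leZ => //; apply: mean_leD; first exact: mean_le_cst.
    have -> : s%:R * (2 * (1 + 4 * A)) =
        n%:R^-1 * \sum_(i < n) s%:R * (2 * (1 + 4 * A)).
      rewrite sumr_const card_ord -[X in _ = _ * X]mulr_natl mulKf//.
      by rewrite gt_eqF.
    apply: mean_leZ; first by rewrite invr_ge0 ltW.
    by apply: mean_le_sum => i; exact: boundary_tails_moment.
  have [mS S0 Sle] := @mean_le_sum _ _ _ P M
    (fun i w => wt i * `|box_error n (u ^~ w) (p i)|) (fun i => wt i * kappa)
    (fun i => mean_leZ (wt0 i) (hbox _ (p01 i))).
  split=> //; apply: (le_trans Sle).
  by rewrite lee_fin -mulr_suml ler_wpM2r.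
have ae_int : {ae P, forall w, forall i, (i < n)%N -> interior_cube (u i w)}.
  have : {ae P, forall w, forall i : 'I_n, interior_cube (u i w)}.
    by apply: filter_forall => i; exact: boundary_tails_interior A0 (tu i).
  by apply: filterS => w h i lt_i; exact: (h (Ordinal lt_i)).
pose e w := rk (th w) - rk thH.
have eE w : (population_risk (th w) - population_risk thH)%E = (e w)%:E.
  by rewrite !rkE.
have e0 w : 0 <= e w by rewrite subr_ge0 -lee_fin -!rkE.
have h2D := mean_leZ (ler0n R 2) hD.
under eq_integral do rewrite eE.
have up : (\int[P]_w (e w)%:E <= (2 * (a * (b + s%:R * 10) +
    (a * (b + s%:R * (2 * (1 + 4 * A))) + W * kappa)))%:E)%E.
  have [m2D D20 D2le] := h2D.
  apply: le_trans D2le; apply: ae_le_integral_measurable_r.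
  - by move=> w; rewrite lee_fin.
  - by move=> w; rewrite lee_fin.
  - exact/measurable_EFinP.
  - apply: filterS2 ae_int hth => w iw hmin; rewrite lee_fin.
    have := hdev (th w) (u ^~ w) iw; have := hdev thH (u ^~ w) iw.
    rewrite -/(D w) !ler_norml /e => /andP[_ h1] /andP[h2 _].
    lra.
have fin : (\int[P]_w (e w)%:E)%E \is a fin_num.
  rewrite ge0_fin_numE ?(le_lt_trans up) ?ltry//.
  by apply: integral_ge0 => w _; rewrite lee_fin.
exists (fine (\int[P]_w (e w)%:E)%E); rewrite fineK//; split=> //.
apply/andP; split; first by apply: fine_ge0; apply: integral_ge0 => w _; rewrite lee_fin.
by rewrite -lee_fin fineK.
Qed.

End expected_excess_risk.

(** * Box errors of independent samples *)

Section independent_samples.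
Context {d} {T : measurableType d} {R : realType} {s : nat}.
Variable P : probability T R.

Lemma integral_indic_comb (I : Type) (r : seq I) (c : I -> R) (B : I -> set T) :
  (forall i, measurable (B i)) ->
  P.-integrable setT (fun w => (\sum_(i <- r) c i * \1_(B i) w)%:E) /\
  (\int[P]_w (\sum_(i <- r) c i * \1_(B i) w)%:E =
    (\sum_(i <- r) c i * fine (P (B i)))%:E)%E.
Proof.
move=> mB.
have iB i : P.-integrable setT (fun w => (c i * \1_(B i) w)%:E).
  under eq_fun do rewrite EFinM.
  by apply: integrableZl => //; exact: integrable_indic.
have E : (fun w => (\sum_(i <- r) c i * \1_(B i) w)%:E) =
    (fun w => \sum_(i <- r) (c i * \1_(B i) w)%:E)%E.
  by apply/funext => w; rewrite sumEFin.
rewrite E; split; first exact: integrable_sum.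
rewrite integral_sum// -sumEFin; apply: eq_bigr => i _.
under eq_integral do rewrite EFinM.
rewrite integralZl//; last exact: integrable_indic.
by rewrite integral_indic// setIT EFinM fineK ?fin_num_measure.
Qed.

Lemma borel_upper_box (p : 'I_s -> R) : borel [set x : 'cV[R]_s | upper_box p x].
Proof.
have -> : [set x : 'cV[R]_s | upper_box p x] =
    ~` (\bigcup_(j in [set: 'I_s]) [set x : 'cV[R]_s | x j ord0 \in `]-oo, p j[]).
  apply/seteqP; split => x /=.
    by move=> /forallP h [j _] /=; rewrite in_itv/= ltNge h.
  move=> h; apply/forallP => j; rewrite leNgt; apply/negP => xj.
  by apply: h; exists j; rewrite //= in_itv.
rewrite /borel -setTD; apply: (@sigma_algebraCD _ [set: 'cV[R]_s]).
apply: sub_sigma_algebra => /=; apply: bigcup_open => j _.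
apply: (@open_comp _ _ (fun x : 'cV[R]_s => x j ord0) `]-oo, p j[%classic).
  by move=> x _; exact: coord_continuous.
exact: interval_open.
Qed.

(** The variance of the mean of [n] independent indicators is at most [1 / n];
    the first absolute moment follows from
    [2 * `|x| <= sqrt n * x ^+ 2 + 1 / sqrt n]. *)
Lemma iid_box_error (u : nat -> T -> 'cV[R]_s) n p : (0 < n)%N ->
  iid_uniform P u -> unit_corner p ->
  mean_le P (fun w => `|box_error n (u ^~ w) p|) (Num.sqrt n%:R)^-1.
Proof.
move=> n0 [uu ind] p01.
have n0R : 0 < n%:R :> R by rewrite ltr0n.
have nn0 : n%:R != 0 :> R by rewrite gt_eqF.
pose B i := [set w | upper_box p (u i w)].
have mB i : measurable (B i).
  apply: measurable_upper_box => j; exact: uniform_vector_measurable (uu i).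
set v := volume p.
have PB i : P (B i) = v%:E by exact: uniform_vector_upper_box.
have PBB i j : i != j -> P (B i `&` B j) = (v * v)%:E.
  move=> ij; have := ind [:: i; j] (fun=> [set x | upper_box p x]).
  rewrite /= inE ij => /(_ isT (fun=> borel_upper_box p)).
  rewrite big_cons big_seq1 [X in _ = (X * _)%E -> _]PB
    [X in _ = (_ * X)%E -> _]PB EFinM => <-.
  congr (P _); apply/seteqP; split => w.
    by move=> [Bi Bj] k /=; rewrite !inE => /orP[] /eqP->.
  by move=> h; split; apply: h; rewrite /= !inE eqxx// orbT.
have v01 : 0 <= v <= 1.
  rewrite -!lee_fin -(PB 0%N) measure_ge0/=; exact: probability_le1.
pose X i w : R := \1_(B i) w.
have XE i w : (upper_box p (u i w))%:R = X i w.
  rewrite /X indicE; congr (_%:R); congr nat_of_bool.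
  by apply/idP/idP => [h|/set_mem//]; exact/mem_set.
have errE w : box_error n (u ^~ w) p = n%:R^-1 * \sum_(i < n) (X i w - v).
  rewrite /box_error sumrB sumr_const card_ord mulrBr.
  rewrite -[X in _ - _ * X]mulr_natl mulKf//.
  by congr (_ * _ - _); apply: eq_bigr => i _; rewrite XE.
have cov i j : (\int[P]_w ((X i w - v) * (X j w - v))%:E =
     (if i == j then v - v * v else 0)%:E)%E /\
    P.-integrable setT (fun w => ((X i w - v) * (X j w - v))%:E).
  (* The product of the two centred indicators expands into a combination of the
     indicators of [B i :&: B j], [B i], [B j] and the whole space. *)
  pose c := nth 0 [:: 1; - v; - v; v * v].
  pose S k := match k with 0 => B i `&` B j | 1 => B i | 2 => B j | _ => setT end.
  have mS k : measurable (S k).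
    by case: k => [|[|[|k]]] //=; exact: measurableI.
  have E : (fun w => ((X i w - v) * (X j w - v))%:E) =
      (fun w => (\sum_(k <- iota 0 4) c k * \1_(S k) w)%:E).
    apply/funext => w; congr EFin.
    rewrite !big_cons big_nil /c /S/= indicI indicT /X /=; ring.
  have [iS SE] := integral_indic_comb (iota 0 4) c mS.
  rewrite E; split=> //.
  rewrite [LHS]SE !big_cons big_nil /c /S/= !PB probability_setT/=.
  congr EFin; case: eqP => [->|/eqP ij].
    by rewrite setIid PB/=; ring.
  by rewrite PBB//=; ring.
pose Y w : R := \sum_(i < n) \sum_(j < n) (X i w - v) * (X j w - v).
have YE : (\int[P]_w (Y w)%:E = (n%:R * (v - v * v))%:E)%E.
  rewrite /Y.
  under eq_integral do rewrite -sumEFin.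
  under eq_integral do under eq_bigr do rewrite -sumEFin.
  rewrite integral_sum//; last first.
    by move=> i; apply: integrable_sum => // j _; have [] := cov i j.
  have h (i : 'I_n) : (\int[P]_w (\sum_(j < n) ((X i w - v) * (X j w - v))%:E) =
      (v - v * v)%:E)%E.
    rewrite integral_sum//; last by move=> j; have [] := cov i j.
    rewrite (bigD1 i)//= big1 ?adde0; first by have [-> _] := cov i i; rewrite eqxx.
    move=> j ji; have [-> _] := cov i j.
    by rewrite (_ : (i == j :> nat) = false)//; apply/negbTE; rewrite eq_sym.
  under eq_bigr do rewrite h.
  by rewrite sumEFin sumr_const card_ord mulr_natl.
have Y2 w : Y w = (\sum_(i < n) (X i w - v)) ^+ 2.
  rewrite expr2 mulr_suml; apply: eq_bigr => i _.
  by rewrite mulr_sumr.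
have sq0 : 0 < Num.sqrt n%:R :> R by rewrite sqrtr_gt0.
have mX i : measurable_fun setT (X i) by exact: measurable_indic.
have mS : measurable_fun setT (fun w => \sum_(i < n) (X i w - v)).
  by apply: measurable_sum => i; exact: measurable_funB.
have mY : mean_le P Y (n%:R * (v - v * v)).
  split; last by rewrite YE.
    by rewrite (funext Y2); exact: measurable_funX.
  by move=> w; rewrite Y2 sqr_ge0.
pose k := 2^-1 * (Num.sqrt n%:R / n%:R ^+ 2) : R.
have k0 : 0 <= k by rewrite !mulr_ge0 ?invr_ge0 ?exprn_ge0 ?ltW.
have ms0 : 0 <= 2^-1 * (Num.sqrt n%:R)^-1 :> R by rewrite mulr_ge0 ?invr_ge0 ?ltW.
have [mh h0 hle] := mean_leD (mean_leZ k0 mY) (mean_le_cst P ms0).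
split.
- apply: measurableT_comp => //; under eq_fun do rewrite errE.
  exact: measurable_funM.
- by move=> w; exact: normr_ge0.
- apply: (@le_trans _ _ (\int[P]_w (k * Y w + 2^-1 * (Num.sqrt n%:R)^-1)%:E)%E).
    apply: ge0_le_integral_nonmeasurable => w; first by rewrite lee_fin.
    rewrite lee_fin errE Y2; set S := \sum_(i < n) _.
    set q := Num.sqrt n%:R; rewrite normrM ger0_norm ?invr_ge0//.
    have nq : n%:R = q ^+ 2 :> R by rewrite sqr_sqrtr// ltW.
    have := sqr_ge0 (`|S| / q - 1).
    rewrite sqrrB expr1n mulr1 exprMn real_normK ?num_real// exprVn => hq.
    rewrite /k -/q nq -subr_ge0.
    have -> : 2^-1 * (q / q ^+ 2 ^+ 2) * S ^+ 2 + 2^-1 / q - (q ^+ 2)^-1 * `|S| =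
      2^-1 * q^-1 * (S ^+ 2 / q ^+ 2 - `|S| / q *+ 2 + 1).
      have := lt0r_neq0 sq0; rewrite -/q => qn0; rewrite mulr2n; field.
      exact: qn0.
    by rewrite mulr_ge0// mulr_ge0 ?invr_ge0// ltW.
  apply: (le_trans hle); rewrite lee_fin /k.
  set q := Num.sqrt n%:R.
  have nq : n%:R = q ^+ 2 :> R by rewrite sqr_sqrtr// ltW.
  have -> : 2^-1 * (q / n%:R ^+ 2) * (n%:R * (v - v * v)) =
     2^-1 * q^-1 * (v - v * v).
    by rewrite nq; have := lt0r_neq0 sq0; rewrite -/q => qn0; field.
  have qV : 0 < q^-1 by rewrite invr_gt0.
  move: v01 => /andP[v0 v1]; nra.
Qed.

End independent_samples.

(** * Box errors of nets *)

Section net_discrepancy.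
Context {R : realType}.
Variables (beta t m s : nat).
Hypotheses (beta1 : (1 < beta)%N) (tm : (t <= m)%N).
Variable x : 'I_(beta ^ m) -> 'cV[R]_s.+1.
Hypothesis x01 : forall i j, 0 <= x i j ord0 < 1.
Hypothesis netx : is_net t x.
Local Notation J := 'I_s.+1.
Implicit Types (k c : J -> nat) (p : J -> R) (F : R -> R).

Let beta_gt0 : (0 < beta)%N.
Proof. exact: ltnW. Qed.

Let beta0 l : 0 < (beta ^ l)%N%:R :> R.
Proof. by rewrite ltr0n expn_gt0 ltnW. Qed.

Let node (l e : nat) : R := e%:R / (beta ^ l)%N%:R.

Let node_le l e e' : (e <= e')%N -> node l e <= node l e'.
Proof. by move=> ee'; rewrite ler_wpM2r ?invr_ge0 // ler_nat. Qed.

Let node_ge0 l e : 0 <= node l e.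
Proof. by rewrite divr_ge0// ltW. Qed.

Let node_scale l e : node l.+1 (beta * e) = node l e.
Proof.
rewrite /node expnS !natrM invfM mulrACA divff ?mul1r//.
by rewrite pnatr_eq0 -lt0n ltnW.
Qed.

(** Membership in an elementary interval and length are both written as
    increments of a function over a cell of the [l]th subdivision, hence are
    additive when the cell is subdivided. *)
Let incr F l e := F (node l e.+1) - F (node l e).

Let incr_split F l e : incr F l e = \sum_(i < beta) incr F l.+1 (beta * e + i)%N.
Proof.
rewrite -(big_mkord xpredT (fun i => incr F l.+1 (beta * e + i)%N)).
under eq_bigr do rewrite /incr -addnS.
rewrite (telescope_sumr (fun i => F (node l.+1 (beta * e + i)%N)))//.
by rewrite -mulnSr addn0 !node_scale.
Qed.

Let lt_ind (y : R) : R -> R := fun z => (y < z)%R%:R.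

Let incr_lt_ind y l e : incr (lt_ind y) l e = (node l e <= y < node l e.+1)%R%:R.
Proof.
rewrite /incr /lt_ind [node l e <= y]leNgt.
case: (ltP y (node l e)) => /= [ye|ye]; last by rewrite subr0.
by rewrite (lt_le_trans ye) ?node_le// subrr.
Qed.

(** [memb] tests [y] for membership in the part above [q] of the [e]th cell of
    length [beta ^- l], whose length is [len]. *)
Let memb y q l e : R := incr (lt_ind y) l e * (q <= y)%R%:R.
Let len q l e : R := incr (Num.max^~ q) l e.

Let memb_ge0 y q l e : 0 <= memb y q l e.
Proof. by rewrite /memb incr_lt_ind mulr_ge0. Qed.

Let len_ge0 q l e : 0 <= len q l e.
Proof.
rewrite /len /incr subr_ge0 ge_max !le_max lexx orbT andbT.
by rewrite node_le.
Qed.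

Let memb_split y q l e :
  memb y q l e = \sum_(i < beta) memb y q l.+1 (beta * e + i)%N.
Proof. by rewrite /memb incr_split mulr_suml. Qed.

Let len_split q l e : len q l e = \sum_(i < beta) len q l.+1 (beta * e + i)%N.
Proof. exact: incr_split. Qed.

Let set_at (k : J -> nat) j v : J -> nat := fun i => if i == j then v else k i.

Let prod_set_at (g : J -> nat -> nat -> R) k c j l e :
  \prod_i g i (set_at k j l i) (set_at c j e i) =
  g j l e * \prod_(i | i != j) g i (k i) (c i).
Proof.
rewrite (bigD1 j)//= /set_at eqxx; congr (_ * _).
by apply: eq_bigr => i /negbTE ->.
Qed.

Let prod_split (g : J -> nat -> nat -> R) k c j :
  (forall l e, g j l e = \sum_(i < beta) g j l.+1 (beta * e + i)%N) ->
  \prod_i g i (k i) (c i) = \sum_(e < beta)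
    \prod_i g i (set_at k j (k j).+1 i) (set_at c j (beta * c j + e)%N i).
Proof.
move=> gs; under [RHS]eq_bigr do rewrite prod_set_at.
by rewrite -mulr_suml -gs (bigD1 j).
Qed.

Let cnt k c p : R := \sum_i \prod_j memb (x i j ord0) (p j) (k j) (c j).
Let vol k c p : R := \prod_j len (p j) (k j) (c j).
Let err k c p := cnt k c p - (beta ^ m)%N%:R * vol k c p.

Let cnt_split k c p j : cnt k c p = \sum_(e < beta)
  cnt (set_at k j (k j).+1) (set_at c j (beta * c j + e)%N) p.
Proof.
rewrite /cnt exchange_big/=; apply: eq_bigr => i _.
apply: (prod_split (g := fun i' => memb (x i i' ord0) (p i'))).
exact: memb_split.
Qed.

Let vol_split k c p j : vol k c p = \sum_(e < beta)
  vol (set_at k j (k j).+1) (set_at c j (beta * c j + e)%N) p.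
Proof. by apply: (prod_split (g := fun i => len (p i))); exact: len_split. Qed.

Let err_split k c p j : err k c p = \sum_(e < beta)
  err (set_at k j (k j).+1) (set_at c j (beta * c j + e)%N) p.
Proof. by rewrite /err (cnt_split _ _ _ j) (vol_split _ _ _ j) mulr_sumr sumrB. Qed.

Let cnt_ge0 k c p : 0 <= cnt k c p.
Proof. by apply: sumr_ge0 => i _; apply: prodr_ge0. Qed.

Let zero : J -> R := fun=> 0.

Let cnt_le_zero k c p : cnt k c p <= cnt k c zero.
Proof.
apply: ler_sum => i _; apply: ler_prod => j _; rewrite memb_ge0/= /memb.
rewrite ler_wpM2l ?incr_lt_ind// /zero; have /andP[-> _] := x01 i j.
by rewrite ler_nat leq_b1.
Qed.

Let vol_le_zero k c p : (forall j, 0 <= p j) -> vol k c p <= vol k c zero.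
Proof.
move=> p0; apply: ler_prod => j _; rewrite len_ge0/= /len /incr /zero.
rewrite !(max_l (node_ge0 _ _)).
have := node_le (k j) (leqnSn (c j)).
case: (leP (node (k j) (c j).+1) (p j)); case: (leP (node (k j) (c j)) (p j)); lra.
Qed.

Let vol_zero k c : vol k c zero = (beta ^ (\sum_j k j))%N%:R^-1.
Proof.
rewrite /vol; have -> : (beta ^ (\sum_j k j))%N%:R^-1 = \prod_j ((beta ^ k j)%N%:R : R)^-1.
  by rewrite prodfV -natr_prod; congr (_%:R^-1); rewrite expn_sum.
apply: eq_bigr => j _; rewrite /len /incr /zero !(max_l (node_ge0 _ _)) /node.
by rewrite -mulrBl -natrB// subSnn mul1r.
Qed.

Let valid k c := forall j, (c j < beta ^ k j)%N.

Let valid_split k c j (e : 'I_beta) : valid k c ->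
  valid (set_at k j (k j).+1) (set_at c j (beta * c j + e)%N).
Proof.
move=> kc i; rewrite /set_at; case: eqP => // _.
rewrite expnS (@leq_trans (beta * (c j).+1))//.
  by rewrite mulnS addnC ltn_add2r.
by rewrite leq_pmul2l ?kc// ltnW.
Qed.

Let sum_set_at k j l : (\sum_i set_at k j l i + k j = \sum_i k i + l)%N.
Proof.
rewrite (bigD1 j)//= [in RHS](bigD1 j)//= {1}/set_at eqxx.
have -> : (\sum_(i | i != j) set_at k j l i = \sum_(i | i != j) k i)%N.
  by apply: eq_bigr => i /negbTE ij; rewrite /set_at ij.
by rewrite addnC (addnC l) addnA.
Qed.

Let sum_set_atS k j : (\sum_i set_at k j (k j).+1 i = (\sum_i k i).+1)%N.
Proof. have := sum_set_at k j (k j).+1; lia. Qed.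

(** The net property speaks of intervals of volume [beta ^ (t - m)]; a larger
    elementary interval is a disjoint union of those. *)
Let cnt_zero k c : valid k c -> (\sum_j k j <= m - t)%N ->
  cnt k c zero = (beta ^ (m - \sum_j k j))%N%:R.
Proof.
move=> kc; move: {2}(m - t - \sum_j k j)%N (erefl (m - t - \sum_j k j)%N) => g.
elim: g k c kc => [|g IH] k c kc gE kM.
  have sM : (\sum_j k j = m - t)%N by lia.
  have [_ /(_ k c kc sM) card] := netx.
  rewrite sM subKn// -card -sum1_card natr_sum big_mkcond/= /cnt.
  apply: eq_bigr => i _.
  have -> : \prod_j memb (x i j ord0) (zero j) (k j) (c j) =
      \prod_j (node (k j) (c j) <= x i j ord0 < node (k j) (c j).+1)%R%:R :> R.
    apply: eq_bigr => j _; rewrite /memb incr_lt_ind /zero.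
    by have /andP[-> _] := x01 i j; rewrite mulr1.
  rewrite -natr_prod.
  case: ifPn => [xin|xnin].
    have /set_mem h : x i \in elementary_interval R beta k c by [].
    by rewrite big1// => j _; rewrite /node (h j).
  have [j xj] : exists j, ~~ (node (k j) (c j) <= x i j ord0 < node (k j) (c j).+1).
    apply: contrapT => /forallNP h; move/negP: xnin; apply.
    by apply: (@mem_set _ (elementary_interval R beta k c)) => j; move: (h j) => /negP; rewrite negbK.
  by rewrite (bigD1 j)//= (negbTE xj) mul0n.
rewrite (cnt_split _ _ _ ord0).
rewrite (eq_bigr (fun=> (beta ^ (m - (\sum_j k j).+1))%N%:R)); last first.
  move=> e _; rewrite IH ?sum_set_atS//; first exact: valid_split.
  - by lia.
  - by lia.
rewrite sumr_const card_ord -mulrnA mulnC -expnS; congr (_ ^ _)%:R.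
lia.
Qed.

(** An elementary interval that is too small for the net property lies in one of
    volume [beta ^ (t - m)]. *)
Let cnt_small k c : valid k c -> (m - t <= \sum_j k j)%N ->
  cnt k c zero <= (beta ^ t)%N%:R.
Proof.
move=> kc; move: {2}(\sum_j k j - (m - t))%N (erefl (\sum_j k j - (m - t))%N) => g.
elim: g k c kc => [|g IH] k c kc gE kM.
  rewrite cnt_zero//; last lia.
  by rewrite ler_nat leq_pexp2l//; lia.
have [j kj] : exists j, (0 < k j)%N.
  apply: contrapT => /forallNP h.
  have : (\sum_j k j = 0)%N.
    by rewrite big1// => j _; move: (h j) => /negP; rewrite -eqn0Ngt => /eqP.
  lia.
pose k' := set_at k j (k j).-1; pose c' := set_at c j (c j %/ beta)%N.
have sk' : (\sum_i k' i = (\sum_i k i).-1)%N.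
  by have := sum_set_at k j (k j).-1; rewrite -/k'; lia.
have kc' : valid k' c'.
  move=> i; rewrite /k' /c' /set_at; case: eqP => // _.
  by rewrite ltn_divLR// -expnSr prednK.
apply: (le_trans _ (IH k' c' kc' _ _)); [|by rewrite sk'; lia|by rewrite sk'; lia].
rewrite (cnt_split k' c' _ j).
pose e := Ordinal (ltn_pmod (c j) (ltnW beta1)).
rewrite (bigD1 e)//=.
have -> : set_at k' j (k' j).+1 = k.
  apply/funext => i; rewrite /set_at /k' /set_at eqxx prednK//.
  by case: eqP => // ->.
have -> : set_at c' j (beta * c' j + c j %% beta)%N = c.
  apply/funext => i; rewrite /set_at /c' /set_at eqxx.
  by case: eqP => // ->; rewrite mulnC -divn_eq.
by rewrite lerDl; apply: sumr_ge0.
Qed.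

Let norm_sub_le (y z b : R) : 0 <= y <= b -> 0 <= z <= b -> `|y - z| <= b.
Proof. by move=> /andP[y0 yb] /andP[z0 zb]; rewrite ler_norml; apply/andP; split; lra. Qed.

Let err_small k c p : valid k c -> (forall j, 0 <= p j) ->
  (m - t <= \sum_j k j)%N -> `|err k c p| <= (beta ^ t)%N%:R.
Proof.
move=> kc p0 kM; apply: norm_sub_le.
  by rewrite cnt_ge0 (le_trans (cnt_le_zero k c p))// cnt_small.
rewrite mulr_ge0 ?prodr_ge0//=//.
rewrite (@le_trans _ _ ((beta ^ m)%N%:R * vol k c zero))//.
  by rewrite ler_wpM2l ?vol_le_zero// ltW.
rewrite vol_zero ler_pdivrMr// -natrM ler_nat -expnD leq_pexp2l//; lia.
Qed.

Let err_zero k c : valid k c -> `|err k c zero| <= (beta ^ t)%N%:R.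
Proof.
move=> kc; case: (leqP (m - t) (\sum_j k j)) => kM.
  by apply: err_small => // j; rewrite /zero.
rewrite /err cnt_zero//; last exact: ltnW.
rewrite vol_zero.
have -> : (beta ^ m = beta ^ (m - \sum_j k j) * beta ^ (\sum_j k j))%N.
  by rewrite -expnD; congr (_ ^ _)%N; lia.
rewrite natrM mulfK ?subrr ?normr0 //.
by rewrite gt_eqF.
Qed.

(** Cutting the box at one of its corners along the base-[beta] subdivision
    leaves fewer than [beta] pieces without that corner and one smaller piece
    that still has it.  After [m - t] refinements a piece lies in an elementary
    interval with [beta ^ t] points, so its error is trivially small. *)
Let err_bound r a k c p : valid k c -> (forall j, 0 <= p j) ->
  (#|[pred j | p j != 0%R]| <= a)%N -> (m - t <= \sum_j k j + r)%N ->
  `|err k c p| <= (beta ^ t)%N%:R * (1 + beta%:R * r%:R) ^+ a.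
Proof.
have ge1 r' a' : 1 <= (1 + beta%:R * r'%:R) ^+ a' :> R.
  by rewrite exprn_ege1// lerDl mulr_ge0.
have triv r' a' : (beta ^ t)%N%:R <= (beta ^ t)%N%:R * (1 + beta%:R * r'%:R) ^+ a' :> R.
  by rewrite ler_peMr ?ge1// ltW.
elim: r a k c p => [|r IH] a k c p kc p0 pa kM.
  apply: le_trans (triv _ _); apply: err_small => //; lia.
have [[j pj]|] := pselect (exists j, p j != 0); last first.
  move=> /forallNP h; have -> : p = zero.
    by apply/funext => j; apply/eqP; move: (h j) => /negP; rewrite negbK.
  exact: le_trans (err_zero kc) (triv _ _).
case: a pa => [|a] pa.
  by move: pa; rewrite leqn0 => /eqP/card0_eq/(_ j); rewrite !inE pj.
rewrite (err_split _ _ _ j).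
set k' := set_at k j (k j).+1; pose c' e := set_at c j (beta * c j + e)%N.
have sk' : (\sum_i k' i = (\sum_i k i).+1)%N by exact: sum_set_atS.
pose lo e := node (k j).+1 (beta * c j + e)%N.
have lo0 e : 0 <= lo e by exact: node_ge0.
pose p' i := if i == j then 0 else p i.
have B0 b : 0 <= (beta ^ t)%N%:R * (1 + beta%:R * r%:R) ^+ b :> R.
  by rewrite mulr_ge0 // (lt_le_trans ltr01).
pose Ba : R := (beta ^ t)%N%:R * (1 + beta%:R * r%:R) ^+ a.
pose BSa : R := (beta ^ t)%N%:R * (1 + beta%:R * r%:R) ^+ a.+1.
have kj : k' j = (k j).+1 by rewrite /k' /set_at eqxx.
have cj e : c' e j = (beta * c j + e)%N by rewrite /c' /set_at eqxx.
have step (e : 'I_beta) : `|err k' (c' e) p| <=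
    Ba + (lt_ind (p j) (lo e.+1) - lt_ind (p j) (lo e)) * BSa.
  have vc' : valid k' (c' e) by exact: valid_split.
  have le_lo : lo e <= lo e.+1 by apply: node_le; rewrite addnS.
  have chi0 : 0 <= lt_ind (p j) (lo e.+1) - lt_ind (p j) (lo e).
    rewrite subr_ge0 /lt_ind ler_nat; case: (ltP _ (lo e)) => // h.
    by rewrite (lt_le_trans h).
  have [plo|lop] := leP (p j) (lo e).
    have -> : err k' (c' e) p = err k' (c' e) p'.
      rewrite /err /cnt /vol; congr (_ - _ * _).
        apply: eq_bigr => i _; rewrite [in LHS](bigD1 j)//= [in RHS](bigD1 j)//=.
        congr (_ * _); last first.
          by apply: eq_bigr => i' /negbTE ij; rewrite /p' ij.
        rewrite /memb incr_lt_ind /p' eqxx kj cj.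
        have /andP[-> _] := x01 i j.
        case: (boolP (_ <= _ < _)); rewrite ?mul0r// => /andP[h _].
        by rewrite (le_trans plo h).
      rewrite [in LHS](bigD1 j)//= [in RHS](bigD1 j)//=; congr (_ * _); last first.
        by apply: eq_bigr => i' /negbTE ij; rewrite /p' ij.
      rewrite /len /incr /p' eqxx kj cj -addnS -/(lo e) -/(lo e.+1).
      by rewrite (max_l (le_trans plo le_lo)) (max_l plo) !(max_l (lo0 _)).
    rewrite (@le_trans _ _ Ba)//; last by rewrite lerDl mulr_ge0 ?B0.
    apply: IH => //; last by rewrite sk'; lia.
      by move=> i; rewrite /p'; case: eqP.
    rewrite -ltnS (leq_trans _ pa)// [X in (_ < X)%N](cardD1 j) !inE pj/= add1n ltnS.
    apply: subset_leq_card; apply/fintype.subsetP => i; rewrite !inE /p'.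
    by case: (i == j); rewrite ?eqxx.
  have [pge|plt] := leP (lo e.+1) (p j).
    have -> : err k' (c' e) p = 0.
      rewrite /err /cnt /vol [X in _ - _ * X](bigD1 j)//=.
      rewrite /len /incr kj cj -addnS -/(lo e) -/(lo e.+1).
      rewrite (max_r pge) (max_r (le_trans le_lo pge)) subrr mul0r mulr0 subr0.
      rewrite big1// => i _.
      rewrite (bigD1 j)//= /memb incr_lt_ind kj cj -addnS -/(lo e).
      rewrite -/(lo e.+1); case: (boolP (_ <= _ < _)) => [/andP[_ h]|]; last by rewrite !mul0r.
      by rewrite [p j <= _]leNgt (lt_le_trans h pge) mulr0 mul0r.
    by rewrite normr0 addr_ge0 ?B0// mulr_ge0 ?B0.
  rewrite {1}/lt_ind plt /lt_ind ltNge (ltW lop) subr0 mul1r.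
  rewrite (@le_trans _ _ BSa) ?lerDr ?B0//.
  by apply: IH => //; rewrite sk'; lia.
rewrite (le_trans (ler_norm_sum _ _ _))// (le_trans (ler_sum _ (fun e _ => step e)))//.
rewrite big_split/= sumr_const card_ord -mulr_suml.
rewrite -(big_mkord xpredT (fun e => lt_ind (p j) (lo e.+1) - lt_ind (p j) (lo e))).
rewrite (telescope_sumr (fun e => lt_ind (p j) (lo e)))//.
apply: (@le_trans _ _ (Ba *+ beta + BSa)).
  rewrite lerD2l ler_piMl ?B0// /lt_ind.
  by case: (_ < _); case: (_ < _); rewrite ?subr0 ?subrr ?sub0r//; lra.
have -> : Ba *+ beta = beta%:R * Ba by rewrite mulr_natl.
rewrite /Ba /BSa mulrCA -mulrDr ler_wpM2l//.
rewrite [leRHS]exprS [X in _ + X]exprS -mulrDl.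
have -> : beta%:R + (1 + beta%:R * r%:R) = 1 + beta%:R * r.+1%:R :> R.
  by rewrite -[in RHS]natr1; ring.
rewrite ler_wpM2l ?addr_ge0 ?mulr_ge0// lerXn2r ?nnegrE ?addr_ge0 ?mulr_ge0//.
by rewrite lerD2l ler_wpM2l// ler_nat.
Qed.

(** The whole cube is the elementary interval with all exponents 0, from which
    the subdivision starts. *)
Lemma net_box_error (us : nat -> 'cV[R]_s.+1) p : (forall i : 'I_(beta ^ m), us i = x i) ->
  unit_corner p ->
  `|box_error (beta ^ m) us p| <=
    (beta ^ t)%N%:R * (1 + beta%:R * m%:R) ^+ s.+1 / (beta ^ m)%N%:R.
Proof.
move=> ux p01.
pose k0 : J -> nat := fun=> 0%N.
have node0 e : node 0 e = e%:R by rewrite /node expn0 divr1.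
have E : box_error (beta ^ m) us p = (beta ^ m)%N%:R^-1 * err k0 k0 p.
  rewrite /box_error /err mulrBr mulKf ?gt_eqF//; congr (_ * _ - _).
    apply: eq_bigr => i _; rewrite ux.
    have -> : \prod_j memb (x i j ord0) (p j) (k0 j) (k0 j) =
        (\prod_j (p j <= x i j ord0)%R)%N%:R :> R.
      rewrite natr_prod; apply: eq_bigr => j _.
      by rewrite /memb incr_lt_ind !node0 x01 mul1r.
    congr (_%:R); rewrite /upper_box; case: forallP => [h|/existsNP[j /negP/negbTE hj]].
      by rewrite big1// => j _; rewrite h.
    by rewrite (bigD1 j)//= hj mul0n.
  apply: eq_bigr => j _; rewrite /len /incr !node0.
  by have /andP[p0 p1] := p01 j; rewrite (max_l p1) (max_r p0).
rewrite E normrM ger0_norm ?invr_ge0 // mulrC ler_wpM2r ?invr_ge0 //.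
have kc : valid k0 k0 by move=> j; rewrite expn0.
have p0 j : 0 <= p j by have /andP[] := p01 j.
have pa : (#|[pred j | p j != 0%R]| <= s.+1)%N.
  by rewrite -[leqRHS]card_ord max_card.
by apply: err_bound => //; lia.
Qed.

End net_discrepancy.

(** * Scrambling one coordinate *)

Section scramble_one_coordinate.
Context {R : realType}.
Variables (beta : nat) (hb : (1 < beta)%N).
Implicit Types (pi : seq 'I_beta -> {perm 'I_beta}) (x : R) (k n c : nat).

Let beta_gt0 : (0 < beta)%N.
Proof. exact: ltnW. Qed.

Let pow_gt0 k : 0 < (beta ^ k)%N%:R :> R.
Proof. by rewrite ltr0n expn_gt0 beta_gt0. Qed.

Let pow_neq0 k : (beta ^ k)%N%:R != 0 :> R.
Proof. by rewrite gt_eqF. Qed.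

Let powS k : (beta ^ k.+1)%N%:R = beta%:R * (beta ^ k)%N%:R :> R.
Proof. by rewrite expnS natrM. Qed.

Definition digits x k := [seq digit hb x l | l <- iota 0 k].

Definition scrambled_digit pi x k : 'I_beta := pi (digits x k) (digit hb x k).

(** Prefixes of expansions are kept as integers: those number the elementary
    intervals of each length. *)
Fixpoint scrambled_prefix pi x k : nat :=
  if k is k'.+1 then (beta * scrambled_prefix pi x k' + scrambled_digit pi x k')%N
  else 0%N.

Definition prefix_of x k : nat := Num.truncn (x * (beta ^ k)%N%:R).

Lemma digitsS x k : digits x k.+1 = rcons (digits x k) (digit hb x k).
Proof. by rewrite /digits -addn1 iotaD map_cat /= cats1. Qed.

Lemma prefix_ofS x k : 0 <= x ->
  prefix_of x k.+1 = (beta * prefix_of x k + digit hb x k)%N.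
Proof.
move=> x0; rewrite {2}/prefix_of.
suff -> : Num.truncn (x * (beta ^ k)%N%:R) = (prefix_of x k.+1 %/ beta)%N.
  by rewrite mulnC -divn_eq.
apply: truncn_def.
have y0 : 0 <= x * (beta ^ k.+1)%N%:R by rewrite mulr_ge0.
have /andP[h1 h2] := truncn_itv y0; rewrite -/(prefix_of x k.+1) in h1 h2.
have b0 : 0 < beta%:R :> R by rewrite ltr0n.
have E : x * (beta ^ k.+1)%N%:R = beta%:R * (x * (beta ^ k)%N%:R).
  by rewrite powS mulrCA.
rewrite E in h1 h2.
rewrite -(ler_pM2l b0) -(ltr_pM2l b0) -!natrM; apply/andP; split.
  by apply: le_trans h1; rewrite ler_nat mulnC leq_divM.
apply: lt_le_trans h2 _; rewrite ler_nat {1}(divn_eq (prefix_of x k.+1) beta).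
by rewrite mulnS mulnC addnC ltn_add2r ltn_mod.
Qed.

Lemma prefix_of0 x : 0 <= x < 1 -> prefix_of x 0 = 0%N.
Proof. by move=> x01; apply: truncn_def; rewrite expn0 mulr1. Qed.

Lemma prefix_ofP x k c : 0 <= x -> (prefix_of x k == c) =
  (c%:R / (beta ^ k)%N%:R <= x < c.+1%:R / (beta ^ k)%N%:R).
Proof.
move=> x0; rewrite truncn_eq ?mulr_ge0//.
by rewrite ler_pdivrMr// ltr_pdivlMr.
Qed.

Lemma scrambled_prefix_lt pi x k : (scrambled_prefix pi x k < beta ^ k)%N.
Proof.
elim: k => [|k IH] //=.
rewrite expnS (@leq_trans (beta * (scrambled_prefix pi x k).+1))//.
  by rewrite mulnS addnC ltn_add2r.
by rewrite leq_pmul2l.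
Qed.

(** Reading the scrambling tree backwards, a prefix of the scrambled digits
    determines the prefix of the original digits. *)
Lemma scrambled_prefix_inv pi k c : (c < beta ^ k)%N -> exists2 c',
  (c' < beta ^ k)%N & forall x, 0 <= x < 1 ->
    (scrambled_prefix pi x k == c) = (prefix_of x k == c').
Proof.
suff H : (c < beta ^ k)%N -> exists c' w, (c' < beta ^ k)%N /\
    forall x, 0 <= x < 1 ->
    (scrambled_prefix pi x k == c) = (prefix_of x k == c') /\
    (prefix_of x k = c' -> digits x k = w).
  by move=> /H[c' [w [c'k h]]]; exists c' => // x /h[].
elim: k c => [|k IH] c.
  rewrite expn0 ltnS leqn0 => /eqP->; exists 0%N, [::]; split=> // x x01.
  by rewrite prefix_of0.
move=> ck; have ck' : (c %/ beta < beta ^ k)%N by rewrite ltn_divLR// -expnSr.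
have [c' [w [c'k h]]] := IH _ ck'.
pose e := Ordinal (ltn_pmod c beta_gt0).
pose e' := ((pi w)^-1)%g e.
exists (beta * c' + e')%N, (rcons w e'); split.
  rewrite expnS (@leq_trans (beta * c'.+1))//.
    by rewrite mulnS addnC ltn_add2r.
  by rewrite leq_pmul2l.
have uniq_dm (q1 q2 : nat) (r1 r2 : 'I_beta) :
    (beta * q1 + r1 == beta * q2 + r2)%N = (q1 == q2) && (r1 == r2).
  apply/eqP/andP => [E|[/eqP-> /eqP->]//].
  have := congr1 (divn^~ beta) E; have := congr1 (modn^~ beta) E.
  rewrite /= !(mulnC beta) !modnMDl !modn_small//.
  rewrite !divnMDl// !divn_small// !addn0 => r12 ->.
  by split=> //; apply/eqP/val_inj.
move=> x x01; have [hx1 hx2] := h x x01.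
have x0 : 0 <= x by case/andP: x01.
have cE : (beta * (c %/ beta) + e = c)%N by rewrite mulnC -divn_eq.
have -> : scrambled_prefix pi x k.+1 =
  (beta * scrambled_prefix pi x k + scrambled_digit pi x k)%N by [].
rewrite prefix_ofS// -{1}cE !uniq_dm hx1.
case: eqP => [/hx2 wE|/eqP ne]; rewrite ?andTb ?andFb.
  rewrite /scrambled_digit wE digitsS wE -(can2_eq (permK (pi w)) (permKV (pi w))).
  split=> // /eqP; rewrite uniq_dm => /andP[_ /eqP ->//].
by split=> // /eqP; rewrite uniq_dm (negbTE ne).
Qed.

Let partial pi x n : R := (scrambled_prefix pi x n)%:R / (beta ^ n)%N%:R.

Let partialS pi x n : partial pi x n.+1 =
  partial pi x n + (scrambled_digit pi x n)%:R / (beta ^ n.+1)%N%:R.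
Proof.
rewrite /partial/= natrD natrM mulrDl powS invfM; congr (_ + _).
by rewrite mulrACA divff ?mul1r// pnatr_eq0 -lt0n.
Qed.

Let partialE pi x : series (fun k => (scrambled_digit pi x k)%:R
    / (beta ^ k.+1)%N%:R) = partial pi x.
Proof.
apply/funext => n; rewrite /series/=; elim: n => [|n IH].
  by rewrite big_nil /partial/= mul0r.
by rewrite big_nat_recr//= IH partialS.
Qed.

Let partial_nd pi x : nondecreasing_seq (partial pi x).
Proof. by apply/nondecreasing_seqP => n; rewrite partialS lerDl divr_ge0. Qed.

Let upper_ni pi x n : partial pi x n.+1 + (beta ^ n.+1)%N%:R^-1 <=
  partial pi x n + (beta ^ n)%N%:R^-1 ?= iff (scrambled_digit pi x n == beta.-1 :> nat).
Proof.
rewrite partialS -addrA.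
have -> : (scrambled_digit pi x n)%:R / (beta ^ n.+1)%N%:R + (beta ^ n.+1)%N%:R^-1
    = (scrambled_digit pi x n).+1%:R / (beta ^ n.+1)%N%:R :> R.
  by rewrite -natr1 mulrDl mul1r.
have -> : (beta ^ n)%N%:R^-1 = beta%:R / (beta ^ n.+1)%N%:R :> R.
  by rewrite powS invfM mulrA divff ?mul1r// pnatr_eq0 -lt0n.
have dlt := ltn_ord (scrambled_digit pi x n).
split; first by rewrite lerD2l ler_pM2r ?invr_gt0// ler_nat.
rewrite (inj_eq (addrI _)) (inj_eq (mulIf _)) ?invr_eq0// eqr_nat.
by rewrite -[RHS]eqSS prednK.
Qed.

Let upper_le pi x n l : (n <= l)%N -> partial pi x l + (beta ^ l)%N%:R^-1 <=
  partial pi x n + (beta ^ n)%N%:R^-1.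
Proof.
elim: l => [|l IH]; first by rewrite leqn0 => /eqP->.
rewrite leq_eqVlt => /predU1P[<-//|]; rewrite ltnS => /IH.
by apply: le_trans; exact: upper_ni.
Qed.

(** The partial sums increase, while the partial sums plus the length of the
    current interval decrease. *)
Lemma cvg_partial_scramble pi x : (fun n => (scrambled_prefix pi x n)%:R / (beta ^ n)%N%:R : R)
  @ \oo --> scramble hb pi x.
Proof.
rewrite /scramble -[X in limn (series X)]/(fun k => (scrambled_digit pi x k)%:R
  / (beta ^ k.+1)%N%:R) partialE.
apply: nondecreasing_is_cvgn; first exact: partial_nd.
exists (partial pi x 0 + (beta ^ 0)%N%:R^-1) => _ [n _ <-].
by apply: le_trans (upper_le pi x (leq0n n)); rewrite lerDl invr_ge0.
Qed.

Lemma scramble_ge pi x n :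
  (scrambled_prefix pi x n)%:R / (beta ^ n)%N%:R <= scramble hb pi x.
Proof.
have cv := @cvg_partial_scramble pi x; rewrite -(cvg_lim _ cv)//.
apply: nondecreasing_cvgn_le; first exact: partial_nd.
by apply/cvg_ex; exists (scramble hb pi x).
Qed.

Lemma scramble_le pi x n :
  scramble hb pi x <= (scrambled_prefix pi x n).+1%:R / (beta ^ n)%N%:R.
Proof.
have cv := @cvg_partial_scramble pi x; rewrite -(cvg_lim _ cv)//.
apply: limr_le; first by apply/cvg_ex; exists (scramble hb pi x).
exists n => // l /= nl; rewrite -natr1 mulrDl mul1r.
by apply: le_trans (upper_le pi x nl); rewrite lerDl invr_ge0.
Qed.

(** The upper bound is attained only when all later digits are [beta - 1]. *)
Lemma scramble_lt pi x n l : (n <= l)%N ->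
  scrambled_digit pi x l != beta.-1 :> nat ->
  scramble hb pi x < (scrambled_prefix pi x n).+1%:R / (beta ^ n)%N%:R.
Proof.
move=> nl dl.
apply: (le_lt_trans (scramble_le pi x l.+1)).
rewrite -natr1 mulrDl mul1r -/(partial pi x l.+1).
rewrite (@lt_le_trans _ _ (partial pi x l + (beta ^ l)%N%:R^-1))//.
  have := upper_ni pi x l; move/lt_leif => ->; exact: dl.
by rewrite -natr1 mulrDl mul1r; exact: upper_le.
Qed.

Lemma scramble_itv pi x : (forall n, exists2 l, (n <= l)%N &
    scrambled_digit pi x l != beta.-1 :> nat) ->
  0 <= scramble hb pi x < 1 /\
  forall n, prefix_of (scramble hb pi x) n = scrambled_prefix pi x n.
Proof.
move=> h; have lt1 n := scramble_ge pi x n.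
have u0 : 0 <= scramble hb pi x.
  by have := scramble_ge pi x 0; rewrite /= mul0r.
split.
  rewrite u0/=; have [l l0 dl] := h 0%N.
  by have := scramble_lt l0 dl; rewrite /= expn0 divr1.
move=> n; apply/eqP; rewrite prefix_ofP// scramble_ge/=.
by have [l nl dl] := h n; exact: scramble_lt nl dl.
Qed.

End scramble_one_coordinate.

(** * The law of a scrambled sequence *)

Section random_scrambling.
Context {R : realType} {dO} {Omega : measurableType dO}.
Variable P : probability Omega R.
Variables (beta : nat) (hb : (1 < beta)%N) (s : nat).
Variables (x : nat -> 'cV[R]_s) (u : nat -> Omega -> 'cV[R]_s).
Variable pi : 'I_s * seq 'I_beta -> Omega -> {perm 'I_beta}.
Hypothesis x01 : forall i j, 0 <= x i j ord0 < 1.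
Hypothesis pi_unif : forall (k : 'I_s * seq 'I_beta) (g : {perm 'I_beta}),
  measurable (pi k @^-1` [set g]) /\
  P (pi k @^-1` [set g]) = ((beta`!)%:R^-1)%:E.
Hypothesis pi_indep : mutually_independent P [set: set {perm 'I_beta}] pi.
Hypothesis uE : forall i w j,
  u i w j ord0 = scramble hb (fun l => pi (j, l) w) (x i j ord0).

Let beta_gt0 : (0 < beta)%N.
Proof. exact: ltnW. Qed.

Let betaR0 : 0 < beta%:R :> R.
Proof. by rewrite ltr0n. Qed.

Let value_set k (a e : 'I_beta) := [set w | pi k w a = e].

Let measurable_value k a e : measurable (value_set k a e).
Proof.
have -> : value_set k a e =
    \bigcup_(g in [set g : {perm 'I_beta} | g a = e]) pi k @^-1` [set g].
  apply/seteqP; split => w; first by move=> we; exists (pi k w).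
  by move=> [g /= ga wg]; rewrite /value_set/= wg.
apply: fin_bigcup_measurable => [|g _]; first exact: finite_finset.
by have [] := pi_unif k g.
Qed.

(** Composing with transpositions shows that the permutations sending [a] to
    [e] are as many for each [e]. *)
Let prob_value k a e : P (value_set k a e) = (beta%:R^-1)%:E.
Proof.
pose N e := \sum_(g : {perm 'I_beta}) (g a == e)%:R : R.
have Nsame e' : N e' = N e.
  rewrite /N (reindex_inj (mulIg (tperm e e'))); apply: eq_bigr => g _.
  by rewrite permM (can2_eq (tpermK _ _) (tpermK _ _)) tpermR.
have Ntot : beta%:R * N e = (beta`!)%:R.
  have -> : beta%:R * N e = \sum_(e' < beta) N e'.
    by under eq_bigr do rewrite Nsame; rewrite sumr_const card_ord mulr_natl.
  rewrite exchange_big/= (eq_bigr (fun=> 1)); last first.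
    move=> g _; rewrite (bigD1 (g a))//= eqxx big1 ?addr0// => e' e'g.
    by rewrite eq_sym (negbTE e'g).
  by rewrite sumr_const -cardsT/= -card_Sn cardsT.
have [_] := integral_indic_comb P (index_enum {perm 'I_beta})
  (fun g => (g a == e)%:R) (fun g => proj1 (pi_unif k g)).
have E w : \sum_(g : {perm 'I_beta}) (g a == e)%:R * \1_(pi k @^-1` [set g]) w =
    \1_(value_set k a e) w :> R.
  rewrite (bigD1 (pi k w))//= big1 ?addr0.
    rewrite !indicE mem_set// mulr1; congr (_%:R); congr nat_of_bool.
    by apply/eqP/idP => [h|/set_mem//]; exact/mem_set.
  move=> g gw; rewrite indicE memNset ?mulr0//= => wg.
  by rewrite wg eqxx in gw.
under eq_integral do rewrite E.
rewrite integral_indic// setIT => ->; congr EFin.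
under eq_bigr do rewrite (proj2 (pi_unif k _))/=.
rewrite -mulr_suml -/(N e) -Ntot invfM mulrCA divff ?mulr1//.
apply/eqP => N0; move: Ntot; rewrite N0 mulr0 => /eqP.
by rewrite eq_sym pnatr_eq0 eqn0Ngt fact_gt0.
Qed.

Let sdigit i j l w : 'I_beta :=
  scrambled_digit hb (fun l => pi (j, l) w) (x i j ord0) l.

Let prefix i j n w := scrambled_prefix hb (fun l => pi (j, l) w) (x i j ord0) n.

(** Successive digits use permutations with distinct indices, as the words
    indexing them have distinct lengths. *)
Let prob_digits i j a L (e : nat -> 'I_beta) :
  measurable [set w | forall l, (a <= l < a + L)%N -> sdigit i j l w = e l] /\
  P [set w | forall l, (a <= l < a + L)%N -> sdigit i j l w = e l] =
    (beta%:R^-1 ^+ L)%:E.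
Proof.
pose dg l := digit hb (x i j ord0) l.
pose key l := (j, digits hb (x i j ord0) l).
have size_key l : size (key l).2 = l by rewrite size_map size_iota.
pose keys := [seq key l | l <- iota a L].
have ukeys : uniq keys.
  rewrite map_inj_uniq ?iota_uniq// => l l' /(congr1 (fun k => size k.2)).
  by rewrite !size_key.
pose B (k : 'I_s * seq 'I_beta) := [set g : {perm 'I_beta} | g (dg (size k.2)) = e (size k.2)].
have -> : [set w | forall l, (a <= l < a + L)%N -> sdigit i j l w = e l] =
    \bigcap_(k in [set` keys]) (pi k @^-1` B k).
  apply/seteqP; split => w h.
    move=> k /= /mapP[l]; rewrite mem_iota => al ->.
    by rewrite /B/= size_key; exact: h.
  move=> l al; have := h (key l); rewrite /B/= size_key; apply.
  by apply/mapP; exists l; rewrite ?mem_iota.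
split.
  apply: fin_bigcap_measurable => [|k _]; first exact: finite_seq.
  exact: measurable_value.
have := pi_indep (B := B) ukeys (fun=> Logic.I).
move=> ->; rewrite /keys big_map.
under eq_bigr do rewrite [P _]prob_value.
rewrite prodEFin; congr EFin.
by rewrite big_const_seq count_predT size_iota iter_mulr_1.
Qed.

Let prefix_digits K c : (c < beta ^ K)%N -> exists e : nat -> 'I_beta,
  forall i j w, prefix i j K w = c <->
    forall l, (0 <= l < 0 + K)%N -> sdigit i j l w = e l.
Proof.
elim: K c => [|K IH] c.
  rewrite expn0 ltnS leqn0 => /eqP->.
  by exists (fun=> Ordinal beta_gt0) => i j w; split.
move=> cK; have /IH[e he] : (c %/ beta < beta ^ K)%N by rewrite ltn_divLR// -expnSr.
pose e0 := Ordinal (ltn_pmod c beta_gt0).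
exists (fun l => if l == K then e0 else e l) => i j w.
have -> : prefix i j K.+1 w = (beta * prefix i j K w + sdigit i j K w)%N by [].
split.
  move=> cE; have dlt := ltn_ord (sdigit i j K w).
  have pE : prefix i j K w = (c %/ beta)%N.
    by rewrite -cE mulnC divnMDl// divn_small// addn0.
  move=> l /andP[_]; rewrite add0n ltnS leq_eqVlt; case: eqP => [-> _|_ /= lK].
    by apply/val_inj; rewrite /= -cE mulnC modnMDl modn_small.
  by have /he := pE; apply.
move=> h; have -> : sdigit i j K w = e0.
  by have := h K; rewrite eqxx; apply; rewrite add0n ltnSn.
have -> : prefix i j K w = (c %/ beta)%N.
  apply/he => l /andP[_ lK]; have := h l; rewrite (ltn_eqF lK); apply.
  by rewrite leq0n/= ltnS; exact: ltnW.
by rewrite mulnC -divn_eq.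
Qed.

Let prob_prefix i j K c : (c < beta ^ K)%N ->
  measurable [set w | prefix i j K w = c] /\
  P [set w | prefix i j K w = c] = (beta%:R^-1 ^+ K)%:E.
Proof.
move=> /prefix_digits[e he].
have -> : [set w | prefix i j K w = c] =
    [set w | forall l, (0 <= l < 0 + K)%N -> sdigit i j l w = e l].
  by apply/seteqP; split => w /=; rewrite he.
exact: prob_digits.
Qed.

(** A run of [L] digits [beta - 1] has probability [beta ^- L]. *)
Let ae_not_last i j n : {ae P, forall w, exists2 l, (n <= l)%N &
  sdigit i j l w != beta.-1 :> nat}.
Proof.
have bl : (beta.-1 < beta)%N by rewrite prednK.
pose A L := [set w | forall l, (n <= l < n + L)%N -> sdigit i j l w = Ordinal bl].
have mA L : measurable (A L) by have [] := prob_digits i j n L (fun=> Ordinal bl).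
have PA L : P (A L) = (beta%:R^-1 ^+ L)%:E.
  by have [] := prob_digits i j n L (fun=> Ordinal bl).
exists (\bigcap_L A L); split.
- exact: bigcapT_measurable.
- apply/eqP; rewrite eq_le measure_ge0 andbT; apply/lee_addgt0Pr => e e0; rewrite add0e.
  have : (fun L => (beta%:R^-1 : R) ^+ L) @ \oo --> (0 : R).
    apply: cvg_expr; rewrite ger0_norm ?invr_ge0//.
    by rewrite invf_lt1// ltr1n.
  move=> /cvgr0Pnorm_lt/(_ _ e0)[L _ /(_ L (leqnn L))] hL.
  apply: (@le_trans _ _ (P (A L))).
    by apply: le_measure; rewrite ?inE//; [exact: bigcapT_measurable|move=> w; exact].
  by rewrite PA lee_fin (le_trans (ler_norm _))// ltW.
- move=> w /= hw L _ l /andP[nl _]; apply/val_inj => /=.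
  apply: contrapT => /eqP dl; apply: hw; exists l => //; exact/eqP.
Qed.

(** Outside a null set no scrambled expansion ends in a run of [beta - 1], and so
    the scrambled digits are the digits of the scrambled point. *)
Lemma ae_scramble_itv : {ae P, forall w, forall i j,
  0 <= u i w j ord0 < 1 /\ forall n, prefix_of beta (u i w j ord0) n =
    scrambled_prefix hb (fun l => pi (j, l) w) (x i j ord0) n}.
Proof.
have : {ae P, forall w, forall i, forall j, forall n, exists2 l, (n <= l)%N &
    sdigit i j l w != beta.-1 :> nat}.
  apply: ae_foralln => i; apply: filter_forall => j; apply: ae_foralln => n.
  exact: ae_not_last.
apply: filterS => w h i j; rewrite uE; apply: scramble_itv => n; exact: h.
Qed.

Let measurable_prefix i j n : measurable_fun setT (fun w => (prefix i j n w)%:R : R).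
Proof.
have msd l : measurable_fun setT (fun w => (sdigit i j l w)%:R : R).
  rewrite (_ : (fun w => _) = (fun w => \sum_(e < beta) (e : nat)%:R *
    \1_(value_set (j, digits hb (x i j ord0) l) (digit hb (x i j ord0) l) e) w)).
    by apply: measurable_sum => e; apply: measurable_funM.
  apply/funext => w; rewrite (bigD1 (sdigit i j l w))//= big1 ?addr0.
    by rewrite indicE mem_set// mulr1.
  by move=> e ew; rewrite indicE memNset ?mulr0//= => /esym/eqP; rewrite (negbTE ew).
elim: n => [|n IH]; first exact: measurable_cst.
rewrite (_ : (fun w => _) = (fun w => beta%:R * (prefix i j n w)%:R
    + (sdigit i j n w)%:R)).
  by apply: measurable_funD => //; apply: measurable_funM.
by apply/funext => w; rewrite -natrM -natrD.
Qed.

Lemma measurable_scrambled i j : measurable_fun setT (fun w => u i w j ord0).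
Proof.
under eq_fun do rewrite uE.
apply: (measurable_fun_cvg (h := fun n w => (prefix i j n w)%:R / (beta ^ n)%N%:R)).
  by move=> n; apply: measurable_funM.
by move=> w _; exact: cvg_partial_scramble.
Qed.

(** Take [K] with [1 <= y * beta ^ K < beta]: a point within [y] of a face lies
    in one of the [beta] intervals of length [beta ^- K] next to it, each of
    probability [beta ^- K <= y]. *)
Lemma scrambled_tails i : boundary_tails P (u i) beta%:R.
Proof.
move=> j.
have mu := measurable_scrambled i j.
have scale (y : R) : 0 < y < 1 -> exists K, 1 <= y * (beta ^ K)%N%:R < beta%:R.
  move=> /andP[y0 y1].
  have ex : exists K, 1 <= y * (beta ^ K)%N%:R.
    have : (fun L => (beta%:R^-1 : R) ^+ L) @ \oo --> (0 : R).
      by apply: cvg_expr; rewrite ger0_norm ?invr_ge0// invf_lt1// ltr1n.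
    move=> /cvgr0Pnorm_lt/(_ _ y0)[K _ /(_ K (leqnn K))] hK; exists K.
    move: hK; rewrite ger0_norm ?exprn_ge0 ?invr_ge0// exprVn => /ltW hK.
    by rewrite -ler_pdivrMr ?ltr0n ?expn_gt0 ?beta_gt0// mul1r natrX.
  exists (ex_minn ex); case: ex_minnP => -[|K] yK Kmin.
    by move: yK; rewrite expn0 mulr1 leNgt y1.
  rewrite yK/= expnS natrM mulrCA -[X in _ < X]mulr1 ltr_pM2l// ltNge.
  by apply/negP => /Kmin; rewrite ltnn.
have few (K : nat) (f : nat -> nat) (E : set Omega) (y : R) : measurable E ->
    1 <= y * (beta ^ K)%N%:R ->
    (forall w, E w -> exists2 r, (r < beta)%N & prefix i j K w = f r) ->
    (forall r, (r < beta)%N -> (f r < beta ^ K)%N) ->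
    (P E <= (beta%:R * y)%:E)%E.
  move=> mE yK hE hf.
  pose A r := if (r < beta)%N then [set w | prefix i j K w = f r] else set0.
  have mA r : measurable (A r).
    by rewrite /A; case: ifP => // /hf/(prob_prefix i j)[].
  apply: (@le_trans _ _ (P (\big[setU/set0]_(r < beta) A r))).
    apply: le_measure; rewrite ?inE//; first exact: bigsetU_measurable.
    move=> w /hE[r rb wr]; rewrite -bigcup_mkord; exists r => //=.
    by rewrite /A rb.
  apply: (le_trans (Boole_inequality _ _)) => //.
  rewrite (eq_bigr (fun=> (beta%:R^-1 ^+ K)%:E)); last first.
    by move=> r _; rewrite /A ltn_ord; exact: (proj2 (prob_prefix i j (hf _ (ltn_ord r)))).
  rewrite sumEFin lee_fin sumr_const card_ord -[leLHS]mulr_natl ler_wpM2l//.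
  by rewrite exprVn -natrX -[leLHS]mul1r ler_pdivrMr// ltr0n expn_gt0 beta_gt0.
have large (E : set Omega) (y : R) : measurable E -> 1 <= y -> (P E <= (beta%:R * y)%:E)%E.
  move=> mE y1; rewrite (le_trans (probability_le1 P mE))// lee_fin.
  have : 1 <= beta%:R :> R by rewrite ler1n.
  by nra.
have cst_le (y : R) : measurable [set w | u i w j ord0 <= y].
  rewrite -[X in measurable X]setTI.
  exact: (@measurable_fun_le _ _ _ setT _ (cst y)).
have cst_le' (y : R) : measurable [set w | 1 - u i w j ord0 <= y].
  rewrite -[X in measurable X]setTI.
  apply: (@measurable_fun_le _ _ _ setT _ (cst y)) => //.
  exact: measurable_funB.
split=> // y y0.
- have [y1|y1] := leP 1 y; first exact: large.
  have [K /andP[yK Ky]] := scale y ltac:(by rewrite y0 y1).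
  have bK : 0 < (beta ^ K)%N%:R :> R by rewrite ltr0n expn_gt0 beta_gt0.
  have K0 : (beta <= beta ^ K)%N.
    case: K yK Ky bK => [|K] yK Ky bK; last by rewrite expnS leq_pmulr// expn_gt0 beta_gt0.
    by move: yK; rewrite expn0 mulr1 leNgt y1.
  apply: (few K id) => // [w uy|r rb]; last exact: leq_trans rb K0.
  exists (prefix i j K w) => //; rewrite -(ltr_nat R).
  apply: le_lt_trans Ky; rewrite -ler_pdivrMr//; apply: le_trans uy.
  by rewrite uE; exact: scramble_ge.
- have [y1|y1] := leP 1 y; first exact: large.
  have [K /andP[yK Ky]] := scale y ltac:(by rewrite y0 y1).
  have bK : 0 < (beta ^ K)%N%:R :> R by rewrite ltr0n expn_gt0 beta_gt0.
  apply: (few K (fun r => beta ^ K - r.+1)%N) => // [w uy|r rb]; last first.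
    by rewrite ltn_subrL expn_gt0 beta_gt0.
  have pK := scrambled_prefix_lt hb (fun l => pi (j, l) w) (x i j ord0) K.
  rewrite -/(prefix i j K w) in pK.
  exists (beta ^ K - (prefix i j K w).+1)%N; last by rewrite subnS; lia.
  rewrite -(ltr_nat R) natrB//; apply: le_lt_trans Ky.
  rewrite lerBlDr -lerBlDl -[X in X - _]mul1r -mulrBl -ler_pdivlMr//.
  have := scramble_le hb (fun l => pi (j, l) w) (x i j ord0) K.
  rewrite -uE; apply: le_trans; move: uy => /=; lra.
Qed.

End random_scrambling.

(** * Box errors of scrambled sequences *)

Section scrambled_nets.
Context {R : realType} {dO} {Omega : measurableType dO}.
Variable P : probability Omega R.
Variables (beta : nat) (hb : (1 < beta)%N) (s : nat).

Lemma unit_volume (p : 'I_s -> R) : unit_corner p -> 0 <= volume p <= 1.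
Proof.
move=> p01; have h j : 0 <= 1 - p j <= 1.
  by have /andP[p0 p1] := p01 j; rewrite subr_ge0 p1 gerBl.
apply/andP; split; first by apply: prodr_ge0 => j _; have /andP[] := h j.
by apply: prodr_ile1 => j _; exact: h.
Qed.

Lemma box_error_le1 n (us : nat -> 'cV[R]_s) p : (0 < n)%N -> unit_corner p ->
  `|box_error n us p| <= 1.
Proof.
move=> n0 p01; have /andP[v0 v1] := unit_volume p01.
have n0R : 0 < n%:R :> R by rewrite ltr0n.
set S := \sum_(i < n) (upper_box p (us i))%:R : R.
have S0 : 0 <= S by apply: sumr_ge0.
have Sn : S <= n%:R.
  rewrite -[X in _ <= X%:R](card_ord n) -sumr_const; apply: ler_sum => i _.
  by rewrite lern1 leq_b1.
have nS0 : 0 <= n%:R^-1 * S by rewrite mulr_ge0 ?invr_ge0 ?(ltW n0R).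
have nS1 : n%:R^-1 * S <= 1 by rewrite mulrC ler_pdivrMr// mul1r.
by rewrite /box_error -/S ler_norml; apply/andP; split; lra.
Qed.

Lemma measurable_box_error n (u : nat -> Omega -> 'cV[R]_s) p :
  (forall i j, measurable_fun setT (fun w => u i w j ord0)) ->
  measurable_fun setT (fun w => box_error n (u ^~ w) p).
Proof.
move=> mu; apply: measurable_funB => //; apply: measurable_funM => //.
apply: measurable_sum => i.
rewrite (_ : (fun w => _) = \1_[set w | upper_box p (u i w)]).
  by apply: measurable_indic; exact: measurable_upper_box.
apply/funext => w; rewrite indicE; congr (_%:R); congr nat_of_bool.
by apply/idP/idP => [h|/set_mem//]; exact/mem_set.
Qed.

Lemma elementary_interval_prefix (k c : 'I_s -> nat) (y : 'cV[R]_s) :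
  (forall j, 0 <= y j ord0) ->
  (y \in elementary_interval R beta k c) =
  [forall j, prefix_of beta (y j ord0) (k j) == c j].
Proof.
move=> y0; apply/idP/forallP => [/set_mem h j|h].
  by rewrite prefix_ofP// h.
by apply: (@mem_set _ (elementary_interval R beta k c)) => j; rewrite -prefix_ofP// h.
Qed.

(** Scrambling permutes the elementary intervals of each shape, so it preserves
    the net property of the blocks. *)
Lemma scrambled_net (x y : nat -> 'cV[R]_s)
    (pi : 'I_s * seq 'I_beta -> {perm 'I_beta}) (t m : nat) :
  is_ts_sequence beta t x -> (t <= m)%N ->
  (forall i j, 0 <= y i j ord0 < 1 /\ forall n, prefix_of beta (y i j ord0) n =
    scrambled_prefix hb (fun l => pi (j, l)) (x i j ord0) n) ->
  is_net t (fun r : 'I_(beta ^ m) => y r).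
Proof.
move=> [x01 netx] tm hy; have [_ cardx] := netx 0%N m tm; split=> // k c kc kM.
have /choice[c' hc'] : forall j, exists c', (c' < beta ^ k j)%N /\
    forall z : R, 0 <= z < 1 ->
      (scrambled_prefix hb (fun l => pi (j, l)) z (k j) == c j) =
      (prefix_of beta z (k j) == c').
  by move=> j; have [c' ? ?] := scrambled_prefix_inv (R := R) hb (fun l => pi (j, l)) (kc j);
    exists c'.
rewrite -(cardx k c' (fun j => proj1 (hc' j)) kM); apply: eq_card => r.
rewrite !inE !elementary_interval_prefix; last 2 first.
- by move=> j; have /andP[] := x01 (0 * beta ^ m + r)%N j.
- by move=> j; have [/andP[]] := hy r j.
apply: eq_forallb => j; have [_ ->] := hy r j.
by have [_ ->] := hc' j; rewrite ?mul0n.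
Qed.

End scrambled_nets.

Lemma scrambled_box_error (R : realType) dO (Omega : measurableType dO)
    (P : probability Omega R) (beta : nat) (hb : (1 < beta)%N) (s t : nat)
    (u : nat -> Omega -> 'cV[R]_s) : (0 < s)%N -> scrambled_ts_sequence P hb t u ->
  (forall i, boundary_tails P (u i) beta%:R) /\
  forall m p, unit_corner p -> mean_le P (fun w => `|box_error (beta ^ m) (u ^~ w) p|)
    ((beta ^ t)%N%:R * (1 + beta%:R * m%:R) ^+ s / (beta ^ m)%N%:R).
Proof.
case: s u => // s u _ [x [pi [tsx pi_unif pi_indep uE]]]; have [x01 _] := tsx.
split; first exact: scrambled_tails pi_unif pi_indep uE.
move=> m p p01; set kappa := _ / _.
have b0 k : 0 < (beta ^ k)%N%:R :> R by rewrite ltr0n expn_gt0 ltnW.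
have ge1 : 1 <= (1 + beta%:R * m%:R) ^+ s.+1 :> R.
  by rewrite exprn_ege1// lerDl mulr_ge0.
have kappa0 : 0 <= kappa.
  by rewrite divr_ge0// mulr_ge0// (le_trans ler01).
split.
- apply: measurableT_comp => //; apply: measurable_box_error => i j.
  exact: (measurable_scrambled pi_unif uE).
- by move=> w; exact: normr_ge0.
have [_ _ kle] := mean_le_cst P kappa0; apply: le_trans kle.
apply: ae_le_integral_measurable_r => //.
apply: filterS (ae_scramble_itv pi_unif pi_indep uE) => w hw; rewrite lee_fin.
have [tm|mt] := leqP t m.
  apply: (net_box_error hb tm (x := fun r : 'I_(beta ^ m) => u r w)) => //.
    by move=> i j; have [] := hw i j.
  exact: (scrambled_net (pi := pi^~ w) tsx tm hw).
apply: le_trans (box_error_le1 _ _ p01) _; first by rewrite expn_gt0 ltnW.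
rewrite /kappa ler_pdivlMr// mul1r.
rewrite (@le_trans _ _ (beta ^ t)%N%:R)//.
  by rewrite ler_nat leq_pexp2l ?(ltnW mt)// ltnW.
by rewrite ler_peMr.
Qed.

(** * Tameness of the Kolmogorov model and of the networks *)

Section quantile_coordinates.
Context {R : realType} {d D : nat}.
Implicit Types (K u x y : R) (j : 'I_(d + D)).

(** Chernoff's bound at rate [2 * K] says that the square of the exponential is
    at most a constant over the mass beyond the quantile. *)
Lemma normal_quantile_moment K u : 0 <= K -> 0 < u < 1 ->
  expR (K * `|normal_quantile u|) <=
  expR (K ^+ 2) * (inv_sqrt u + inv_sqrt (1 - u)).
Proof.
move=> K0 u01; have qu := normal_quantileK u01; move: u01 => /andP[u0 u1].
set z := normal_quantile u in qu *.
have K20 : 0 <= 2 * K by rewrite mulr_ge0.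
have [hi lo] := ncdf_tail `|z| K20.
have side x : 0 < x -> x <= expR ((2 * K) ^+ 2 / 2) * expR (- (2 * K * `|z|)) ->
    expR (K * `|z|) <= expR (K ^+ 2) * inv_sqrt x.
  move=> x0 hx; rewrite -ler_pdivrMl ?expR_gt0// -expRN -expRD.
  apply: le_inv_sqrt => //; rewrite ?expR_ge0//.
  rewrite -expRM_natl -ler_pdivlMl ?expR_gt0// mulr1 -expRN (le_trans hx)//.
  rewrite -expRD ler_expR le_eqVlt; apply/orP; left; apply/eqP.
  by field.
have i0 := inv_sqrt_ge0 u; have i1 := inv_sqrt_ge0 (1 - u).
have [z0|z0] := leP 0 z.
  rewrite (le_trans (side (1 - u) _ _)) ?subr_gt0//.
    by rewrite -qu; move: hi; rewrite (ger0_norm z0).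
  by rewrite ler_wpM2l ?expR_ge0// lerDr.
rewrite (le_trans (side u _ _))//.
  by move: lo; rewrite (ltr0_norm z0) opprK qu.
by rewrite ler_wpM2l ?expR_ge0// lerDl.
Qed.

(** The coordinates in which the learning problem is tame: the first [d] are
    those of the cube, the others are the Gaussian increments, up to scaling. *)
Definition quantile_coordinate j : R -> R :=
  if fintype.split j is inl _ then id else @normal_quantile R.

Definition quantile_threshold j : R -> R :=
  if fintype.split j is inl _ then id else ncdf.

Lemma le_quantile_coordinate j u y : 0 < u < 1 ->
  (y <= quantile_coordinate j u) = (quantile_threshold j y <= u).
Proof.
rewrite /quantile_coordinate /quantile_threshold.
by case: (fintype.split j) => // _; exact: le_normal_quantile.
Qed.

Lemma quantile_coordinate_moment K : 0 <= K -> exists C, 0 <= C /\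
  forall j u, 0 < u < 1 ->
    expR (K * `|quantile_coordinate j u|) <= C * (inv_sqrt u + inv_sqrt (1 - u)).
Proof.
move=> K0; exists (expR (K ^+ 2) + expR K); split; first by rewrite addr_ge0 ?expR_ge0.
move=> j u u01; have i0 := inv_sqrt_ge0 u; have i1 := inv_sqrt_ge0 (1 - u).
rewrite mulrDl /quantile_coordinate; case: (fintype.split j) => _.
  have /andP[u0 u1] := u01.
  rewrite (@le_trans _ _ (expR K * 1))//.
    by rewrite mulr1 ler_expR ler_piMr// ger0_norm ltW.
  have iu : 1 <= inv_sqrt u by apply: le_inv_sqrt; rewrite // expr1n mul1r ltW.
  rewrite -[leLHS]add0r lerD ?mulr_ge0 ?addr_ge0 ?expR_ge0//.
  by rewrite ler_wpM2l ?expR_ge0//; lra.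
rewrite (le_trans (normal_quantile_moment K0 u01))// lerDl.
by rewrite mulr_ge0 ?addr_ge0 ?expR_ge0.
Qed.

Lemma coordinates_lshift (u : 'cV[R]_(d + D)) (j : 'I_d) :
  coordinates quantile_coordinate u (lshift D j) = u (lshift D j) ord0.
Proof. by rewrite /coordinates /quantile_coordinate -[lshift D j]/(unsplit (inl j)) unsplitK. Qed.

Lemma coordinates_rshift (u : 'cV[R]_(d + D)) (j : 'I_D) :
  coordinates quantile_coordinate u (rshift d j) = normal_quantile (u (rshift d j) ord0).
Proof. by rewrite /coordinates /quantile_coordinate -[rshift d j]/(unsplit (inr j)) unsplitK. Qed.

End quantile_coordinates.

Section tame_models.
Context {R : realType} {s d : nat} {Theta : Type}.
Variable phi : 'cV[R]_d -> R.
Variable tau : 'I_s -> R -> R.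
Implicit Types g : Theta -> 'cV[R]_s -> R.

(** Tameness after the change of coordinates, in the form in which networks and
    payoffs are given: as functions of a point of the unit cube. *)
Definition tame_in_coordinates g :=
  exists G, tame phi G /\ forall th u, g th u = G th (coordinates tau u).

Definition tame_vector n (v : Theta -> 'cV[R]_s -> 'cV[R]_n) :=
  forall i, tame_in_coordinates (fun th u => v th u i ord0).

Lemma tame_in_ext g g' : tame_in_coordinates g -> (forall th u, g' th u = g th u) ->
  tame_in_coordinates g'.
Proof. by move=> [G [tG gG]] E; exists G; split=> // th u; rewrite E gG. Qed.

Lemma tame_in_param (w : Theta -> R) B : (forall th, `|w th| <= B) ->
  tame_in_coordinates (fun th _ => w th).
Proof. by move=> wB; exists (fun th _ => w th); split=> //; apply: tame_param; exists B. Qed.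

Lemma tame_in_cst c : tame_in_coordinates (fun _ _ => c).
Proof. exact: (tame_in_param (w := fun=> c) (fun _ => lexx _)). Qed.

Lemma tame_in_coord j : tame_in_coordinates (fun _ u => coordinates tau u j).
Proof. by exists (fun _ z => z j); split=> //; exact: tame_coord. Qed.

Lemma tame_in_add g1 g2 : tame_in_coordinates g1 -> tame_in_coordinates g2 ->
  tame_in_coordinates (fun th u => g1 th u + g2 th u).
Proof.
move=> [G1 [t1 h1]] [G2 [t2 h2]]; exists (fun th z => G1 th z + G2 th z).
by split=> [|th u]; [exact: tame_add|rewrite h1 h2].
Qed.

Lemma tame_in_mul g1 g2 : tame_in_coordinates g1 -> tame_in_coordinates g2 ->
  tame_in_coordinates (fun th u => g1 th u * g2 th u).
Proof.
move=> [G1 [t1 h1]] [G2 [t2 h2]]; exists (fun th z => G1 th z * G2 th z).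
by split=> [|th u]; [exact: tame_mul|rewrite h1 h2].
Qed.

Lemma tame_in_sum n (g : 'I_n -> Theta -> 'cV[R]_s -> R) :
  (forall i, tame_in_coordinates (g i)) ->
  tame_in_coordinates (fun th u => \sum_i g i th u).
Proof.
move=> /choice[G hG]; exists (fun th z => \sum_i G i th z); split=> [|th u].
  by apply: tame_sum => i; have [] := hG i.
by apply: eq_bigr => i _; have [_ ->] := hG i.
Qed.

Lemma tame_in_swish g : tame_in_coordinates g ->
  tame_in_coordinates (fun th u => swish (g th u)).
Proof.
move=> tg; have [G [tG gG]] := tg; apply: tame_in_mul tg _.
exists (fun th z => sigmoid (G th z)); split=> [|th u]; first exact: tame_sigmoid.
by rewrite -gG.
Qed.

Lemma tame_in_phi v : tame_vector v -> tame_in_coordinates (fun th u => phi (v th u)).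
Proof.
move=> /choice[S hS].
exists (fun th z => iter_partial phi [::] (\col_i S i th z)); split=> [|th u].
  by apply: tame_phi => i; have [] := hS i.
congr phi; apply/colP => i; rewrite mxE.
by have [_ ->] := hS i.
Qed.

Lemma tame_vector_add n (v1 v2 : Theta -> 'cV[R]_s -> 'cV[R]_n) :
  tame_vector v1 -> tame_vector v2 -> tame_vector (fun th u => v1 th u + v2 th u).
Proof.
move=> h1 h2 i; apply: tame_in_ext (tame_in_add (h1 i) (h2 i)) _ => th u.
by rewrite mxE.
Qed.

Lemma tame_vector_scale n c (v : Theta -> 'cV[R]_s -> 'cV[R]_n) :
  tame_vector v -> tame_vector (fun th u => c *: v th u).
Proof.
move=> h i; apply: tame_in_ext (tame_in_mul (tame_in_cst c) (h i)) _ => th u.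
by rewrite mxE.
Qed.

Lemma tame_vector_cst n (c : 'cV[R]_n) : tame_vector (fun _ _ => c).
Proof. by move=> i; exact: tame_in_cst. Qed.

Lemma tame_vector_mulmx m n (A : Theta -> 'cV[R]_s -> 'M[R]_(m, n))
    (v : Theta -> 'cV[R]_s -> 'cV[R]_n) :
  (forall i j, tame_in_coordinates (fun th u => A th u i j)) -> tame_vector v ->
  tame_vector (fun th u => A th u *m v th u).
Proof.
move=> hA hv i.
apply: tame_in_ext (tame_in_sum (fun j => tame_in_mul (hA i j) (hv j))) _ => th u.
by rewrite mxE.
Qed.

Lemma tame_in_affine n p q (f : 'cV[R]_n -> 'M[R]_(p, q))
    (v : Theta -> 'cV[R]_s -> 'cV[R]_n) i j :
  affine_map f -> tame_vector v -> tame_in_coordinates (fun th u => f (v th u) i j).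
Proof.
move=> [g [c fE]] hv.
have := tame_in_add (tame_in_sum (fun k =>
  tame_in_mul (hv k) (tame_in_cst (g (delta_mx k ord0) i j)))) (tame_in_cst (c i j)).
move=> /tame_in_ext; apply => th u; rewrite fE mxE; congr (_ + _).
rewrite {1}[v th u]matrix_sum_delta linear_sum summxE; apply: eq_bigr => k _.
by rewrite big_ord_recl big_ord0 addr0 linearZ mxE.
Qed.

(** The weights of the network only enter as bounded parameters. *)
Lemma tame_in_network r n h (th0 : Theta -> params R n h)
    (v : Theta -> 'cV[R]_s -> 'cV[R]_n) :
  0 <= r -> (forall th, params_bounded r (th0 th)) -> tame_vector v ->
  tame_in_coordinates (fun th u => network (th0 th) (v th u)).
Proof.
move=> r0; elim: h n th0 v => [|m h IH] n th0 v /= bth tv.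
  have tl : tame_vector (fun th u => (th0 th).1 *m v th u + (th0 th).2).
    apply: tame_vector_add => [|i].
      apply: tame_vector_mulmx => // i j; apply: (@tame_in_param _ r) => th.
      by have [/(le_mx_norm _ r0)] := bth th.
    by apply: (@tame_in_param _ r) => th; have [_ /(le_mx_norm _ r0)] := bth th.
  exact: tl.
apply: (IH m (fun th => (th0 th).2)) => [th|i]; first by have [] := bth th.
have tl : tame_vector (fun th u => (th0 th).1.1 *m v th u + (th0 th).1.2).
  apply: tame_vector_add => [|k].
    apply: tame_vector_mulmx => // k j; apply: (@tame_in_param _ r) => th.
    by have [/(le_mx_norm _ r0)] := bth th.
  by apply: (@tame_in_param _ r) => th; have [_ /(le_mx_norm _ r0)] := bth th.
apply: tame_in_ext (tame_in_swish (tl i)) _ => th u.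
by rewrite mxE.
Qed.

End tame_models.

Section kolmogorov.
Context {R : realType} {d : nat} {Theta : Type}.
Variables (phi : 'cV[R]_d -> R) (a b T : R).
Local Notation tame_vector D :=
  (@tame_vector R (d + D) d Theta phi quantile_coordinate _).

Lemma tame_input D : tame_vector D (fun _ u => input a b u).
Proof.
move=> i; have := tame_in_add (tame_in_cst phi (@quantile_coordinate R d D) a)
  (tame_in_mul (tame_in_cst _ _ (b - a)) (tame_in_coord _ _ (lshift D i))).
move=> /(_ Theta)/tame_in_ext; apply => _ u.
by rewrite coordinates_lshift !mxE.
Qed.

Lemma tame_gaussian D n c (k : 'I_n -> 'I_D) : tame_vector D
  (fun _ u => c *: \col_i normal_quantile (u (rshift d (k i)) ord0)).
Proof.
apply: tame_vector_scale => i; have := tame_in_coord phi quantile_coordinate (rshift d (k i)).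
move=> /(_ Theta)/tame_in_ext; apply => _ u.
by rewrite coordinates_rshift mxE.
Qed.

(** The argument of [phi] is linear in the coordinates in the additive case, a
    coordinate times the exponential of a linear form in the geometric case, and
    a polynomial, by induction on the steps, for the Euler scheme. *)
Lemma kolmogorov_F_tame mu sigma D (F : 'cV[R]_(d + D) -> R) :
  kolmogorov_F phi mu sigma a b T F ->
  tame_in_coordinates phi quantile_coordinate (fun _ : Theta => F).
Proof.
case=> [mubar sigmabar _ _|mubar sigmabar _ _|M affmu affsigma _].
- apply: tame_in_phi; apply: tame_vector_add.
    by apply: tame_vector_add; [exact: tame_vector_cst|exact: tame_input].
  apply: tame_vector_mulmx => [i j|i]; first exact: tame_in_cst.
  apply: tame_in_ext (@tame_gaussian d d (Num.sqrt T) id i) _ => _ u.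
  by rewrite !mxE.
- apply: tame_in_phi => i.
  pose c0 := (mubar i ord0 - 2^-1 * (\sum_j sigmabar i j ^+ 2)) * T.
  pose c (k : 'I_(d + d)) := if fintype.split k is inr j
    then sigmabar i j * Num.sqrt T else 0.
  have te : tame_in_coordinates phi quantile_coordinate
      (fun (_ : Theta) u => expR (\sum_k c k * coordinates (@quantile_coordinate R d d) u k)).
    by exists (fun _ z => expR (\sum_k c k * z k)); split=> //; exact: tame_exp.
  have := tame_in_mul (tame_input d i)
    (tame_in_mul (tame_in_cst _ _ (expR c0)) te).
  move=> /tame_in_ext; apply => _ u; rewrite mxE -expRD; congr (_ * expR (_ + _)).
  rewrite [RHS]big_split_ord/= [X in _ = X + _]big1 ?add0r => [|j _]; last first.
    by rewrite /c (unsplitK (inl j : 'I_d + 'I_d)%type) mul0r.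
  apply: eq_bigr => j _; rewrite coordinates_rshift !mxE.
  by rewrite /c (unsplitK (inr j : 'I_d + 'I_d)%type) mulrA.
- apply: tame_in_phi; rewrite /F_euler/=.
  pose z (u : 'cV[R]_(d + M * d)) k := Num.sqrt (T / M%:R) *:
    map_mx (@normal_quantile R) (row k (vec_mx (dsubmx u)^T : 'M[R]_(M, d)))^T.
  (* The starting point of the scheme has to vary with the point of the cube. *)
  suff euler l (s : Theta -> 'cV[R]_(d + M * d) -> 'cV[R]_d) :
      tame_vector (M * d) s -> tame_vector (M * d) (fun th u => foldl
        (fun s k => s + (T / M%:R) *: mu s + sigma s *m z u k) (s th u) l).
    exact: (euler (enum 'I_M) _ (tame_input (M * d))).
  elim: l s => [|k l IH] s ts /=; first exact: ts.
  apply: (IH (fun th u =>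
    s th u + (T / M%:R) *: mu (s th u) + sigma (s th u) *m z u k)).
  apply: tame_vector_add.
    apply: tame_vector_add => //; apply: tame_vector_scale => i.
    exact: tame_in_affine.
  apply: tame_vector_mulmx => [i j|i]; first exact: tame_in_affine.
  apply: tame_in_ext (@tame_gaussian (M * d) d (Num.sqrt (T / M%:R))
    (fun j => mxvec_index k j) i) _ => _ u.
  by rewrite !mxE.
Qed.

End kolmogorov.

(** * The expected excess risk of the learning problem *)

Section learning_problem.
Context {R : realType} (a b T : R) {d D : nat} (phi : 'cV[R]_d -> R).
Variables (mu : 'cV[R]_d -> 'cV[R]_d) (sigma : 'cV[R]_d -> 'M[R]_d).
Variables (F : 'cV[R]_(d + D) -> R) (h : seq nat) (r : R).
Hypotheses (ab : a < b) (r0 : 0 < r).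
Hypothesis phi_smooth : smooth phi.
Hypothesis phi_growth : poly_growing_partials phi.
Hypothesis FE : kolmogorov_F phi mu sigma a b T F.

(** Functions of the class rather than weights are the index: the empirical
    minimizer is only given as a function. *)
Let Theta := {f | hypothesis_class a b r d h f}.

Let loss (f : Theta) (u : 'cV[R]_(d + D)) : R :=
  (sval f (input a b u) - F u) ^+ 2.

Lemma input_cube (u : 'cV[R]_(d + D)) : interior_cube u -> cube a b d (input a b u).
Proof.
move=> iu i; rewrite !mxE; have /andP[/ltW u0 /ltW u1] := iu (lshift D i).
have ba : 0 <= b - a by rewrite subr_ge0 ltW.
rewrite lerDl mulr_ge0//= -lerBrDl.
by rewrite ler_piMr.
Qed.

(** Choosing weights for every function of the class makes the loss a tame family
    over the class, as the points of the cube are mapped to [[a, b] ^ d], where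
    the restriction of the network to [[a, b] ^ d] is the network. *)
Lemma loss_box_approximation eps : 0 < eps -> exists C, 0 <= C /\
  forall n, (0 < n)%N -> box_approximation loss
    (fun u => C / n%:R * (n%:R `^ eps + boundary_moment u)) (C * n%:R `^ eps).
Proof.
move=> eps0.
have /choice[q hq] : forall f : Theta, exists th : params R d h,
    params_bounded r th /\ sval f = network th \_ (cube a b d).
  by move=> [f [th ?]]; exists th.
pose diff (f : Theta) (u : 'cV[R]_(d + D)) := network (q f) (input a b u) - F u.
have td : tame_in_coordinates phi quantile_coordinate diff.
  have tn := tame_in_network (ltW r0) (fun f => proj1 (hq f))
    (tame_input (Theta := Theta) phi a b D).
  have tF := kolmogorov_F_tame (Theta := Theta) FE.
  apply: tame_in_ext (tame_in_add tn (tame_in_mul (tame_in_cst _ _ (- 1)) tF)) _.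
  by move=> f u; rewrite mulN1r.
have [G [tG GE]] := tame_in_mul td td.
have [c [c0 hc]] := tame_box_approximation phi_smooth phi_growth
  (@le_quantile_coordinate R d D) quantile_coordinate_moment tG.
have c1 : 0 < c + 1 by rewrite ltr_wpDl.
have [C [C0 hC]] := hc _ (divr_gt0 eps0 c1).
exists C; split=> // n n0.
have n1 : 1 <= n%:R :> R by rewrite ler1n.
have le_pow : n%:R `^ (c * (eps / (c + 1))) <= n%:R `^ eps :> R.
  rewrite ler_powR// mulrA ler_pdivrMr// mulrDr mulr1 mulrC lerDl ltW//.
apply: box_approximation_sub (hC n n0).
- move=> f u iu; rewrite -GE /loss expr2; have [_ ->] := hq f.
  by rewrite patchE mem_set//; exact: input_cube.
- by move=> u _; rewrite ler_wpM2l ?divr_ge0// lerD2r.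
- by rewrite ler_wpM2l.
Qed.

Context {d0} {T0 : measurableType d0}.
Variables (P0 : probability T0 R) (U : T0 -> 'cV[R]_(d + D)) (fH : 'cV[R]_d -> R).
Hypothesis unifU : uniform_vector P0 U.
Hypothesis fH_argmin : is_argmin (hypothesis_class a b r d h) (risk P0 U F a b) fH.

(** Both sampling schemes enter only through the tails of the single points and
    the mean box error [kappa]. *)
Lemma expected_excess_risk_rate eps A : 0 < eps -> 0 <= A -> exists C, 0 <= C /\
  forall n, (0 < n)%N ->
  forall dO (Omega : measurableType dO) (P : probability Omega R)
    (u : nat -> Omega -> 'cV[R]_(d + D)) (f : Omega -> 'cV[R]_d -> R) kappa,
  (forall i, boundary_tails P (u i) A) ->
  (forall p, unit_corner p ->
    mean_le P (fun w => `|box_error n (u ^~ w) p|) kappa) ->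
  empirical_minimizer P n u F a b (hypothesis_class a b r d h) f ->
  exists e,
    (\int[P]_w (risk P0 U F a b (f w) - risk P0 U F a b fH) = e%:E)%E /\
    0 <= e <= C * n%:R `^ eps * (n%:R^-1 + kappa).
Proof.
move=> eps0 A0; have [C [C0 hC]] := loss_box_approximation eps0.
set s : R := (d + D)%N%:R.
exists (2 * C * (2 + s * 10 + s * (2 * (1 + 4 * A)))); split.
  by rewrite !(mulr_ge0, addr_ge0).
move=> n n0 dO Omega P u f kappa tu hbox [fH' _ fmin].
have [HfH minfH] := fH_argmin.
pose th w : Theta := exist _ (f w) (fH' w).
pose thH : Theta := exist _ fH HfH.
have riskE (g : Theta) : risk P0 U F a b (sval g) = population_risk loss P0 U g.
  by rewrite /risk unlock.
have nn0 : 0 < n%:R :> R by rewrite ltr0n.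
have [|||||e [eE /andP[e0 ele]]] := @expected_excess_risk R _ Theta loss _ _ _ _ _ unifU
    (C / n%:R) (n%:R `^ eps) (C * n%:R `^ eps) n _ _ n0 (hC n n0) _ _ P u A kappa th thH
    A0 tu hbox.
- by move=> g v; exact: sqr_ge0.
- by rewrite divr_ge0.
- exact: powR_ge0.
- by move=> g; rewrite -!riskE; apply: minfH; case: g.
- by apply: filterS fmin => w [_ /(_ _ HfH)].
exists e; split.
  by rewrite -eE; apply: eq_integral => w _; rewrite -(riskE (th w)) -(riskE thH).
rewrite e0 (le_trans ele)//.
have kappa0 : 0 <= kappa.
  have p0 : unit_corner (fun _ : 'I_(d + D) => 0 : R) by move=> j; rewrite lexx ler01.
  have [_ h0 /(le_trans _)] := hbox _ p0; rewrite -lee_fin; apply.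
  by apply: integral_ge0 => w _; rewrite lee_fin.
set q := n%:R `^ eps.
have q1 : 1 <= q by rewrite /q -[leLHS](powRr0 n%:R) ler_powR ?ler1n// ltW.
set v := n%:R^-1; have v0 : 0 <= v by rewrite invr_ge0 ltW.
have s0 : 0 <= s by exact: ler0n.
set x1 := s * 10; set x2 := s * (2 * (1 + 4 * A)).
have x10 : 0 <= x1 by rewrite mulr_ge0.
have x20 : 0 <= x2 by rewrite !(mulr_ge0, addr_ge0).
have -> : 2 * C * (2 + x1 + x2) * q * (v + kappa) = 2 *
  (C * v * (q + x1 * q) + (C * v * (q + x2 * q) + C * q * kappa)
   + C * (1 + x1 + x2) * q * kappa) by ring.
rewrite ler_wpM2l// (@le_trans _ _ (C * v * (q + x1 * q) +
  (C * v * (q + x2 * q) + C * q * kappa)))//; last first.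
  by rewrite lerDl !(mulr_ge0, addr_ge0)// (le_trans ler01).
by rewrite lerD// ?lerD2r ler_wpM2l ?mulr_ge0// lerD2l ler_peMr.
Qed.

End learning_problem.

(** * Rates of convergence *)

Lemma excess_risk_eqO (R : realType) (x : nat -> \bar R) (g : R^nat) C :
  (forall n, (0 < n)%N -> exists e, x n = e%:E /\ 0 <= e <= C * g n) ->
  exists2 e : R^nat, forall n, (0 < n)%N -> x n = (e n)%:E & e =O_\oo g.
Proof.
move=> hx; have /choice[e he] : forall n, exists e, (0 < n)%N ->
    x n = e%:E /\ 0 <= e <= C * g n.
  by move=> n; have [_|/hx[e ?]] := leqP n 0; [exists 0|exists e].
exists e; first by move=> n /he[].
apply/eqO_exP; exists (`|C| + 1); first by rewrite ltr_wpDl.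
exists 1%N => // n /= /he[_ /andP[e0 ele]]; rewrite ger0_norm// (le_trans ele)//.
by rewrite (le_trans (ler_norm _))// normrM ler_wpM2r// lerDl.
Qed.

(** The logarithmic factors of the discrepancy bound are absorbed by any
    positive power of the sample size. *)
Lemma linear_le_powR (R : realType) (beta : nat) (delta : R) :
  (1 < beta)%N -> 0 < delta -> exists C, 0 <= C /\
  forall m, 1 + beta%:R * m%:R <= C * (beta ^ m)%N%:R `^ delta.
Proof.
move=> b1 delta0; have lb0 : 0 < ln beta%:R :> R by rewrite ln_gt0// ltr1n.
have b0 : 0 < beta%:R :> R by rewrite ltr0n ltnW.
pose k := beta%:R / (delta * ln beta%:R); have k0 : 0 <= k.
  by rewrite divr_ge0// mulr_ge0// ltW.
exists (1 + k); split; first by rewrite addr_ge0.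
move=> m; rewrite natrX /powR gt_eqF ?exprn_gt0// lnXn//.
set y := delta * _; have y0 : 0 <= y by rewrite mulr_ge0 ?mulrn_wge0// ltW.
have -> : beta%:R * m%:R = k * y.
  rewrite /k /y -mulr_natr; field.
  by rewrite mul1r !gt_eqF.
have ey := expR_ge1Dx y; rewrite mulrDl mul1r lerD ?ler_wpM2l//; lra.
Qed.

Theorem theorem3p4 (R : realType) (a b T : R) (d : nat)
    (phi : 'cV[R]_d -> R) (mu : 'cV[R]_d -> 'cV[R]_d)
    (sigma : 'cV[R]_d -> 'M[R]_d) (D : nat) (F : 'cV[R]_(d + D) -> R)
    (L : nat) (h : seq nat) (r : R)
    (d0 : measure_display) (T0 : measurableType d0) (P0 : probability T0 R)
    (U : T0 -> 'cV[R]_(d + D)) (fH : 'cV[R]_d -> R) :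
  a < b -> 0 < T -> (0 < d)%N ->
  smooth phi -> poly_growing_partials phi ->
  kolmogorov_F phi mu sigma a b T F ->
  (2 <= L)%N -> size h = L.-1 -> (forall k, k \in h -> (0 < k)%N) -> 0 < r ->
  uniform_vector P0 U ->
  is_argmin (hypothesis_class a b r d h) (risk P0 U F a b) fH ->
  (forall (dO : measure_display) (Omega : measurableType dO)
      (P : probability Omega R) (u : nat -> Omega -> 'cV[R]_(d + D))
      (beta : nat) (hb : (1 < beta)%N) (t : nat)
      (f : nat -> Omega -> 'cV[R]_d -> R),
    scrambled_ts_sequence P hb t u ->
    (forall m, (0 < m)%N ->
      empirical_minimizer P (beta ^ m) u F a b
        (hypothesis_class a b r d h) (f (beta ^ m)%N)) ->
    forall eps : R, 0 < eps ->
    exists2 e : R^nat,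
      forall m, (0 < m)%N ->
        (\int[P]_w (risk P0 U F a b (f (beta ^ m)%N w) - risk P0 U F a b fH)
          = (e m)%:E)%E &
      e =O_\oo (fun m => (beta ^ m)%N%:R `^ (-1 + eps)))
  /\
  (forall (dO : measure_display) (Omega : measurableType dO)
      (P : probability Omega R) (u : nat -> Omega -> 'cV[R]_(d + D))
      (f : nat -> Omega -> 'cV[R]_d -> R),
    iid_uniform P u ->
    (forall n, (0 < n)%N ->
      empirical_minimizer P n u F a b (hypothesis_class a b r d h) (f n)) ->
    forall eps : R, 0 < eps ->
    exists2 e : R^nat,
      forall n, (0 < n)%N ->
        (\int[P]_w (risk P0 U F a b (f n w) - risk P0 U F a b fH)
          = (e n)%:E)%E &
      e =O_\oo (fun n => n%:R `^ (- 2^-1 + eps))).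
Proof.
move=> ab _ d_gt0 phi_smooth phi_growth FE _ _ _ r0 unifU fH_argmin.
have rate := expected_excess_risk_rate ab r0 phi_smooth phi_growth FE unifU fH_argmin.
split=> [dO Omega P u beta hb t f scr fmin eps eps0
        |dO Omega P u f iid fmin eps eps0].
- have s_gt0 : (0 < d + D)%N by rewrite addn_gt0 d_gt0.
  have [tu hbox] := scrambled_box_error s_gt0 scr.
  have sR0 : 0 < (d + D)%:R :> R by rewrite ltr0n.
  have e20 : 0 < eps / 2 by rewrite divr_gt0.
  have [C [C0 hC]] := rate _ _ e20 (ler0n R beta).
  have [B [B0 hB]] := linear_le_powR hb (divr_gt0 e20 sR0).
  apply: (@excess_risk_eqO _ _ _ (C * (1 + (beta ^ t)%N%:R * B ^+ (d + D)))) => m m0.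
  have n0 : (0 < beta ^ m)%N by rewrite expn_gt0 ltnW.
  have [e [-> /andP[e0 ele]]] := hC _ n0 _ _ P u _ _ tu (hbox m) (fmin m m0).
  exists e; split=> //; rewrite e0 (le_trans ele)//.
  move: (hB m); set n : R := (beta ^ m)%N%:R => hBm.
  have n_gt0 : 0 < n by rewrite ltr0n.
  have pw : (1 + beta%:R * m%:R) ^+ (d + D) <= B ^+ (d + D) * n `^ (eps / 2).
    rewrite (@le_trans _ _ ((B * n `^ (eps / 2 / (d + D)%:R)) ^+ (d + D)))//.
      by rewrite lerXn2r// nnegrE ?addr_ge0 ?mulr_ge0 ?powR_ge0.
    by rewrite exprMn -[(_ `^ _) ^+ _]powR_mulrn ?powR_ge0// -powRrM divfK// gt_eqF.
  have -> : n `^ (-1 + eps) = n^-1 * n `^ (eps / 2) * n `^ (eps / 2).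
    rewrite -powR_inv1 ?ltW// -!powRD ?(gt_eqF n_gt0) ?implybT//.
    by congr (_ `^ _); field.
  have q1 : 1 <= n `^ (eps / 2).
    by rewrite -[leLHS](powRr0 n) ler_powR ?ler1n// ltW.
  move: pw q1; set q := n `^ _; set X := _ ^+ _; set bt : R := (beta ^ t)%N%:R.
  move=> pw q1; have q0 : 0 <= q by exact: le_trans q1.
  have -> : C * q * (n^-1 + bt * X / n) = C * q * n^-1 * (1 + bt * X) by ring.
  have -> : C * (1 + bt * B ^+ (d + D)) * (n^-1 * q * q) =
      C * q * n^-1 * (q + bt * (B ^+ (d + D) * q)) by ring.
  by rewrite ler_wpM2l ?mulr_ge0 ?invr_ge0 ?(ltW n_gt0)// lerD// ler_wpM2l.
- have [C [C0 hC]] := rate _ _ eps0 ler01.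
  apply: (@excess_risk_eqO _ _ _ (C * 2)) => n n0.
  have tu i := uniform_vector_tails (proj1 iid i).
  have hbox (p : 'I_(d + D) -> R) := iid_box_error (p := p) n0 iid.
  have [e [-> /andP[e0 ele]]] := hC _ n0 _ _ P u _ _ tu hbox (fmin n n0).
  exists e; split=> //; rewrite e0 (le_trans ele)//.
  have n_gt0 : 0 < n%:R :> R by rewrite ltr0n.
  rewrite -powR12_sqrt ?(ltW n_gt0)// -powRN -powR_inv1 ?(ltW n_gt0)//.
  have le_half : n%:R `^ (-1) <= n%:R `^ (- 2^-1) :> R.
    by rewrite ler_powR ?ler1n// lerN2 invf_le1// ler1n.
  rewrite powRD ?(gt_eqF n_gt0) ?implybT//.
  rewrite -!mulrA ler_wpM2l// [leRHS]mulrA [leRHS]mulrC ler_wpM2l ?powR_ge0//.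
  by rewrite mulrDl mul1r lerD2r.
Qed.
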